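(* Let $\alpha\ge-\tfrac12$, $d_\alpha=2\alpha+2$. Let $\phi,\psi:(0,\infty)\to(0,\infty)$ satisfy the doubling condition. Let $\rho:(0,\infty)\to(0,\infty)$ satisfy $\int_0^1\frac{\rho(t)}{t}dt<\infty$ and the doubling condition. Assume there exists $C>0$ such that for all $r>0$, $$\phi(r)\int_0^r\frac{\rho(t)}{t}dt+\int_r^\infty\frac{\rho(t)\phi(t)}{t}dt\le C\psi(r).$$ Then for each $1<p<\infty$, $T^\alpha_\rho$ is bounded from $L^{p,\phi}(\mathbb{R},d\mu_\alpha)$ to $L^{p,\psi}(\mathbb{R},d\mu_\alpha)$.
   Context: Dunkl setting on $\mathbb{R}$: fix $\alpha\ge-\frac12$, $d_\alpha=2\alpha+2$, $d\mu_\alpha(x)=A_\alpha|x|^{2\alpha+1}dx$ with $A_\alpha=(2^{\alpha+1}\Gamma(\alpha+1))^{-1}$; $B(0,r)=(-r,r)$. For $x,y,z\in\mathbb{R}$ let $\sigma_{x,y,z}=\frac{x^2+y^2-z^2}{2xy}$ if $x,y\neq0$ and $0$ otherwise; let $\kappa_\alpha(|x|,|y|,|z|)=D_\alpha\frac{([(|x|+|y|)^2-z^2][z^2-(|x|-|y|)^2])^{\alpha-1/2}}{|xyz|^{2\alpha}}$ if $|z|\in[\,||x|-|y||,|x|+|y|\,]$ and $0$ otherwise, where $D_\alpha=\Gamma(\alpha+1)^2/(2^{\alpha-1}\sqrt\pi\,\Gamma(\alpha+\frac12))$; let $W_\alpha(x,y,z)=(1-\sigma_{x,y,z}+\sigma_{z,x,y}+\sigma_{z,y,x})\kappa_\alpha(|x|,|y|,|z|)$.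 The Dunkl translation is $\tau_x^\alpha f(y)=\int_{\mathbb{R}}f(z)W_\alpha(x,y,z)d\mu_\alpha(z)$ for $x,y\neq0$, $\tau_x^\alpha f(0)=f(x)$, $\tau_0^\alpha f(y)=f(y)$ (extended to $L^p$/locally integrable functions in the usual way). $\theta:(0,\infty)\to(0,\infty)$ satisfies the doubling condition if there is $C>0$ with $\frac1C\le\frac{\theta(r)}{\theta(s)}\le C$ whenever $\frac12\le\frac rs\le2$. For $1\le p<\infty$, the generalized Dunkl-type Morrey space $L^{p,\phi}(\mathbb{R},d\mu_\alpha)$ consists of locally $p$-integrable $f$ with $\|f\|_{L^{p,\phi}}:=\sup_{r>0,x\in\mathbb{R}}\frac1{\phi(r)}\big(\frac1{r^{d_\alpha}}\int_{B(0,r)}\tau^\alpha_x|f|^p(y)d\mu_\alpha(y)\big)^{1/p}<\infty$. $T^\alpha_\rho f(x)=\int_{\mathbb{R}}f(y)\,\tau_x^\alpha\Big(\frac{\rho(|\cdot|)}{|\cdot|^{d_\alpha}}\Big)(y)\,d\mu_\alpha(y)$. *)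

(* Defs.v *)
From HB Require Import structures.
From mathcomp Require Import all_boot all_order all_algebra.
From mathcomp Require Import all_classical all_reals all_analysis.
Set Implicit Arguments. Unset Strict Implicit. Unset Printing Implicit Defensive.
Import Order.TTheory GRing.Theory Num.Theory.
Import numFieldNormedType.Exports.
Local Open Scope classical_set_scope.
Local Open Scope ring_scope.

Section Dunkl.
Variable R : realType.
Local Notation leb := (@lebesgue_measure R).

Definition Gamma (s : R) : R :=
  Rintegral leb `]0, +oo[ (fun t => t `^ (s - 1) * expR (- t)).

Definition d_alpha (a : R) : R := 2 * a + 2.

Definition A_alpha (a : R) : R := (2 `^ (a + 1) * Gamma (a + 1))^-1.

Definition w_alpha (a : R) (x : R) : R := A_alpha a * `|x| `^ (2 * a + 1).

Definition int_mu (a : R) (D : set R) (f : R -> R) : \bar R :=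
  (\int[leb]_(x in D) (f x * w_alpha a x)%:E)%E.

Definition Rint_mu (a : R) (D : set R) (f : R -> R) : R :=
  Rintegral leb D (fun x => f x * w_alpha a x).

Definition sigma3 (x y z : R) : R :=
  if (x != 0) && (y != 0) then (x ^+ 2 + y ^+ 2 - z ^+ 2) / (2 * x * y) else 0.

Definition D_alpha (a : R) : R :=
  Gamma (a + 1) ^+ 2 / (2 `^ (a - 1) * Num.sqrt pi * Gamma (a + 2^-1)).

Definition kappa (a : R) (x y z : R) : R :=
  if (`| `|x| - `|y| | <= `|z|) && (`|z| <= `|x| + `|y|) then
    D_alpha a *
      ((((`|x| + `|y|) ^+ 2 - z ^+ 2) * (z ^+ 2 - (`|x| - `|y|) ^+ 2)) `^ (a - 2^-1))
      / (`|x * y * z| `^ (2 * a))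
  else 0.

Definition W_alpha (a : R) (x y z : R) : R :=
  (1 - sigma3 x y z + sigma3 z x y + sigma3 z y x) * kappa a x y z.

(* Dunkl translation tau_x^alpha f (y).  For alpha = -1/2 the kernel formula
   degenerates (Gamma(0)); the Dunkl operator is then d/dx and tau_x is the
   ordinary translation f(x+y). *)
Definition dunkl_tau (a : R) (x : R) (f : R -> R) (y : R) : R :=
  if a == - 2^-1 then f (x + y)
  else if x == 0 then f y
  else if y == 0 then f x
  else Rint_mu a setT (fun z => f z * W_alpha a x y z).

Definition ball0 (r : R) : set R := `](- r), r[%classic.

Definition doubling (theta : R -> R) : Prop :=
  exists C : R, 0 < C /\
    forall r s : R, 0 < r -> 0 < s -> 2^-1 <= r / s <= 2 ->
      C^-1 <= theta r / theta s <= C.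

Definition loc_p_integrable (a p : R) (f : R -> R) : Prop :=
  measurable_fun setT f /\
  forall r : R, 0 < r ->
    (int_mu a (ball0 r) (fun y => (`|f y| `^ p)%R) < +oo)%E.

Definition morrey_norm (a p : R) (phi : R -> R) (f : R -> R) : \bar R :=
  ereal_sup [set (((phi r)^-1)%R%:E *
       poweR ((r `^ (- d_alpha a))%R%:E *
              int_mu a (ball0 r) (dunkl_tau a x (fun z => (`|f z| `^ p)%R))) (p^-1)%R)%E
     | r in [set r : R | (0 < r)%R] & x in [set: R]]%classic.

Definition morrey_space (a p : R) (phi : R -> R) (f : R -> R) : Prop :=
  loc_p_integrable a p f /\ (morrey_norm a p phi f < +oo)%E.

Definition rho_kernel (a : R) (rho : R -> R) (y : R) : R :=
  rho `|y| / `|y| `^ d_alpha a.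

Definition T_rho (a : R) (rho : R -> R) (f : R -> R) (x : R) : R :=
  Rint_mu a setT (fun y => f y * dunkl_tau a x (rho_kernel a rho) y).

End Dunkl.

(* Main.v *)
(* Let P_h(x, y) be the Bessel translation of an even function h >= 0 (for
   alpha = -1/2, the sum of its translates at x + y and x - y).  The Dunkl
   average of g >= 0 over B(0, r) is nonnegative, at most a multiple of
   int g P_{1_B(0,r)}(x, .) dmu, and its values at x and -x add up to at least
   this integral, because the remaining part of the Dunkl kernel is odd.  The
   Morrey norms are thus comparable with averages against P_{1_B(0,r)}, and
   |T_rho f| <= 4 int |f| P_K(x, .) dmu with K = rho(|.|)/|.|^d.

   Split K at radius r.  For the part near 0, the mass bound of P and Holder's
   inequality give an L^p estimate; it can be localized because P_h(z, y) with h
   supported in B(0, r) moves a ball of radius r at x into one of radius 3r.  The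
   tail is an integral of indicators, K(u) <= C int_r^oo rho(t) t^{-d-1} 1_{|u|<t}
   dt, and is estimated by Holder's inequality on each ball B(0, t).  No maximal
   function is needed.  The mass and ball estimates for P come from the explicit
   kernel: after u -> u^2 it is a beta density on
   [(|x|-|y|)^2, (|x|+|y|)^2]. *)
From HB Require Import structures.
From mathcomp Require Import all_boot all_order all_algebra.
From mathcomp Require Import all_classical all_reals all_analysis measurable_realfun.
From mathcomp Require Import ring lra.
Require Import Defs.
Set Implicit Arguments. Unset Strict Implicit. Unset Printing Implicit Defensive.
Import Order.TTheory GRing.Theory Num.Theory.
Import numFieldNormedType.Exports.
Local Open Scope classical_set_scope.
Local Open Scope ring_scope.

(** The kernel of the Dunkl translation takes both signs, so Tonelli's theorem and monotonicity do
    not apply to [dunkl_tau] itself. The estimates are carried out for a nonnegative kernel [P] with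
    values in [\bar R], where no convergence has to be known in advance. [P] is kept abstract
    (positivity, symmetry, mass, domination by balls, comparison of balls), so that one argument
    serves [a > -1/2] and also [a = -1/2], where the kernel formula is meaningless. The exact mass
    of the Bessel kernel is never computed: [D_alpha] and [A_alpha] enter only through their
    positivity. The comparison of balls rests on size: for [|z|] within [r] of [|x|], the average of
    the ball of radius [r] is at most of order [min(1, (r/|x|)^(2a+1))], and that of the ball of
    radius [3r] is at least of this order at every [y] with [|y|] within [2r] of [|x|]. The origin
    is exceptional. For [a > -1/2] it carries no weight as a point of integration; as the centre of
    an average it is replaced by the point [r], whose ball of radius [3r] covers [B(0, r)]. *)

Section integration_tools.
Context {R : realType}.
Local Notation leb := (@lebesgue_measure R).
Local Open Scope ereal_scope.

Lemma ge0_leint (D : set R) (f g : R -> \bar R) :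
  (forall x : R, D x -> 0 <= f x) -> (forall x : R, D x -> f x <= g x) ->
  \int[leb]_(x in D) f x <= \int[leb]_(x in D) g x.
Proof.
move=> f0 fg; have g0 x : D x -> 0 <= g x by move=> Dx; exact: le_trans (f0 _ Dx) (fg _ Dx).
(* The integral of a nonnegative function, measurable or not, is a supremum
   over the simple functions below it. *)
rewrite !ge0_integralE//; apply: ereal_sup_le => _ /= [h hf <-].
exists h => //= x; apply: le_trans (hf x) _.
by rewrite !patchE; case: ifPn => // /set_mem; exact: fg.
Qed.

(** The image of Lebesgue measure under a translation agrees with it on half-open intervals, and
    these determine it. *)
Lemma integral_translate (f : R -> \bar R) (c : R) :
  measurable_fun setT f -> (forall x, 0 <= f x) ->
  \int[leb]_x f (c + x)%R = \int[leb]_x f x.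
Proof.
move=> mf f0.
pose phi : R -> measurableTypeR R := fun x => (c + x)%R.
have mphi : measurable_fun setT phi by apply: measurable_funD.
transitivity (\int[pushforward leb phi]_y f y); last first.
  apply: eq_measure_integral => A mA _.
  apply/esym/lebesgue_measure_unique => // _ [[a b]] _ <-.
  transitivity (leb `](a - c)%R, (b - c)%R]%classic).
    rewrite /= !lebesgue_measure_itv/= !lte_fin ltrD2r.
    by case: ifP => // _; rewrite -!EFinD; congr EFin; lra.
  congr (leb _); apply/seteqP; split => x /=; rewrite /phi !in_itv/= => /andP[? ?]; apply/andP; split; lra.
by rewrite ge0_integral_pushforward// => y _; exact: f0.
Qed.

Lemma integral_reflect (f : R -> \bar R) :
  measurable_fun setT f -> (forall x, 0 <= f x) ->
  \int[leb]_x f (- x)%R = \int[leb]_x f x.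
Proof.
move=> mf f0.
pose phi : R -> measurableTypeR R := fun x => (- x)%R.
have mphi : measurable_fun setT phi by exact: oppr_measurable.
transitivity (\int[pushforward leb phi]_y f y); last first.
  by apply: eq_measure_integral => A mA _; exact: lebesgue_measureN.
by rewrite ge0_integral_pushforward// => y _; exact: f0.
Qed.

(** Reflection exchanges the positive and the negative part; integrability excludes [+oo - +oo]. *)
Lemma integral_odd (f : R -> R) : leb.-integrable setT (EFin \o f) ->
  (forall x, f (- x) = - f x)%R -> \int[leb]_x (f x)%:E = 0.
Proof.
move=> intf fN; rewrite integralE.
have mfE : measurable_fun setT (EFin \o f) by exact: measurable_int intf.
rewrite (_ : \int[leb]_x (EFin \o f)^\- x = \int[leb]_x (EFin \o f)^\+ x).
  by rewrite subee//; exact: integrable_pos_fin_num.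
rewrite -(integral_reflect (f := (EFin \o f)^\-)) //; last exact: measurable_funeneg.
by apply: eq_integral => x _; rewrite funenegE funeposE/= fN opprK.
Qed.

Lemma integral_abs_sym (g : R -> R) : measurable_fun setT (fun x : R => g `|x|%R) ->
  (forall x, 0 <= g x)%R ->
  \int[leb]_x (g `|x|%R)%:E = 2%:E * \int[leb]_(x in `]0%R, +oo[) (g x)%:E.
Proof.
move=> mg g0; pose G (x : R) := (g `|x|%R)%:E.
have mG : measurable_fun setT G by exact/measurable_EFinP.
have G0 x : 0 <= G x by rewrite lee_fin.
have -> : \int[leb]_x (g `|x|%R)%:E = \int[leb]_(x in `]-oo, 0%R] `|` `]0%R, +oo[) G x.
  rewrite (_ : _ `|` _ = setT)//; apply/seteqP; split => // x _ /=.
  by rewrite !in_itv/= andbT; case: (leP x 0%R); [left|right].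
rewrite ge0_integral_setU//=; last 2 first.
- exact: measurable_funTS.
- apply/disj_setPS => x /= []; rewrite !in_itv/= andbT => ? ?; lra.
have -> : \int[leb]_(x in `]-oo, 0%R]) G x = \int[leb]_(x in `[0%R, +oo[) G x.
  rewrite ge0_integration_by_substitution0//; apply: eq_integral => x _.
  by rewrite /G normrN.
rewrite -integral_itv_obnd_cbnd; last exact: measurable_funTS.
rewrite (_ : 2%:E = 1 + 1)// ge0_muleDl// mul1e.
by congr (_ + _); apply: eq_integral => x; rewrite inE/= in_itv/= andbT => x0; rewrite /G gtr0_norm.
Qed.

End integration_tools.

(** * Powers: limits at 0, integration up to singular endpoints, positivity of Gamma *)

Section ftc_open_interval.
Context {R : realType}.
Local Notation leb := (@lebesgue_measure R).

(** The limit [l = 0] is the point of interest: differentiability of the power fails there for small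
    [s], yet antiderivatives such as [x^s / s] have to be followed up to that endpoint. *)
Lemma cvg_powR (T : Type) (F : set_system T) (FF : Filter F) (G : T -> R) (l s : R) :
  0 < s -> (\forall x \near F, 0 <= G x) -> 0 <= l -> G @ F --> l ->
  (fun x => G x `^ s) @ F --> l `^ s.
Proof.
move=> s0 G0; rewrite le_eqVlt => /predU1P[<-|l0] Gl; last first.
  apply: (@cvg_comp _ _ _ G (fun y : R => y `^ s) _ _ _ Gl).
  have := @derivable_powR R 1 s l; rewrite in_itv/= andbT => /(_ l0).
  by move=> /derivable1_diffP/differentiable_continuous.
rewrite powR0 ?gt_eqF//; apply/cvgrPdist_lt => e e0.
have e1 : 0 < e `^ s^-1 by rewrite powR_gt0.
move/cvgrPdist_lt : Gl => /(_ _ e1) Gl; near=> x.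
have Gx0 : 0 <= G x by near: x.
have : `|0 - G x| < e `^ s^-1 by near: x.
rewrite !sub0r !normrN !ger0_norm ?powR_ge0// => Gxe.
rewrite (_ : e = (e `^ s^-1) `^ s); last first.
  by rewrite -powRrM mulVf ?gt_eqF// powRr1// ltW.
by apply: gt0_ltr_powR => //; rewrite nnegrE// powR_ge0.
Unshelve. all: by end_near. Qed.

(** The integrand may blow up at the endpoints, as [x^(s-1)] does at 0 for [s < 1]. The theorem for
    compact intervals is applied to an exhaustion of []a, b[]; nonnegativity gives monotone
    convergence of the integrals, and the one-sided limits of [F] give convergence of the
    increments. *)
Lemma ge0_FTC2_oo (f F : R -> R) (a b : R) : a < b ->
  {in `]a, b[, continuous f} ->
  (forall x, x \in `]a, b[ -> 0 <= f x) ->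
  (forall x, x \in `]a, b[ -> is_derive x 1 F (f x)) ->
  F x @[x --> a^'+] --> F a -> F x @[x --> b^'-] --> F b ->
  (\int[leb]_(x in `]a, b[) (f x)%:E = (F b - F a)%:E)%E.
Proof.
move=> ab cf f0 dF Fa Fb.
(* Since [harmonic 0 = 1], the factor 1/3 keeps the subinterval nondegenerate already for
   [n = 0]. *)
pose d n : R := (b - a) / 3 * harmonic n.
have d0 n : 0 < d n by rewrite /d mulr_gt0//= ?invr_gt0 ?divr_gt0 ?subr_gt0.
have d1 n : d n <= (b - a) / 3.
  have ba3 : 0 <= (b - a) / 3 by lra.
  by rewrite /d ler_piMr//= invf_le1// ler1n.
have dcvg : d @ \oo --> 0.
  by rewrite -[X in _ --> X](mulr0 ((b - a) / 3)); apply: cvgM; [exact: cvg_cst|exact: cvg_harmonic].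
have dd m n : (m <= n)%N -> d n <= d m.
  move=> mn; have ba3 : 0 <= (b - a) / 3 by lra.
  by rewrite /d ler_wpM2l//= lef_pV2 ?posrE// ler_nat.
pose I n := `[a + d n, b - d n]%classic.
have abn n : a + d n < b - d n by have := d1 n; have := d0 n; lra.
have Isub n x : x \in `[a + d n, b - d n] -> x \in `]a, b[.
  by rewrite !in_itv/= => /andP[? ?]; have := d0 n => ?; apply/andP; split; lra.
have cfn n : {within I n, continuous f}.
  by apply: continuous_in_subspaceT => x /set_mem xI; apply: cf; exact: Isub xI.
have cF x : x \in `]a, b[ -> {for x, continuous F}.
  by move=> /dF [dFx _]; apply: differentiable_continuous; exact/derivable1_diffP.
have FTC n : (\int[leb]_(x in I n) (f x)%:E = (F (b - d n) - F (a + d n))%:E)%E.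
  rewrite (@continuous_FTC2 _ f F)//; first exact: cfn.
  - have an : a + d n \in `]a, b[ by apply: (Isub n); rewrite in_itv/= lexx ltW.
    have bn : b - d n \in `]a, b[ by apply: (Isub n); rewrite in_itv/= lexx ltW.
    split.
    + move=> x xI; have /dF[] // : x \in `]a, b[.
      by apply: (Isub n); exact: subset_itv_oo_cc xI.
    + by apply: cvg_at_right_filter; exact: cF.
    + by apply: cvg_at_left_filter; exact: cF.
  - move=> x xI; have /dF[dFx dFE] : x \in `]a, b[.
      by apply: (Isub n); exact: subset_itv_oo_cc xI.
    by rewrite derive1E.
have IU : `]a, b[%classic = \bigcup_n I n.
  apply/seteqP; split => [x /=|x [n _ xI]]; last exact: (Isub n).
  rewrite in_itv/= => /andP[ax xb].
  have : 0 < Num.min (x - a) (b - x) by rewrite lt_min !subr_gt0 ax.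
  move=> m0; move/cvgrPdist_lt : dcvg => /(_ _ m0)[N _ /(_ N (leqnn N))].
  rewrite sub0r normrN gtr0_norm// lt_min => /andP[h1 h2].
  by exists N => //; rewrite /I/= in_itv/=; apply/andP; split; lra.
have cI : (fun n => \int[leb]_(x in I n) (f x)%:E)%E @ \oo
    --> (\int[leb]_(x in `]a, b[) (f x)%:E)%E.
  rewrite IU; apply: ge0_nondecreasing_set_cvg_integral => //.
  - move=> m n mn; apply/subsetPset => x; rewrite /I/= !in_itv/= => /andP[? ?].
    by have := dd _ _ mn => ?; apply/andP; split; lra.
  - by move=> i; exact: measurable_itv.
  - move=> i; apply/measurable_EFinP.
    by apply: subspace_continuous_measurable_fun => //; exact: measurable_itv.
  - by move=> i x /Isub/f0; rewrite lee_fin.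
(* The right filter at [a] asks for strict inequality besides convergence; it holds because every
   [d n] is positive. *)
have ra : (fun n => a + d n) @ \oo --> a^'+.
  move=> P aP; have : (fun n => a + d n) @ \oo --> a.
    by rewrite -[X in _ --> X]addr0; apply: cvgD => //; exact: cvg_cst.
  move=> H; have h : \forall n \near \oo, a < a + d n -> P (a + d n) := H _ aP.
  change (\forall n \near \oo, P (a + d n)).
  by apply: filterS h => n; apply; rewrite ltrDl.
have lb : (fun n => b - d n) @ \oo --> b^'-.
  move=> P aP; have : (fun n => b - d n) @ \oo --> b.
    by rewrite -[X in _ --> X]subr0; apply: cvgB => //; exact: cvg_cst.
  move=> H; have h : \forall n \near \oo, b - d n < b -> P (b - d n) := H _ aP.
  change (\forall n \near \oo, P (b - d n)).
  by apply: filterS h => n; apply; rewrite ltrBlDr ltrDl.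
rewrite -(cvg_lim (@ereal_hausdorff R) cI); apply/cvg_lim => //; under eq_fun do rewrite FTC.
apply: cvg_EFin; first by near=> n.
by apply: cvgB; [exact: (cvg_comp _ _ lb)|exact: (cvg_comp _ _ ra)].
Unshelve. all: by end_near. Qed.

Lemma integral_powR0 (s r : R) : 0 < s -> 0 < r ->
  (\int[leb]_(x in `]0%R, r[) (x `^ (s - 1))%:E = (r `^ s / s)%:E)%E.
Proof.
move=> s0 r0; pose F x : R := x `^ s / s.
transitivity ((F r - F 0)%:E); last by rewrite /F powR0 ?gt_eqF// mul0r subr0.
apply: ge0_FTC2_oo => //.
- move=> x; rewrite in_itv/= => /andP[x0 _].
  apply: differentiable_continuous; apply/derivable1_diffP.
  by apply: derivable_powR; rewrite in_itv/= x0.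
- by move=> x _; exact: powR_ge0.
- move=> x; rewrite in_itv/= => /andP[x0 _].
  have -> : F = (s^-1 \*: ((fun y : R => y `^ s)))%R by apply/funext => y; rewrite /F mulrC.
  have -> : x `^ (s - 1) = s^-1 *: (s * x `^ (s - 1)).
    by rewrite /GRing.scale/= mulrA mulVf ?gt_eqF// mul1r.
  by apply: is_deriveZ; exact: is_derive1_powR.
- apply: cvgM; last exact: cvg_cst.
  apply: cvg_powR => //; first by near=> x; apply: ltW; near: x; exact: nbhs_right_gt.
  by apply: cvg_at_right_filter; exact: cvg_id.
- apply: cvgM; last exact: cvg_cst.
  apply: cvg_powR => //; [|exact: ltW|].
    by near=> x; near: x; apply: nbhs_left_ge.
  by apply: cvg_at_left_filter; exact: cvg_id.
Unshelve. all: by end_near. Qed.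

(** From [u <= expR u] at [u = t / (2 s)], raised to the power [s]. *)
Lemma powR_le_expR (s : R) : 0 < s ->
  exists C : R, 0 < C /\ forall t, 0 < t -> t `^ s <= C * expR (t / 2).
Proof.
move=> s0; exists ((2 * s) `^ s); split; first by rewrite powR_gt0 ?mulr_gt0.
move=> t t0; have s20 : 0 < 2 * s by rewrite mulr_gt0.
have h : t / (2 * s) <= expR (t / (2 * s)).
  by apply: le_trans (expR_ge1Dx _); rewrite lerDr.
have -> : expR (t / 2) = expR (t / (2 * s)) `^ s.
  by rewrite -expRM; congr expR; rewrite invfM; field; rewrite gt_eqF.
rewrite -(powRM _ (ltW s20) (expR_ge0 _)); apply: (ge0_ler_powR (ltW s0)); rewrite ?nnegrE; try exact: ltW.
  by rewrite mulr_ge0 ?expR_ge0 ?ltW.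
by rewrite mulrC -ler_pdivrMr.
Qed.

Lemma measurable_Gamma_integrand (s : R) :
  measurable_fun setT (fun t : R => t `^ (s - 1) * expR (- t)).
Proof.
apply: measurable_funM; first exact: measurable_powR.
by apply: measurableT_comp; [exact: measurable_expR|exact: oppr_measurable].
Qed.

(** [Gamma] is the finite part of an integral and [fine +oo = 0], so positivity requires finiteness
    of the integral as well as a lower bound. *)
Lemma Gamma_gt0 (s : R) : 0 < s -> 0 < Gamma s.
Proof.
move=> s0; rewrite /Gamma /Rintegral.
set g := fun t : R => t `^ (s - 1) * expR (- t).
have g0 t : 0 <= g t by rewrite mulr_ge0 ?powR_ge0 ?expR_ge0.
have mg : measurable_fun setT g by exact: measurable_Gamma_integrand.
have mgE D : measurable_fun D (EFin \o g).
  by apply: measurable_funTS; exact/measurable_EFinP.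
apply: fine_gt0; apply/andP; split.
  (* On []1, 2[] one has [t^(s-1) = t^s / t >= 1/2] and [expR (- t) >= expR (- 2)]. *)
  apply: (@lt_le_trans _ _ (\int[leb]_(t in `]1%R, 2%R[) (expR (- 2) / 2)%:E)%E).
    rewrite (integral_cst _ _ (expR (- 2) / 2)%:E)//= lebesgue_measure_itv/= lte_fin ltr1n/= -EFinD -EFinM lte_fin.
    by rewrite mulr_gt0// ?divr_gt0 ?expR_gt0//; lra.
  apply: (@le_trans _ _ (\int[leb]_(t in `]1%R, 2%R[) (g t)%:E)%E).
    apply: ge0_leint => t /=; first by rewrite lee_fin divr_ge0 ?expR_ge0.
    rewrite in_itv/= => /andP[t1 t2]; rewrite lee_fin /g mulrC.
    apply: ler_pM; rewrite ?invr_ge0 ?expR_ge0//; last by rewrite ler_expR; lra.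
    have tn0 : t != 0 by rewrite gt_eqF//; lra.
    rewrite powRB ?tn0 ?implybT//.
    rewrite powRr1; last lra.
    rewrite -[2^-1]mul1r; apply: ler_pM => //; last by rewrite lef_pV2 ?posrE//; lra.
    by rewrite -(powRr0 t); apply: ler_powR; lra.
  apply: ge0_subset_integral => //; first exact: mgE.
    by move=> t _; rewrite lee_fin.
  by move=> t /=; rewrite !in_itv/= andbT => /andP[+ _]; apply: lt_trans.
have [C [C0 hC]] := powR_le_expR s0.
have -> : `]0%R, +oo[%classic = `]0%R, 1%R[%classic `|` `[1%R, +oo[%classic :> set R.
  apply/seteqP; split => [x|x [|]] /=; rewrite ?in_itv/= ?andbT; [|lra|lra].
  by case: (ltP x 1) => ? ?; [left; apply/andP|right].
rewrite ge0_integral_setU//=; last 3 first.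
- exact: mgE.
- by move=> t _; exact: g0.
- by apply/disj_setPS => x /= []; rewrite !in_itv/= andbT => /andP[? ?] ?; lra.
apply: lte_add_pinfty.
  apply: (@le_lt_trans _ _ (\int[leb]_(t in `]0%R, 1%R[) (t `^ (s - 1))%:E)%E).
    apply: ge0_leint => t /=; first by move=> _; exact: g0.
    rewrite in_itv/= => /andP[t1 t2]; rewrite lee_fin /g ler_piMr ?powR_ge0//.
    by rewrite -expR0 ler_expR; lra.
  by rewrite integral_powR0// ltry.
apply: (@le_lt_trans _ _ (\int[leb]_(t in `[1%R, +oo[) (C * expR (- (t / 2)))%:E)%E).
  apply: ge0_leint => t /=; first by move=> _; exact: g0.
  rewrite in_itv/= andbT => t1; rewrite lee_fin /g.
  (* One factor [expR (- (t / 2))] absorbs the power of [t], the other is integrable at infinity. *)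
  rewrite (_ : - t = - (t / 2) + - (t / 2)); last lra.
  rewrite expRD mulrA ler_pM2r ?expR_gt0//.
  apply: (@le_trans _ _ (t `^ s * expR (- (t / 2)))).
    by rewrite ler_pM2r ?expR_gt0//; apply: ler_powR => //; lra.
  by rewrite expRN ler_pdivrMr ?expR_gt0//; apply: hC; lra.
rewrite (@ge0_continuous_FTC2y _ _ (fun t => - 2 * C * expR (- (t / 2))) _ 0) ?ltry//.
- by move=> x _; rewrite mulr_ge0 ?expR_ge0 ?ltW.
- apply: continuous_subspaceT => x; apply: cvgM; first exact: cvg_cst.
  apply: (continuous_comp (f := fun t : R => - (t / 2))); last exact: continuous_expR.
  by apply: cvgN; apply: cvgM; [exact: cvg_id|exact: cvg_cst].
- rewrite -[X in _ --> X](mulr0 (- 2 * C)); apply: cvgM; first exact: cvg_cst.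
  apply: (@cvg_comp _ _ _ (fun t : R => t / 2) (fun u => expR (- u)) _ (@pinfty_nbhs R)).
    apply/cvgryPge => A; near=> t; rewrite ler_pdivlMr//.
  exact: cvgr_expR.
- apply: cvg_at_right_filter; apply: cvgM; first exact: cvg_cst.
  apply: (continuous_comp (f := fun t : R => - (t / 2))); last exact: continuous_expR.
  by apply: cvgN; apply: cvgM; [exact: cvg_id|exact: cvg_cst].
- move=> x _; rewrite derive1E derive_val.
  by rewrite /GRing.scale/=; field.
Unshelve. all: by end_near. Qed.

End ftc_open_interval.

Lemma measurable_norm_comp (R : realType) d (T : measurableType d) (f : T -> R) :
  measurable_fun setT f -> measurable_fun setT (fun t => `|f t|).
Proof. by move=> mf; exact: measurableT_comp. Qed.

(** Dispatches on the head operation of the function. Inverses have no clause of their own: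
    quotients with a variable denominator are first rewritten as powers with a negative exponent. *)
Ltac measurability_step := lazymatch goal with
  | |- measurable_fun _ (fun x => @GRing.mul _ (@?f x) (@?g x)) => apply: measurable_funM
  | |- measurable_fun _ (fun x => @GRing.add _ (@?f x) (@GRing.opp _ (@?g x))) => apply: measurable_funB
  | |- measurable_fun _ (fun x => @GRing.add _ (@?f x) (@?g x)) => first [apply: measurable_funD | apply: emeasurable_funD]
  | |- measurable_fun _ (fun x => @GRing.opp _ (@?f x)) => apply: (measurableT_comp (oppr_measurable _))
  | |- measurable_fun _ (fun x => EFin (@?f x)) => apply/measurable_EFinP
  | |- measurable_fun _ (fun x => mule (@?f x) (@?g x)) => apply: emeasurable_funM
  | |- measurable_fun _ (fun x => poweR (@?f x) ?s) => apply: (measurableT_comp (measurable_poweR s))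
  | |- measurable_fun _ (fun x => powR (@?f x) ?s) => apply: (measurableT_comp (measurable_powR s))
  | |- measurable_fun _ (fun x => andb (@?b x) (@?c x)) => apply: measurable_and
  | |- measurable_fun _ (fun x => @Order.lt _ _ (@?b x) (@?c x)) => apply: measurable_fun_ltr
  | |- measurable_fun _ (fun x => @Order.le _ _ (@?b x) (@?c x)) => apply: measurable_fun_ler
  | |- measurable_fun _ (fun x => @eq_op _ (@?b x) (@?c x)) => apply: measurable_fun_eqr
  | |- measurable_fun _ (fun x => negb (@?b x)) => apply: measurable_neg
  | |- measurable_fun _ (fun x => @Num.norm _ _ (@?b x)) => apply: measurable_norm_comp
  | |- measurable_fun _ (fun x => @GRing.exp _ (@?b x) ?n) => apply: measurable_funX
  | |- measurable_fun _ (fun x => fst x) => exact: measurable_fst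
  | |- measurable_fun _ (fun x => snd x) => exact: measurable_snd
  | |- measurable_fun _ (fun x => fst (fst x)) => exact: (measurableT_comp measurable_fst measurable_fst)
  | |- measurable_fun _ (fun x => snd (fst x)) => exact: (measurableT_comp measurable_snd measurable_fst)
  | |- measurable_fun _ (fun x => fst (snd x)) => exact: (measurableT_comp measurable_fst measurable_snd)
  | |- measurable_fun _ (fun x => snd (snd x)) => exact: (measurableT_comp measurable_snd measurable_snd)
  | |- measurable_fun _ (fun x => x) => exact: measurable_id
  | |- _ => first [exact: measurable_cst | apply: measurable_fun_ifT | apply: measurable_norm_comp
      | apply: measurable_fun_ltr]
  end.
Ltac measurability := repeat (first [assumption
  | match goal with H : forall _, measurable_fun _ _ |- measurable_fun _ _ => exact: H end
  | measurability_step]).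

Lemma powRD_gt0 (R : realType) (x r s : R) : 0 < x -> x `^ (r + s) = x `^ r * x `^ s.
Proof. by move=> x0; rewrite powRD// (gt_eqF x0) implybT. Qed.

Lemma powRB_gt0 (R : realType) (x r s : R) : 0 < x -> x `^ (r - s) = x `^ r / x `^ s.
Proof. by move=> x0; rewrite powRB// (gt_eqF x0) implybT. Qed.

(** * Integration against a weight, Young's and Holder's inequalities *)

Section weighted_integral.
Context {R : realType}.
Local Notation leb := (@lebesgue_measure R).
Local Open Scope ereal_scope.

(** Two weights occur: the density of [mu_alpha] for integrals in space, and the constant 1 for
    integrals over radii. *)
Definition wint (w : R -> R) (h : R -> \bar R) := \int[leb]_y (h y * (w y)%:E).

Variable w : R -> R.
Hypothesis w0 : forall x, (0 <= w x)%R.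
Hypothesis mw : measurable_fun setT w.

Lemma wint_ge0 (h : R -> \bar R) : (forall x, 0 <= h x) -> 0 <= wint w h.
Proof. by move=> h0; apply: integral_ge0 => x _; rewrite mule_ge0// lee_fin. Qed.

Lemma le_wint (h g : R -> \bar R) :
  (forall x, 0 <= h x) -> (forall x, h x <= g x) -> wint w h <= wint w g.
Proof.
move=> h0 hg; apply: ge0_leint => x _; first by rewrite mule_ge0// lee_fin.
by apply: lee_wpmul2r => //; rewrite lee_fin.
Qed.

Lemma wintZl (c : \bar R) (h : R -> \bar R) : 0 <= c -> (forall x, 0 <= h x) ->
  measurable_fun setT h -> wint w (fun x => c * h x) = c * wint w h.
Proof.
move=> c0 h0 mh; rewrite /wint -ge0_integralZl//.
- by apply: eq_integral => x _; rewrite muleA.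
- by measurability.
- by move=> x _; rewrite mule_ge0// lee_fin.
Qed.

Lemma wintD (h g : R -> \bar R) : (forall x, 0 <= h x) -> (forall x, 0 <= g x) ->
  measurable_fun setT h -> measurable_fun setT g ->
  wint w (fun x => h x + g x) = wint w h + wint w g.
Proof.
move=> h0 g0 mh mg; rewrite /wint -ge0_integralD//.
- by apply: eq_integral => x _; rewrite ge0_muleDl.
- by move=> x _; rewrite mule_ge0// lee_fin.
- by measurability.
- by move=> x _; rewrite mule_ge0// lee_fin.
- by measurability.
Qed.

Lemma measurable_wint d (T : measurableType d) (h : T -> R -> \bar R) :
  (forall z y, 0 <= h z y) ->
  measurable_fun [set: T * R] (fun q => h q.1 q.2) ->
  measurable_fun setT (fun z => wint w (h z)).
Proof.
move=> h0 mh.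
apply: (measurable_fun_fubini_tonelli_F (m2 := leb) (fun q : T * R => h q.1 q.2 * (w q.2)%:E)).
  by apply: emeasurable_funM => //; apply/measurable_EFinP; apply: measurableT_comp.
by move=> q; rewrite mule_ge0// lee_fin.
Qed.

Lemma wint_swap (w' : R -> R) (h : R -> R -> \bar R) :
  (forall x, (0 <= w' x)%R) -> measurable_fun setT w' ->
  (forall z y, 0 <= h z y) -> measurable_fun setT (fun q : R * R => h q.1 q.2) ->
  wint w (fun x => wint w' (h x)) = wint w' (fun y => wint w (h ^~ y)).
Proof.
move=> w'0 mw' h0 mh.
have mh1 x : measurable_fun setT (h x) := measurable_fun_pair2 x mh.
have mh2 y : measurable_fun setT (h ^~ y) := measurable_fun_pair1 y mh.
pose H (q : R * R) := h q.1 q.2 * (w' q.2)%:E * (w q.1)%:E.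
have mH : measurable_fun setT H.
  apply: emeasurable_funM; [apply: emeasurable_funM => //|];
    apply/measurable_EFinP; exact: measurableT_comp.
have H0 q : 0 <= H q by rewrite !mule_ge0// lee_fin.
transitivity (\int[leb]_x \int[leb]_y H (x, y)).
  apply: eq_integral => x _; rewrite /H/= ge0_integralZr//.
  - by measurability.
  - by move=> y _; rewrite mule_ge0// lee_fin.
  - by rewrite lee_fin.
rewrite fubini_tonelli//; apply: eq_integral => y _; rewrite /H/=.
rewrite -ge0_integralZr//.
- by apply: eq_integral => x _; rewrite -!muleA; congr (_ * _); rewrite muleC.
- by measurability.
- by move=> x _; rewrite mule_ge0// lee_fin.
- by rewrite lee_fin.
Qed.

(** Young's inequality without the dual exponent: if [g <= l] the second term suffices, otherwise
    [(g / l)^(p-1) >= 1] makes the first term at least [g]. *)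
Lemma le_young (p l g : R) : (1 < p)%R -> (0 < l)%R -> (0 <= g)%R ->
  (g <= l `^ (1 - p) * g `^ p + l)%R.
Proof.
move=> p1 l0 g0; have [gl|lg] := leP g l.
  by rewrite (le_trans gl)// lerDr mulr_ge0// powR_ge0.
have gg : (0 < g)%R by exact: lt_trans lg.
rewrite -[leLHS]addr0; apply: lerD; last exact: ltW.
have -> : (g `^ p = g * g `^ (p - 1))%R.
  by rewrite -[X in (X * _)%R]powRr1 ?(ltW gg)// -powRD_gt0//; congr (_ `^ _)%R; lra.
have -> : (l `^ (1 - p) = (l `^ (p - 1))^-1)%R by rewrite -powRN; congr (_ `^ _)%R; lra.
rewrite mulrCA ler_peMr//.
rewrite ler_pdivlMl ?powR_gt0// mulr1.
by apply: ge0_ler_powR; rewrite ?nnegrE ?(ltW l0) ?(ltW lg)//; lra.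
Qed.

(** The sum is at most twice the larger term. *)
Lemma poweRD_le (a b : \bar R) (p : R) : (0 < p)%R -> 0 <= a -> 0 <= b ->
  (a + b) `^ p <= (2 `^ p)%:E * (a `^ p + b `^ p).
Proof.
move=> p0; wlog ab : a b / a <= b => [hw a0 b0|a0 b0].
  have [?|/ltW ?] := leP a b; first exact: hw.
  by rewrite addeC [X in _ * X]addeC; exact: hw.
apply: (@le_trans _ _ ((2%:E * b) `^ p)).
  apply: gt0_ler_poweR; rewrite ?in_itv/= ?leey ?andbT ?adde_ge0 ?mule_ge0//; first exact: ltW.
  by rewrite (_ : 2%:E = 1 + 1)// ge0_muleDl// !mul1e leeD2r.
rewrite poweRM// poweR_EFin lee_wpmul2l ?lee_fin ?powR_ge0//.
by rewrite leeDr// poweR_ge0.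
Qed.

(* Holder's inequality up to the factor 2^p, by optimizing
   g <= l^(1-p) g^p + l over l *)
Lemma wint_hoelder (g : R -> R) (n : R -> \bar R) (I p : R) :
  (1 < p)%R -> (0 < I)%R -> (forall x, 0 <= g x)%R -> (forall x, 0 <= n x) ->
  measurable_fun setT g -> measurable_fun setT n -> wint w n <= I%:E ->
  (wint w (fun y => (g y)%:E * n y)) `^ p <=
    (2 `^ p * I `^ (p - 1))%:E * wint w (fun y => (g y `^ p)%:E * n y).
Proof.
move=> p1 I0 g0 n0 mg mn nI.
set A := wint w _; set F := wint w _.
have A0 : 0 <= A by apply: wint_ge0 => x; rewrite mule_ge0// lee_fin.
have F0 : 0 <= F by apply: wint_ge0 => x; rewrite mule_ge0// lee_fin powR_ge0.
have p0 : (0 < p)%R by lra.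
have key (l : R) : (0 < l)%R -> A <= (l `^ (1 - p))%:E * F + (l * I)%:E.
  move=> l0; apply: (@le_trans _ _ (wint w (fun y =>
      (l `^ (1 - p))%:E * ((g y `^ p)%:E * n y) + l%:E * n y))).
    apply: le_wint => y; first by rewrite mule_ge0// lee_fin.
    rewrite muleA -ge0_muleDl ?lee_fin ?mulr_ge0 ?powR_ge0 ?(ltW l0)//.
    by rewrite lee_wpmul2r// lee_fin le_young.
  rewrite wintD; first last.
  - by measurability.
  - by measurability.
  - by move=> y; rewrite mule_ge0 ?lee_fin ?(ltW l0).
  - by move=> y; rewrite !mule_ge0 ?lee_fin ?powR_ge0.
  rewrite !wintZl ?lee_fin ?powR_ge0 ?(ltW l0)//; first last.
  - by measurability.
  - by move=> y; rewrite !mule_ge0 ?lee_fin ?powR_ge0.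
  by rewrite leeD2l// EFinM lee_wpmul2l// lee_fin (ltW l0).
have c0 : (0 < 2 `^ p * I `^ (p - 1))%R by rewrite mulr_gt0 ?powR_gt0.
move: F F0 key => [r| |]// r0 key; last by rewrite gt0_muley ?lte_fin// leey.
move: r0; rewrite lee_fin le_eqVlt => /predU1P[r0|r0].
  (* When the integral of [g^p] is 0 there is no optimal positive [l]; letting [l * I] tend to 0
     gives [A = 0]. *)
  rewrite -r0 mule0.
  suff -> : A = 0 by rewrite poweR0r// gt_eqF.
  apply/eqP; rewrite eq_le A0 andbT; apply/lee_addgt0Pr => e e0.
  have := key (e / I)%R; rewrite divr_gt0// => /(_ isT).
  by rewrite -r0 mule0 divfK ?gt_eqF.
(* At this [l] the two terms [l^(1-p) * r] and [l * I] coincide. *)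
pose l := ((r / I) `^ p^-1)%R.
have rI : (0 < r / I)%R by rewrite divr_gt0.
have l0 : (0 < l)%R by rewrite powR_gt0.
have lp : (l `^ p = r / I)%R by rewrite /l -powRrM mulVf ?gt_eqF// powRr1// ltW.
apply: (@le_trans _ _ (((2 * (l * I))%:E) `^ p)).
  apply: gt0_ler_poweR; rewrite ?in_itv/= ?leey ?andbT//; first exact: ltW.
    by rewrite lee_fin !mulr_ge0// ?(ltW l0) ?(ltW I0).
  have := key l l0; rewrite -EFinM -EFinD.
  suff -> : (l `^ (1 - p) * r + l * I = 2 * (l * I))%R by [].
  rewrite powRB_gt0//.
  rewrite powRr1 ?(ltW l0)// lp; field.
  by rewrite (gt_eqF r0) (gt_eqF I0).
rewrite poweR_EFin -EFinM lee_fin !powRM ?mulr_ge0 ?(ltW l0) ?(ltW I0)//.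
rewrite lp -[leRHS]mulrA ler_pM2l ?powR_gt0//.
rewrite powRB_gt0//.
rewrite powRr1 ?(ltW I0)// le_eqVlt; apply/orP; left; apply/eqP; field.
by rewrite gt_eqF.
Qed.

End weighted_integral.

(** * The abstract estimate of a potential by averages *)

Section averaging_bound.
Context {R : realType}.
Local Open Scope ereal_scope.
Variable w : R -> R.
Hypothesis w0 : forall x, (0 <= w x)%R.
Hypothesis mw : measurable_fun setT w.
Local Notation one := (fun _ : R => 1%R : R).

(* [k1 + C1 * \int c t N_t dt] splits a kernel into its part near the diagonal
   and an average of the indicator kernels [N t] of larger balls. *)
Lemma averaging_bound (d p C1 C2 C4 I B r r' x : R) (g c lam : R -> R)
    (k k1 : R -> R -> \bar R) (N : R -> R -> R -> \bar R) :
  (1 < p)%R -> (0 <= C1)%R -> (0 <= C2)%R -> (0 <= C4)%R -> (0 < I)%R -> (0 <= B)%R ->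
  (0 < r)%R -> (0 < r')%R ->
  (forall y, 0 <= g y)%R -> measurable_fun setT g ->
  (forall t, 0 <= c t)%R -> (forall t : R, t <= 0 -> c t = 0)%R -> measurable_fun setT c ->
  (forall t : R, 0 < t -> 0 < lam t)%R ->
  measurable_fun setT (fun t : R => c t * (lam t * t `^ d))%R ->
  (forall z y, 0 <= k z y) -> (forall z y, 0 <= k1 z y) ->
  (forall t z y, 0 <= N t z y) ->
  measurable_fun setT (fun q : R * R => k1 q.1 q.2) ->
  (forall z, measurable_fun setT (fun q : R * R => N q.1 z q.2)) ->
  (forall z y, k z y <= k1 z y + C1%:E * wint one (fun t => (c t)%:E * N t z y)) ->
  (forall t z : R, (0 < t)%R -> wint w (N t z) <= (C2 * t `^ d)%:E) ->
  (forall z, wint w (k1 z) <= I%:E) ->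
  (forall y, wint w (k1 ^~ y) <= I%:E) ->
  (forall z y, k1 z y * N r x z <= C4%:E * (k1 z y * N r' x y)) ->
  (forall t z : R, (0 < t)%R ->
     wint w (fun y => (g y `^ p)%:E * N t z y) <= (lam t `^ p * t `^ d)%:E) ->
  wint one (fun t => (c t * (lam t * t `^ d))%:E) <= B%:E ->
  wint w (fun z => (wint w (fun y => (g y)%:E * k z y)) `^ p * N r x z) <=
  (2 `^ p * (2 `^ p * I `^ p * C4 * (lam r' `^ p * r' `^ d)
      + (C1 * (1 + C2) * B) `^ p * (C2 * r `^ d)))%:E.
Proof.
move=> p1 C10 C20 C40 I0 B0 r0 r'0 g0 mg c0 cneg mc lam0 mcl k0 k10 N0 mk1 mN.
move=> hk hN hk1 hk1' hk1N hg hB.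
have one0 t : (0 <= one t)%R by [].
have mone : measurable_fun setT one by exact: measurable_cst.
have p0 : (0 < p)%R := lt_trans ltr01 p1.
have mNt t z : measurable_fun setT (N t z).
  exact: (measurable_fun_pair2 (f := fun q => N q.1 z q.2) t (mN z)).
have mNy z y : measurable_fun setT (fun t => N t z y).
  exact: (measurable_fun_pair1 (f := fun q => N q.1 z q.2) y (mN z)).
have mk1z z : measurable_fun setT (k1 z).
  exact: (measurable_fun_pair2 (f := fun q => k1 q.1 q.2) z mk1).
have mk1y y : measurable_fun setT (k1 ^~ y).
  exact: (measurable_fun_pair1 (f := fun q => k1 q.1 q.2) y mk1).
(* Young's inequality with [l = lam t], the size of [g] at scale [t], turns both terms into
   multiples of [lam t * t^d]. *)
have gN t z : (0 < t)%R ->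
    wint w (fun y => (g y)%:E * N t z y) <= ((1 + C2) * (lam t * t `^ d))%:E.
  move=> t0; have l0 := lam0 t t0.
  apply: (@le_trans _ _ (wint w (fun y =>
      (lam t `^ (1 - p))%:E * ((g y `^ p)%:E * N t z y) + (lam t)%:E * N t z y))).
    apply: le_wint => // y; first by rewrite mule_ge0// lee_fin.
    rewrite muleA -ge0_muleDl ?lee_fin ?mulr_ge0 ?powR_ge0 ?(ltW l0)//.
    by rewrite lee_wpmul2r// lee_fin le_young.
  rewrite wintD//; first last.
  - by measurability.
  - by measurability.
  - by move=> y; rewrite mule_ge0 ?lee_fin ?(ltW l0).
  - by move=> y; rewrite !mule_ge0 ?lee_fin ?powR_ge0.
  rewrite !wintZl ?lee_fin ?powR_ge0 ?(ltW l0)//; first last.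
  - by measurability.
  - by move=> y; rewrite !mule_ge0 ?lee_fin ?powR_ge0.
  apply: (@le_trans _ _ ((lam t `^ (1 - p))%:E * (lam t `^ p * t `^ d)%:E +
      (lam t)%:E * (C2 * t `^ d)%:E)).
    by apply: leeD; apply: lee_wpmul2l; rewrite ?lee_fin ?powR_ge0 ?(ltW l0)// ?hg// hN.
  have e : (lam t `^ (1 - p) * (lam t `^ p * t `^ d) = lam t * t `^ d)%R.
    by rewrite mulrA -powRD_gt0// subrK powRr1 ?(ltW l0).
  by rewrite -!EFinM -EFinD e lee_fin le_eqVlt; apply/orP; left; apply/eqP; ring.
(* The tail contribution is bounded uniformly in [z]: exchange the integrals over [y] and [t], then
   apply [gN] at each radius. *)
pose S z := wint w (fun y => (g y)%:E * wint one (fun t => (c t)%:E * N t z y)).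
have SB z : S z <= ((1 + C2) * B)%:E.
  have -> : S z = wint one (fun t => (c t)%:E * wint w (fun y => (g y)%:E * N t z y)).
    transitivity (wint w (fun y => wint one (fun t => (g y)%:E * ((c t)%:E * N t z y)))).
      apply: eq_integral => y _; congr (_ * _); rewrite wintZl ?lee_fin//.
      - by move=> t; rewrite mule_ge0// lee_fin.
      - by measurability.
    rewrite (wint_swap w0 mw one0 mone (h := fun y t => (g y)%:E * ((c t)%:E * N t z y))).
    - apply: eq_integral => t _; congr (_ * _); rewrite -wintZl ?lee_fin//.
      + by apply: eq_integral => y _; rewrite muleCA.
      + by move=> y; rewrite mule_ge0// lee_fin.
      + by measurability.
    - by move=> y t; rewrite !mule_ge0 ?lee_fin.
    - apply: emeasurable_funM; first by apply/measurable_EFinP; exact: measurableT_comp.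
      apply: emeasurable_funM; first by apply/measurable_EFinP; exact: measurableT_comp.
      apply: (measurableT_comp (mN z) (g := fun q : R * R => (q.2, q.1))).
      by apply: measurable_fun_pair; measurability.
  apply: (@le_trans _ _ (wint one (fun t => (1 + C2)%:E * (c t * (lam t * t `^ d))%:E))).
    apply: le_wint => // t.
      rewrite mule_ge0 ?lee_fin//; apply: wint_ge0 => // y.
      by rewrite mule_ge0 ?lee_fin.
    have [t0|t0] := ltP 0%R t; last by rewrite cneg// !mul0e mul0r mule0.
    rewrite (EFinM (c t)) muleCA lee_wpmul2l ?lee_fin// -EFinM.
    exact: gN.
  have h0 t : 0 <= (c t * (lam t * t `^ d))%:E.
    have [t0|t0] := ltP 0%R t; last by rewrite cneg// mul0r.
    by rewrite lee_fin !mulr_ge0 ?powR_ge0 ?(ltW (lam0 _ t0)).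
  rewrite wintZl//; last 2 first.
  - by rewrite lee_fin addr_ge0.
  - exact/measurable_EFinP.
  by rewrite EFinM lee_wpmul2l// lee_fin addr_ge0.
pose B2 := (C1 * (1 + C2) * B)%R.
have B20 : (0 <= B2)%R by rewrite !mulr_ge0// addr_ge0.
pose T1 z := wint w (fun y => (g y)%:E * k1 z y).
pose F1 z := wint w (fun y => (g y `^ p)%:E * k1 z y).
have T10 z : 0 <= T1 z by apply: wint_ge0 => // y; rewrite mule_ge0 ?lee_fin.
have F10 z : 0 <= F1 z by apply: wint_ge0 => // y; rewrite mule_ge0 ?lee_fin ?powR_ge0.
have mF1 : measurable_fun setT F1.
  apply: measurable_wint => //; first by move=> z y; rewrite mule_ge0 ?lee_fin ?powR_ge0.
  apply: emeasurable_funM => //; apply/measurable_EFinP.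
  apply: (measurableT_comp (measurable_powR p)); exact: measurableT_comp.
have mS z : measurable_fun setT (fun y => wint one (fun t => (c t)%:E * N t z y)).
  apply: measurable_wint => //; first by move=> y t; rewrite mule_ge0 ?lee_fin.
  apply: emeasurable_funM; first by apply/measurable_EFinP; exact: measurableT_comp.
  apply: (measurableT_comp (mN z) (g := fun q : R * R => (q.2, q.1))).
  by apply: measurable_fun_pair; measurability.
have S0 z y : 0 <= wint one (fun t => (c t)%:E * N t z y).
  by apply: wint_ge0 => // t; rewrite mule_ge0 ?lee_fin.
have hT z : wint w (fun y => (g y)%:E * k z y) <= T1 z + B2%:E.
  apply: (@le_trans _ _ (wint w (fun y => (g y)%:E * k1 z y +
      C1%:E * ((g y)%:E * wint one (fun t => (c t)%:E * N t z y))))).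
    apply: le_wint => // y; first by rewrite mule_ge0 ?lee_fin.
    by rewrite muleCA -ge0_muleDr ?mule_ge0 ?lee_fin// lee_wpmul2l ?lee_fin.
  rewrite wintD//; first last.
  - by measurability.
  - by measurability.
  - by move=> y; rewrite !mule_ge0 ?lee_fin.
  - by move=> y; rewrite !mule_ge0 ?lee_fin.
  rewrite wintZl ?lee_fin//; first last.
  - by measurability.
  - by move=> y; rewrite !mule_ge0 ?lee_fin.
  apply: leeD2l; apply: le_trans (lee_wpmul2l _ (SB z)) _; first by rewrite lee_fin.
  by rewrite -EFinM mulrA.
(* Holder's inequality is spent on the near part only; the tail is already a constant [B2]. *)
have hTp z : wint w (fun y => (g y)%:E * k z y) `^ p <=
    (2 `^ p)%:E * ((2 `^ p * I `^ (p - 1))%:E * F1 z + (B2 `^ p)%:E).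
  apply: (@le_trans _ _ ((T1 z + B2%:E) `^ p)).
    apply: gt0_ler_poweR; rewrite ?in_itv/= ?leey ?andbT ?(ltW p0)//.
      by apply: wint_ge0 => // y; rewrite mule_ge0 ?lee_fin.
    by rewrite adde_ge0 ?lee_fin.
  apply: (le_trans (poweRD_le p0 (T10 z) _)); first by rewrite lee_fin.
  rewrite lee_wpmul2l ?lee_fin ?powR_ge0// leeD//.
  exact: wint_hoelder.
(* A localized Schur test. [hk1N] replaces the ball kernel at [z] by a larger one at [y], which
   frees the integral over [z]; integrating [k1] in [z] then costs one factor [I]. *)
have hG : wint w (fun z => N r x z * F1 z) <= (C4 * I * (lam r' `^ p * r' `^ d))%:E.
  have -> : wint w (fun z => N r x z * F1 z) =
      wint w (fun z => wint w (fun y => N r x z * ((g y `^ p)%:E * k1 z y))).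
    apply: eq_integral => z _; congr (_ * _); rewrite wintZl//.
    - by move=> y; rewrite mule_ge0 ?lee_fin ?powR_ge0.
    - by measurability.
  rewrite (wint_swap w0 mw w0 mw (h := fun z y => N r x z * ((g y `^ p)%:E * k1 z y))); first last.
  - apply: emeasurable_funM; first exact: measurableT_comp.
    apply: emeasurable_funM => //; apply/measurable_EFinP.
    apply: (measurableT_comp (measurable_powR p)); exact: measurableT_comp.
  - by move=> z y; rewrite !mule_ge0 ?lee_fin ?powR_ge0.
  apply: (@le_trans _ _ (wint w (fun y => (C4 * I)%:E * ((g y `^ p)%:E * N r' x y)))).
    apply: le_wint => // y.
      by apply: wint_ge0 => // z; rewrite !mule_ge0 ?lee_fin ?powR_ge0.
    apply: (@le_trans _ _ (wint w (fun z => (C4%:E * ((g y `^ p)%:E * N r' x y)) * k1 z y))).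
      apply: le_wint => // z; first by rewrite !mule_ge0 ?lee_fin ?powR_ge0.
      have -> : C4%:E * ((g y `^ p)%:E * N r' x y) * k1 z y =
          (g y `^ p)%:E * (C4%:E * (k1 z y * N r' x y)).
        by rewrite -!muleA muleCA [N r' x y * _]muleC.
      by rewrite muleCA lee_wpmul2l ?lee_fin ?powR_ge0// muleC.
    rewrite wintZl//; last by rewrite !mule_ge0 ?lee_fin ?powR_ge0.
    rewrite [leRHS](_ : _ = C4%:E * ((g y `^ p)%:E * N r' x y) * I%:E); last first.
      by rewrite EFinM muleAC.
    rewrite lee_wpmul2l//.
    by rewrite !mule_ge0 ?lee_fin ?powR_ge0.
  rewrite wintZl ?lee_fin ?mulr_ge0 ?(ltW I0)//; first last.
  - by measurability.
  - by move=> y; rewrite !mule_ge0 ?lee_fin ?powR_ge0.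
  by rewrite (EFinM (C4 * I)) lee_wpmul2l ?lee_fin ?mulr_ge0 ?(ltW I0)// hg.
apply: (@le_trans _ _ (wint w (fun z => (2 `^ p)%:E *
    ((2 `^ p * I `^ (p - 1))%:E * (N r x z * F1 z) + (B2 `^ p)%:E * N r x z)))).
  apply: le_wint => // z; first by rewrite mule_ge0 ?poweR_ge0.
  rewrite [N r x z * F1 z]muleC muleA -ge0_muleDl ?mule_ge0 ?lee_fin ?mulr_ge0 ?powR_ge0//.
  by rewrite muleA lee_wpmul2r.
rewrite wintZl ?lee_fin ?powR_ge0//; first last.
- by measurability.
- by move=> z; rewrite adde_ge0 ?mule_ge0 ?lee_fin ?mulr_ge0 ?powR_ge0.
rewrite wintD//; first last.
- by measurability.
- by measurability.
- by move=> z; rewrite ?mule_ge0 ?lee_fin ?powR_ge0.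
- by move=> z; rewrite ?mule_ge0 ?lee_fin ?mulr_ge0 ?powR_ge0.
rewrite !wintZl ?lee_fin ?mulr_ge0 ?powR_ge0//; first last.
- by measurability.
- by move=> z; rewrite mule_ge0.
rewrite [leRHS]EFinM lee_wpmul2l ?lee_fin ?powR_ge0// EFinD leeD//.
  apply: le_trans (lee_wpmul2l _ hG) _; first by rewrite lee_fin mulr_ge0 ?powR_ge0.
  rewrite -EFinM lee_fin le_eqVlt; apply/orP; left; apply/eqP.
  (* [I^(p-1)] from Holder's inequality and [I] from the integral over [z] combine to [I^p]. *)
  rewrite -[X in (_ = _ * X * _ * _)%R](mulr_powRB1 (ltW I0) p0); ring.
by rewrite EFinM lee_wpmul2l ?lee_fin ?powR_ge0// hN.
Qed.

End averaging_bound.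

(** * Integrals and two-sided bounds of beta type *)

Section power_integrals.
Context {R : realType}.
Local Notation leb := (@lebesgue_measure R).

Lemma continuous_powR (s l : R) : 0 < l -> {for l, continuous (fun v : R => v `^ s)}.
Proof.
move=> l0; apply: differentiable_continuous; apply/derivable1_diffP.
by apply: derivable_powR; rewrite in_itv/= l0.
Qed.

(** The antiderivative is a multiple of [(u^2 - e^2)^s]. For [s < 1] the integrand can be singular
    at [e], which is why the interval is open. *)
Lemma integral_sqrB_powR (e b s : R) : 0 <= e -> e < b -> 0 < s ->
  (\int[leb]_(u in `]e, b[) (u * (u ^+ 2 - e ^+ 2) `^ (s - 1))%:E =
   ((b ^+ 2 - e ^+ 2) `^ s / (2 * s))%:E)%E.
Proof.
move=> e0 eb s0; pose F (u : R) := (u ^+ 2 - e ^+ 2) `^ s / (2 * s).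
have pos (u : R) : e < u -> 0 < u ^+ 2 - e ^+ 2.
  by move=> eu; rewrite subr_gt0 ltr_sqr ?nnegrE//; lra.
have cq : continuous (fun u : R => u ^+ 2 - e ^+ 2).
  by move=> u; apply: cvgB; [exact: exprn_continuous|exact: cvg_cst].
transitivity ((F b - F e)%:E); last by rewrite /F subrr powR0 ?gt_eqF// mul0r subr0.
apply: ge0_FTC2_oo => //.
- move=> u; rewrite in_itv/= => /andP[eu _]; apply: cvgM; first exact: cvg_id.
  apply: (@cvg_comp _ _ _ (fun u : R => u ^+ 2 - e ^+ 2) (fun v : R => v `^ (s - 1)) _ _ _ (cq u)).
  by apply: continuous_powR; exact: pos.
- move=> u; rewrite in_itv/= => /andP[eu _]; rewrite mulr_ge0 ?powR_ge0//.
  exact: le_trans (ltW eu).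
- move=> u; rewrite in_itv/= => /andP[eu _].
  have dq : is_derive u 1 (fun v : R => v ^+ 2 - e ^+ 2) (2 * u).
    by apply: is_derive_eq; rewrite /GRing.scale/=; ring.
  have dp := is_derive1_powR s (pos u eu).
  have dc := @is_derive1_comp _ (fun v : R => v `^ s) (fun v : R => v ^+ 2 - e ^+ 2) _ _ _ dp dq.
  have -> : F = ((2 * s)^-1 \*: ((fun v : R => v `^ s) \o (fun v : R => v ^+ 2 - e ^+ 2)))%R.
    by apply/funext => y; rewrite /F/= mulrC.
  apply: is_derive_eq; rewrite /GRing.scale/=; field.
  by rewrite gt_eqF.
- apply: cvgM; last exact: cvg_cst.
  apply: cvg_powR; rewrite ?subrr//.
    by near=> u; apply: ltW; apply: pos; near: u; exact: nbhs_right_gt.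
  apply: cvg_at_right_filter; have := cq e; rewrite /continuous_at subrr; exact.
- apply: cvgM; last exact: cvg_cst.
  apply: cvg_powR; rewrite ?(ltW (pos _ eb))//.
    by near=> u; apply: ltW; apply: pos; near: u; exact: nbhs_left_gt.
  by apply: cvg_at_left_filter; exact: cq.
Unshelve. all: by end_near. Qed.

Lemma integral_sqrBl_powR (e b s : R) : 0 <= e -> e < b -> 0 < s ->
  (\int[leb]_(u in `]e, b[) (u * (b ^+ 2 - u ^+ 2) `^ (s - 1))%:E =
   ((b ^+ 2 - e ^+ 2) `^ s / (2 * s))%:E)%E.
Proof.
move=> e0 eb s0; pose F (u : R) := - ((b ^+ 2 - u ^+ 2) `^ s / (2 * s)).
have pos (u : R) : e < u -> u < b -> 0 < b ^+ 2 - u ^+ 2.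
  by move=> eu ub; rewrite subr_gt0 ltr_sqr ?nnegrE//; lra.
have cq : continuous (fun u : R => b ^+ 2 - u ^+ 2).
  by move=> u; apply: cvgB; [exact: cvg_cst|exact: exprn_continuous].
have be : 0 <= b ^+ 2 - e ^+ 2 by rewrite subr_ge0 ler_sqr ?nnegrE//; lra.
transitivity ((F b - F e)%:E).
  2: by rewrite /F subrr powR0 ?gt_eqF// mul0r oppr0 opprK add0r.
apply: ge0_FTC2_oo => //.
- move=> u; rewrite in_itv/= => /andP[eu ub]; apply: cvgM; first exact: cvg_id.
  apply: (@cvg_comp _ _ _ (fun u : R => b ^+ 2 - u ^+ 2) (fun v : R => v `^ (s - 1)) _ _ _ (cq u)).
  by apply: continuous_powR; exact: pos.
- move=> u; rewrite in_itv/= => /andP[eu _]; rewrite mulr_ge0 ?powR_ge0//.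
  exact: le_trans (ltW eu).
- move=> u; rewrite in_itv/= => /andP[eu ub].
  have dq : is_derive u 1 (fun v : R => b ^+ 2 - v ^+ 2) (- (2 * u)).
    by apply: is_derive_eq; rewrite /GRing.scale/=; ring.
  have dp := is_derive1_powR s (pos u eu ub).
  have dc := @is_derive1_comp _ (fun v : R => v `^ s) (fun v : R => b ^+ 2 - v ^+ 2) _ _ _ dp dq.
  have -> : F = ((- (2 * s)^-1) \*: ((fun v : R => v `^ s) \o (fun v : R => b ^+ 2 - v ^+ 2)))%R.
    by apply/funext => y; rewrite /F/= mulrC /GRing.scale/= mulNr.
  apply: is_derive_eq; rewrite /GRing.scale/=; field.
  by rewrite gt_eqF.
- apply: cvgN; apply: cvgM; last exact: cvg_cst.
  apply: cvg_powR => //.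
    near=> u; apply: ltW; apply: pos; near: u; first exact: nbhs_right_gt.
    exact: nbhs_right_lt.
  by apply: cvg_at_right_filter; exact: cq.
- apply: cvgN; apply: cvgM; last exact: cvg_cst.
  apply: cvg_powR; rewrite ?subrr//.
    near=> u; apply: ltW; apply: pos; near: u; first exact: nbhs_left_gt.
    exact: nbhs_left_lt.
  apply: cvg_at_left_filter; have := cq b; rewrite /continuous_at subrr; exact.
Unshelve. all: by end_near. Qed.

(** The constant covers both signs of [b]: the power is at most [2^b] for [b >= 0] and at most 1
    otherwise. *)
Lemma powR_le2 (b v : R) : 1 <= v <= 2 -> v `^ b <= 1 + 2 `^ b.
Proof.
move=> /andP[v1 v2]; have [b0|b0] := leP 0 b.
  have h : v `^ b <= 2 `^ b by apply: ge0_ler_powR; rewrite ?nnegrE//; lra.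
  lra.
have h : v `^ b <= v `^ 0 by apply: ler_powR => //; exact: ltW.
have := powR_ge0 2 b; move: h; rewrite powRr0; lra.
Qed.

Lemma powR_comparable (b s D : R) : 0 < D -> D / 2 <= s <= D ->
  s `^ b <= (1 + 2 `^ (- b)) * D `^ b /\ D `^ b <= (1 + 2 `^ b) * s `^ b.
Proof.
move=> D0 /andP[s1 s2]; have s0 : 0 < s by lra.
pose v := D / s; have v12 : 1 <= v <= 2.
  by rewrite /v ler_pdivlMr// ler_pdivrMr//; apply/andP; split; lra.
have v0 : 0 < v by rewrite divr_gt0.
have Dv : D = v * s by rewrite /v divfK ?gt_eqF.
split.
  have -> : s = v^-1 * D by rewrite Dv mulKf ?gt_eqF.
  rewrite powRM ?invr_ge0 ?(ltW v0) ?(ltW D0)// ler_pM2r ?powR_gt0//.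
  by rewrite -(powR_inv1 (ltW v0)) -powRrM mulN1r; exact: powR_le2.
rewrite {1}Dv powRM ?(ltW v0) ?(ltW s0)// ler_pM2r ?powR_gt0//; exact: powR_le2.
Qed.

(** The distance to the farther endpoint lies between half the length of the interval and the full
    length, so its power is comparable with that of [M - m] whatever the sign of [b]. The sum of two
    powers covers both halves. *)
Lemma beta_integrand_le (b m M t : R) : m < M -> m <= t <= M ->
  ((M - t) * (t - m)) `^ b <=
    (1 + 2 `^ (- b)) * (M - m) `^ b * ((t - m) `^ b + (M - t) `^ b).
Proof.
move=> mM /andP[mt tM]; have D0 : 0 < M - m by lra.
have C0 : 0 <= (1 + 2 `^ (- b)) * (M - m) `^ b by rewrite mulr_ge0 ?addr_ge0 ?powR_ge0.
rewrite powRM ?subr_ge0//; have [h|h] := leP (t - m) (M - t).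
  have [|l _] := @powR_comparable b (M - t) (M - m) D0; first by apply/andP; split; lra.
  apply: (le_trans (ler_wpM2r (powR_ge0 _ _) l)).
  by rewrite ler_wpM2l// lerDl powR_ge0.
have [|l _] := @powR_comparable b (t - m) (M - m) D0; first by apply/andP; split; lra.
rewrite mulrC; apply: (le_trans (ler_wpM2r (powR_ge0 _ _) l)).
by rewrite ler_wpM2l// lerDr powR_ge0.
Qed.

(** In the half next to [m] only the power of [t - m] varies essentially; together with the next
    bound this is a two-sided comparison. *)
Lemma beta_integrand_le_half (b m M t : R) : m < M -> m <= t -> t - m <= (M - m) / 2 ->
  ((M - t) * (t - m)) `^ b <= (1 + 2 `^ (- b)) * (M - m) `^ b * (t - m) `^ b.
Proof.
move=> mM mt tM; have D0 : 0 < M - m by lra.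
have tM' : 0 <= M - t by lra.
rewrite powRM ?subr_ge0//; last by lra.
have [|l _] := @powR_comparable b (M - t) (M - m) D0; first by apply/andP; split; lra.
exact: (ler_wpM2r (powR_ge0 _ _) l).
Qed.

Lemma beta_integrand_ge_half (b m M t : R) : m < M -> m <= t -> t - m <= (M - m) / 2 ->
  (M - m) `^ b * (t - m) `^ b <= (1 + 2 `^ b) * ((M - t) * (t - m)) `^ b.
Proof.
move=> mM mt tM; have D0 : 0 < M - m by lra.
have tM' : 0 <= M - t by lra.
rewrite powRM ?subr_ge0//; last by lra.
have [|_ l] := @powR_comparable b (M - t) (M - m) D0; first by apply/andP; split; lra.
by rewrite mulrA; exact: (ler_wpM2r (powR_ge0 _ _) l).
Qed.

End power_integrals.

(** * The Bessel kernel as a beta density *)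

Section bessel_kernel.
Context {R : realType}.
Local Notation leb := (@lebesgue_measure R).
Variable a : R.

Lemma ge0_leint_supp (D D' : set R) (f g : R -> \bar R) :
  (forall x, D x -> 0 <= f x)%E -> (forall x, D' x -> 0 <= g x)%E ->
  (forall x, D x -> D' x -> f x <= g x)%E -> (forall x, D x -> ~ D' x -> f x = 0)%E ->
  (\int[leb]_(x in D) f x <= \int[leb]_(x in D') g x)%E.
Proof.
move=> f0 g0 fg fz; rewrite [leLHS]integral_mkcond [leRHS]integral_mkcond.
apply: ge0_leint => x _; first by apply: erestrict_ge0.
rewrite !patchE; case: ifPn => xD; case: ifPn => xD' //.
- by apply: fg; exact/set_mem.
- by rewrite fz//; [exact/set_mem|by move/mem_set; apply/negP].
- by apply: g0; exact/set_mem.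
Qed.

Lemma A_alpha_gt0 : -1 < a -> 0 < A_alpha a.
Proof.
by move=> a1; rewrite /A_alpha invr_gt0 mulr_gt0 ?powR_gt0// Gamma_gt0//; lra.
Qed.

Lemma w_alpha_ge0 (x : R) : -1 < a -> 0 <= w_alpha a x.
Proof. by move=> a1; rewrite mulr_ge0 ?powR_ge0// ltW// A_alpha_gt0. Qed.

Lemma w_alphaN (x : R) : w_alpha a (- x) = w_alpha a x.
Proof. by rewrite /w_alpha normrN. Qed.

Lemma measurable_w_alpha : measurable_fun setT (w_alpha a).
Proof. by rewrite /w_alpha; measurability. Qed.

(* The kernel [kappa] cut off where its formula involves division by zero. *)
Definition bkernel (x y z : R) : R :=
  if [&& x != 0, y != 0 & z != 0] then kappa a x y z else 0.

Lemma bkernelC (x y z : R) : bkernel x y z = bkernel y x z.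
Proof.
rewrite /bkernel andbCA; case: ifP => // _; rewrite /kappa.
by rewrite distrC [`|x| + _]addrC [x * y]mulrC -[X in z ^+ 2 - X]sqrrN opprB.
Qed.

(** By Heron's formula the product of the two brackets in [kappa] is 16 times the squared area of
    the triangle with sides [|x|], [|y|], [|z|], and the support condition is the triangle
    inequality. Both are symmetric in the three sides. *)
Lemma bkernelCr (x y z : R) : bkernel x y z = bkernel x z y.
Proof.
rewrite /bkernel [(y != 0) && _]andbC; case: ifP => // _; rewrite /kappa.
rewrite [x * y * z]mulrAC.
have -> : ((`| `|x| - `|y| | <= `|z|) && (`|z| <= `|x| + `|y|)) =
    ((`| `|x| - `|z| | <= `|y|) && (`|y| <= `|x| + `|z|)).
  by rewrite (ler_norml (`|x| - `|y|)) (ler_norml (`|x| - `|z|)); apply/idP/idP => /andP[/andP[? ?] ?]; apply/andP; split; try (apply/andP; split); lra.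
case: ifP => // _; congr (_ * _ `^ _ / _).
rewrite -(real_normK (num_real z)) -(real_normK (num_real y)); ring.
Qed.

Lemma bkernel_norm (x y z : R) : bkernel x y z = bkernel x y `|z|.
Proof.
by rewrite /bkernel normr_eq0 /kappa normr_id real_normK ?num_real// !normrM normr_id.
Qed.

Lemma bkernel_supp (x y z : R) :
  bkernel x y z != 0 -> (`| `|x| - `|y| | <= `|z|) && (`|z| <= `|x| + `|y|).
Proof. by rewrite /bkernel /kappa; case: ifP => _; [case: ifP|]; rewrite ?eqxx. Qed.

Lemma measurable_bkernel d (T : measurableType d) (fx fy fz : T -> R) :
  measurable_fun setT fx -> measurable_fun setT fy -> measurable_fun setT fz ->
  measurable_fun setT (fun t => bkernel (fx t) (fy t) (fz t)).
Proof.
move=> mx my mz; rewrite /bkernel /kappa.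
under eq_fun do rewrite -powRN; measurability.
Qed.

Hypothesis ha : - 2^-1 < a.
(** The beta density has exponent [s - 1] at both endpoints and is integrable because [s > 0]. *)
Let s : R := a + 2^-1.
Let s0 : 0 < s. Proof. by rewrite /s; have := ha; lra. Qed.
Let a1 : -1 < a. Proof. by have := ha; lra. Qed.

Lemma D_alpha_gt0 : 0 < D_alpha a.
Proof.
have a10 : 0 < a + 1 by have := ha; lra.
rewrite /D_alpha divr_gt0 ?exprn_gt0 ?Gamma_gt0//.
by rewrite !mulr_gt0 ?powR_gt0 ?sqrtr_gt0 ?pi_gt0 ?Gamma_gt0.
Qed.

Lemma kappa_ge0 (x y z : R) : 0 <= kappa a x y z.
Proof.
rewrite /kappa; case: ifP => // _; apply: mulr_ge0; last by rewrite invr_ge0 powR_ge0.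
by apply: mulr_ge0; [exact: ltW D_alpha_gt0|exact: powR_ge0].
Qed.

Lemma bkernel_ge0 (x y z : R) : 0 <= bkernel x y z.
Proof. by rewrite /bkernel; case: ifP => // _; exact: kappa_ge0. Qed.

(** The powers of [u] in weight and kernel leave a single factor [u], which is half the Jacobian of
    [u -> u^2]. *)
Lemma bkernel_weight (x y u : R) : x != 0 -> y != 0 -> 0 < u ->
  `| `|x| - `|y| | <= u <= `|x| + `|y| ->
  bkernel x y u * w_alpha a u = D_alpha a * A_alpha a / (`|x| * `|y|) `^ (2 * a) *
    (u * (((`|x| + `|y|) ^+ 2 - u ^+ 2) * (u ^+ 2 - `| `|x| - `|y| | ^+ 2)) `^ (s - 1)).
Proof.
move=> x0 y0 u0 xyu; rewrite /bkernel x0 y0 (gt_eqF u0)/= /kappa (gtr0_norm u0) xyu.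
rewrite real_normK ?num_real// /w_alpha (gtr0_norm u0).
have -> : s - 1 = a - 2^-1 by rewrite /s; lra.
rewrite !normrM (gtr0_norm u0).
have -> : (`|x| * `|y| * u) `^ (2 * a) = (`|x| * `|y|) `^ (2 * a) * u `^ (2 * a).
  by rewrite powRM ?mulr_ge0 ?(ltW u0).
rewrite (powRD_gt0 (2 * a) 1 u0) (powRr1 (ltW u0)).
have h1 : (`|x| * `|y|) `^ (2 * a) != 0.
  by rewrite gt_eqF// powR_gt0// mulr_gt0 ?normr_gt0.
have h2 : u `^ (2 * a) != 0 by rewrite gt_eqF// powR_gt0.
by field; rewrite h1 h2.
Qed.

Definition bessel_const : R := D_alpha a * A_alpha a * 4 `^ (2 * a).
Local Notation c0 := bessel_const.
Lemma bessel_const_gt0 : 0 < c0.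
Proof.
apply: mulr_gt0; last exact: powR_gt0.
by apply: mulr_gt0; [exact: D_alpha_gt0|exact: A_alpha_gt0].
Qed.

Let bkernel_weight_ge0 (x y u : R) : 0 <= bkernel x y u * w_alpha a u.
Proof. by apply: mulr_ge0; [exact: bkernel_ge0|exact: w_alpha_ge0]. Qed.

Let scaled_const_ge0 (x y : R) :
  0 <= D_alpha a * A_alpha a / (`|x| * `|y|) `^ (2 * a).
Proof.
apply: mulr_ge0; last by rewrite invr_ge0 powR_ge0.
by apply: mulr_ge0; apply: ltW; [exact: D_alpha_gt0|exact: A_alpha_gt0].
Qed.

(** Since [2 a = 2 s - 1], the power [s - 1] of [4 |x| |y|] produced by the beta bounds turns the
    prefactor into [c0] over the power [s]. That power cancels against the integrals, whose bounds
    thus become independent of [x] and [y]. *)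
Lemma bkernel_scaling (x y : R) : x != 0 -> y != 0 ->
  D_alpha a * A_alpha a / (`|x| * `|y|) `^ (2 * a) * (4 * (`|x| * `|y|)) `^ (s - 1) =
  c0 / (4 * (`|x| * `|y|)) `^ s.
Proof.
move=> x0 y0; have xy : 0 < `|x| * `|y| by rewrite mulr_gt0 ?normr_gt0.
have xy4 : 0 < 4 * (`|x| * `|y|) by rewrite mulr_gt0.
have -> : s - 1 = 2 * a - s by rewrite /s; lra.
rewrite powRB_gt0// [X in _ * (X / _)]powRM ?(ltW xy)// /bessel_const.
have h1 : (`|x| * `|y|) `^ (2 * a) != 0 by rewrite gt_eqF// powR_gt0.
have h2 : (4 * (`|x| * `|y|)) `^ s != 0 by rewrite gt_eqF// powR_gt0.
by field; rewrite h1 h2.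
Qed.

(** For [x = 0] or [y = 0] this is 0, not the value of the true translation, because [bkernel] is
    cut off there. *)
Definition btrans (h : R -> R) (x y : R) : \bar R :=
  wint (w_alpha a) (fun z => (h z * bkernel x y z)%:E).

Definition ind_ball (t z : R) : R := if `|z| < t then 1 else 0.

Lemma ind_ball_ge0 (t z : R) : 0 <= ind_ball t z.
Proof. by rewrite /ind_ball; case: ifP. Qed.

Lemma btrans_ball_half (r x y : R) :
  btrans (ind_ball r) x y = (2%:E * \int[leb]_(u in `]0%R, +oo[)
     (ind_ball r u * bkernel x y u * w_alpha a u)%:E)%E.
Proof.
rewrite -(integral_abs_sym (g := fun u => ind_ball r u * bkernel x y u * w_alpha a u)).
- rewrite /btrans /wint; apply: eq_integral => z _.
  by rewrite -EFinM {1}bkernel_norm /ind_ball /w_alpha normr_id.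
- have mk := @measurable_bkernel _ _ (fun=> x) (fun=> y) (fun z : R => `|z|).
  rewrite /ind_ball; apply: measurable_funM; last by rewrite /w_alpha; measurability.
  apply: measurable_funM; last by apply: mk; measurability.
  by measurability.
- by move=> u; rewrite -mulrA; apply: mulr_ge0; [exact: ind_ball_ge0|].
Qed.

(** Squares are abstracted into plain variables in these three facts, which makes the goals
    linear. *)
Let aux1 (r2 e2 D E2 u2 : R) : r2 - e2 <= D / 2 -> E2 - e2 = D -> 0 < D ->
  u2 <= r2 -> u2 <= E2.
Proof. by lra. Qed.

Let aux2 (u2 e2 Dv D E2 : R) : u2 < e2 + Dv -> Dv <= D / 2 -> E2 - e2 = D -> 0 < D ->
  u2 <= E2.
Proof. by lra. Qed.

Let aux3 (u2 e2 Dv D E2 : R) : u2 < e2 + Dv -> Dv <= D / 2 -> E2 - e2 = D ->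
  u2 - e2 <= (E2 - e2) / 2.
Proof. by lra. Qed.

Section fixed_xy.
Variables x y : R.
Hypotheses (x0 : x != 0) (y0 : y != 0).
(** In the variable [u^2] the kernel lives on the interval from [e^2] to [E^2], whose length is
    [Dl]. *)
Let e : R := `| `|x| - `|y| |.
Let E : R := `|x| + `|y|.
Let Dl : R := 4 * (`|x| * `|y|).
Let b : R := s - 1.

Let e0 : 0 <= e. Proof. exact: normr_ge0. Qed.
Let Dl0 : 0 < Dl. Proof. by rewrite !mulr_gt0 ?normr_gt0. Qed.
Let DlE : E ^+ 2 - e ^+ 2 = Dl.
Proof. by rewrite /E /e /Dl real_normK ?num_real//; ring. Qed.
Let E0 : 0 < E. Proof. by rewrite addr_gt0 ?normr_gt0. Qed.
Let eE : e < E.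
Proof. by rewrite -ltr_sqr ?nnegrE ?(ltW E0)// -subr_gt0 DlE. Qed.
Let eE2 : e ^+ 2 < E ^+ 2. Proof. by rewrite -subr_gt0 DlE. Qed.

Let integrand_ge0 (r u : R) : (0 <= (ind_ball r u * bkernel x y u * w_alpha a u)%:E)%E.
Proof. by rewrite lee_fin -mulrA; apply: mulr_ge0; [exact: ind_ball_ge0|]. Qed.

(** The ball is discarded and the whole beta mass is bounded: each of the two one-sided powers
    integrates to [Dl^s / (2 s)], and [Dl^s] cancels. *)
Lemma btrans_ball_le (r : R) : (btrans (ind_ball r) x y <= (2 * c0 * (1 + 2 `^ (- b)) / s)%:E)%E.
Proof.
rewrite btrans_ball_half.
pose c := c0 / Dl `^ s * (1 + 2 `^ (- b)).
have cp : 0 <= c.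
  apply: mulr_ge0; last by rewrite addr_ge0 ?powR_ge0.
  by apply: divr_ge0; [exact: ltW bessel_const_gt0|exact: powR_ge0].
apply: (@le_trans _ _ (2%:E * (\int[leb]_(u in `]e, E[)
   (c%:E * ((u * (u ^+ 2 - e ^+ 2) `^ b)%:E + (u * (E ^+ 2 - u ^+ 2) `^ b)%:E)))))%E.
  apply: lee_wpmul2l; first by rewrite lee_fin.
  rewrite -(@integral_itv_bndoo _ e E _ true false); last first.
    by apply: measurable_funTS; measurability.
  apply: ge0_leint_supp => [u _|u|u|u]; rewrite /= ?in_itv/= ?andbT.
  - exact: integrand_ge0.
  - move=> /andP[eu uE]; have u0 : 0 <= u by exact: le_trans eu.
    by rewrite !(mule_ge0, adde_ge0) ?lee_fin// ?mulr_ge0 ?powR_ge0.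
  - move=> u0 eu; rewrite -EFinD -EFinM lee_fin.
    have -> : c * (u * (u ^+ 2 - e ^+ 2) `^ b + u * (E ^+ 2 - u ^+ 2) `^ b) =
        D_alpha a * A_alpha a / (`|x| * `|y|) `^ (2 * a) * (u * ((1 + 2 `^ (- b)) * Dl `^ b *
          ((u ^+ 2 - e ^+ 2) `^ b + (E ^+ 2 - u ^+ 2) `^ b))).
      by rewrite /c -bkernel_scaling//; ring.
    apply: (@le_trans _ _ (bkernel x y u * w_alpha a u)).
      by rewrite /ind_ball; case: ifP => _; rewrite ?mul1r// !mul0r.
    rewrite bkernel_weight//; apply: ler_wpM2l; first exact: scaled_const_ge0.
    apply: ler_wpM2l; first exact: ltW.
    rewrite -DlE.
    move: eu => /andP[eu uE].
    apply: beta_integrand_le => //; rewrite !ler_sqr ?nnegrE ?(ltW u0) ?(ltW E0)//.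
    by rewrite eu.
  - move=> u0 /negP h; suff /eqP -> : bkernel x y u == 0 by rewrite mulr0 mul0r.
    apply: contraNT h => /bkernel_supp; by rewrite (gtr0_norm u0).
rewrite ge0_integralZl_EFin//; first last.
- by apply: measurable_funTS; measurability.
- move=> u; rewrite /= in_itv/= => /andP[eu _].
  by rewrite adde_ge0 ?lee_fin ?mulr_ge0 ?powR_ge0 ?(le_trans e0 (ltW eu)).
rewrite ge0_integralD//; first last.
- by apply: measurable_funTS; measurability.
- move=> u; rewrite /= in_itv/= => /andP[eu _].
  by rewrite lee_fin ?mulr_ge0 ?powR_ge0 ?(le_trans e0 (ltW eu)).
- by apply: measurable_funTS; measurability.
- move=> u; rewrite /= in_itv/= => /andP[eu _].
  by rewrite lee_fin ?mulr_ge0 ?powR_ge0 ?(le_trans e0 (ltW eu)).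
rewrite integral_sqrB_powR// integral_sqrBl_powR// DlE -EFinD -!EFinM lee_fin /c.
have h : Dl `^ s != 0 by rewrite gt_eqF// powR_gt0.
rewrite le_eqVlt; apply/orP; left; apply/eqP; field.
by rewrite h gt_eqF.
Qed.

(** A ball that reaches at most the midpoint of the interval of [u^2] meets only the endpoint [e],
    so its mass is of the order of the covered fraction to the power [s]. *)
Lemma btrans_ball_le_small (r : R) : e < r -> r ^+ 2 - e ^+ 2 <= Dl / 2 ->
  (btrans (ind_ball r) x y <=
   (c0 * (1 + 2 `^ (- b)) / s * ((r ^+ 2 - e ^+ 2) / Dl) `^ s)%:E)%E.
Proof.
move=> er rD; rewrite btrans_ball_half.
have r0 : 0 < r by exact: le_lt_trans er.
pose c := c0 / Dl `^ s * (1 + 2 `^ (- b)).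
have cp : 0 <= c.
  apply: mulr_ge0; last by rewrite addr_ge0 ?powR_ge0.
  by apply: divr_ge0; [exact: ltW bessel_const_gt0|exact: powR_ge0].
apply: (@le_trans _ _ (2%:E * (\int[leb]_(u in `]e, r[)
   (c%:E * (u * (u ^+ 2 - e ^+ 2) `^ b)%:E))))%E.
  apply: lee_wpmul2l; first by rewrite lee_fin.
  rewrite -(@integral_itv_bndoo _ e r _ true false); last first.
    by apply: measurable_funTS; measurability.
  apply: ge0_leint_supp => [u _|u|u|u]; rewrite /= ?in_itv/= ?andbT.
  - exact: integrand_ge0.
  - move=> /andP[eu uE]; have u0 : 0 <= u by exact: le_trans eu.
    by rewrite mule_ge0 ?lee_fin// ?mulr_ge0 ?powR_ge0.
  - move=> u0 /andP[eu ur]; rewrite -EFinM lee_fin.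
    have ru2 : u ^+ 2 <= r ^+ 2 by rewrite ler_sqr ?nnegrE ?(ltW u0) ?(ltW r0).
    have -> : c * (u * (u ^+ 2 - e ^+ 2) `^ b) =
        D_alpha a * A_alpha a / (`|x| * `|y|) `^ (2 * a) * (u * ((1 + 2 `^ (- b)) * Dl `^ b *
          (u ^+ 2 - e ^+ 2) `^ b)).
      by rewrite /c -bkernel_scaling//; ring.
    apply: (@le_trans _ _ (bkernel x y u * w_alpha a u)).
      by rewrite /ind_ball; case: ifP => _; rewrite ?mul1r// !mul0r.
    rewrite bkernel_weight//; last first.
      rewrite eu/= -ler_sqr ?nnegrE ?(ltW u0) ?(ltW E0)//.
      exact: (aux1 rD DlE Dl0 ru2).
    apply: ler_wpM2l; first exact: scaled_const_ge0.
    apply: ler_wpM2l; first exact: ltW.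
    rewrite -DlE.
    apply: beta_integrand_le_half => //.
      by rewrite ler_sqr ?nnegrE ?(ltW u0).
    by rewrite DlE (le_trans _ rD)// lerD2r.
  - move=> u0 /negP h; rewrite /ind_ball (gtr0_norm u0); case: ifP => ur; last by rewrite !mul0r.
    suff /eqP -> : bkernel x y u == 0 by rewrite mulr0 mul0r.
    by apply: contraNT h => /bkernel_supp; rewrite (gtr0_norm u0) (ltW ur) andbT => /andP[].
rewrite ge0_integralZl_EFin//; first last.
- by apply: measurable_funTS; measurability.
- move=> u; rewrite /= in_itv/= => /andP[eu _].
  by rewrite lee_fin ?mulr_ge0 ?powR_ge0 ?(le_trans e0 (ltW eu)).
rewrite integral_sqrB_powR// -!EFinM lee_fin /c.
rewrite powRM ?invr_ge0 ?(ltW Dl0)//; last by rewrite subr_ge0 ler_sqr ?nnegrE ?(ltW r0) ?(ltW er).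
have -> : Dl^-1 `^ s = (Dl `^ s)^-1.
  by rewrite -powR_inv1 ?(ltW Dl0)// -powRrM mulN1r powRN.
have h : Dl `^ s != 0 by rewrite gt_eqF// powR_gt0.
rewrite le_eqVlt; apply/orP; left; apply/eqP; field.
by rewrite h gt_eqF.
Qed.

(** [v] is a fraction of the interval of [u^2] that the ball is certain to cover; [v <= 1/2] keeps
    it in the half next to [e], where the beta density is bounded below by a one-sided power. *)
Lemma btrans_ball_ge (r v : R) : 0 < r -> 0 < v -> v <= 2^-1 -> e ^+ 2 + Dl * v <= r ^+ 2 ->
  ((c0 / (1 + 2 `^ b) / s * v `^ s)%:E <= btrans (ind_ball r) x y)%E.
Proof.
move=> r0 v0 v1 hr; rewrite btrans_ball_half.
pose be := Num.sqrt (e ^+ 2 + Dl * v).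
have h0 : 0 <= e ^+ 2 + Dl * v by rewrite addr_ge0 ?sqr_ge0 ?mulr_ge0 ?(ltW Dl0) ?(ltW v0).
have be2 : be ^+ 2 = e ^+ 2 + Dl * v by rewrite sqr_sqrtr.
have be0 : 0 <= be by exact: sqrtr_ge0.
have eb : e < be.
  by rewrite -ltr_sqr ?nnegrE// be2 ltrDl mulr_gt0.
have br : be <= r by rewrite -ler_sqr ?nnegrE ?(ltW r0)// be2.
pose c := c0 / Dl `^ s / (1 + 2 `^ b).
have b2 : 0 < 1 + 2 `^ b by rewrite ltr_pwDl// powR_ge0.
have cp : 0 <= c.
  apply: divr_ge0; last exact: ltW b2.
  by apply: divr_ge0; [exact: ltW bessel_const_gt0|exact: powR_ge0].
apply: (@le_trans _ _ (2%:E * (\int[leb]_(u in `]e, be[)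
   (c%:E * (u * (u ^+ 2 - e ^+ 2) `^ b)%:E))))%E.
  rewrite ge0_integralZl_EFin//; first last.
  - by apply: measurable_funTS; measurability.
  - move=> u; rewrite /= in_itv/= => /andP[eu _].
    by rewrite lee_fin ?mulr_ge0 ?powR_ge0 ?(le_trans e0 (ltW eu)).
  rewrite integral_sqrB_powR// be2 addrAC subrr add0r -!EFinM lee_fin /c.
  rewrite powRM ?(ltW Dl0) ?(ltW v0)//.
  have h : Dl `^ s != 0 by rewrite gt_eqF// powR_gt0.
  rewrite le_eqVlt; apply/orP; left; apply/eqP; field.
  by rewrite h !gt_eqF.
apply: lee_wpmul2l; first by rewrite lee_fin.
apply: ge0_leint_supp => [u|u _|u|u]; rewrite /= ?in_itv/= ?andbT.
- move=> /andP[eu _]; rewrite -EFinM lee_fin; apply: mulr_ge0 => //.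
  by apply: mulr_ge0; [exact: le_trans e0 (ltW eu)|exact: powR_ge0].
- exact: integrand_ge0.
- move=> /andP[eu ub] u0; rewrite -EFinM lee_fin.
  have ub2 : u ^+ 2 < be ^+ 2 by rewrite ltr_sqr ?nnegrE ?(ltW u0).
  have Dv : Dl * v <= Dl / 2 by rewrite ler_pM2l.
  rewrite /ind_ball (gtr0_norm u0) (lt_le_trans ub br) mul1r.
  rewrite bkernel_weight//; last first.
    rewrite (ltW eu)/= -ler_sqr ?nnegrE ?(ltW u0) ?(ltW E0)//.
    by apply: (aux2 _ Dv DlE Dl0); rewrite -be2.
  have -> : c * (u * (u ^+ 2 - e ^+ 2) `^ b) =
        D_alpha a * A_alpha a / (`|x| * `|y|) `^ (2 * a) * (u * (Dl `^ b *
          (u ^+ 2 - e ^+ 2) `^ b / (1 + 2 `^ b))).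
    by rewrite /c -bkernel_scaling//; ring.
  apply: ler_wpM2l; first exact: scaled_const_ge0.
  apply: ler_wpM2l; first exact: ltW.
  rewrite ler_pdivrMr// [leRHS]mulrC -DlE.
  apply: beta_integrand_ge_half => //.
    by rewrite ler_sqr ?nnegrE ?(ltW u0) ?(ltW eu).
  by apply: (aux3 _ Dv DlE); rewrite -be2.
- by move=> /andP[eu _] /negP; rewrite (le_lt_trans e0 eu).
Qed.

End fixed_xy.
End bessel_kernel.

(** * The kernel of the potential: part near 0, tail, masses *)

Section radial_kernels.
Context {R : realType}.
Local Notation leb := (@lebesgue_measure R).
Local Notation one := (fun _ : R => 1%R : R).
Variables (a : R) (rho : R -> R).
Hypothesis ha : - 2^-1 <= a.
Hypothesis rho_pos : forall r : R, 0 < r -> 0 < rho r.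
Hypothesis rho_meas : measurable_fun (`]0, +oo[ : set R) rho.
Local Notation K := (rho_kernel a rho).
Local Notation w := (w_alpha a).
Local Notation d := (d_alpha a).

Let a1 : -1 < a. Proof. by have := ha; lra. Qed.
Let d0 : 0 < d. Proof. by rewrite /d_alpha; have := ha; lra. Qed.

Lemma measurable_extend0 (f : R -> R) : measurable_fun (`]0, +oo[ : set R) f ->
  measurable_fun setT (fun t : R => if 0 < t then f t else 0).
Proof.
move=> mf; apply: measurable_fun_if => //.
- by measurability.
- by apply: measurable_funS mf => // t [_ /=]; rewrite in_itv/= andbT.
Qed.

Lemma rho_kernel_ge0 u : 0 <= K u.
Proof.
(* At 0 the denominator is 0 and the quotient is 0 by the convention [0^-1 = 0], whatever the value
   of [rho 0]. *)
rewrite /rho_kernel; have [->|u0] := eqVneq u 0.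
  by rewrite normr0 powR0 ?gt_eqF// invr0 mulr0.
by rewrite divr_ge0 ?powR_ge0// ltW// rho_pos// normr_gt0.
Qed.

Lemma measurable_rho_kernel : measurable_fun setT K.
Proof.
pose f (t : R) := if 0 < t then rho t else 0.
have -> : K = fun u => f `|u| * `|u| `^ (- d).
  apply/funext => u; rewrite /rho_kernel /f powRN normr_gt0.
  case: eqVneq => //= ->; rewrite normr0 powR0 ?gt_eqF//.
  by rewrite invr0 !mulr0.
apply: measurable_funM; last by measurability.
by apply: (measurableT_comp (measurable_extend0 rho_meas)); measurability.
Qed.

Definition near_kernel (r u : R) : R := if `|u| < r then K u else 0.

Lemma near_kernel_ge0 r u : 0 <= near_kernel r u.
Proof. by rewrite /near_kernel; case: ifP => // _; exact: rho_kernel_ge0. Qed.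

Lemma measurable_near_kernel r : measurable_fun setT (near_kernel r).
Proof. by have := measurable_rho_kernel => mK; rewrite /near_kernel; measurability. Qed.

Definition tail_weight (r t : R) : R := if r < t then rho t * t `^ (- d - 1) else 0.

Lemma tail_weight_ge0 (r t : R) : 0 < r -> 0 <= tail_weight r t.
Proof.
move=> r0; rewrite /tail_weight; case: ifP => // rt.
by rewrite mulr_ge0 ?powR_ge0// ltW// rho_pos// (lt_trans r0).
Qed.

Lemma measurable_tail_weight (r : R) : 0 < r -> measurable_fun setT (tail_weight r).
Proof.
move=> r0; pose f (t : R) := if 0 < t then rho t else 0.
have mf : measurable_fun setT f := measurable_extend0 rho_meas.
have -> : tail_weight r = fun t => if r < t then f t * t `^ (- d - 1) else 0.
  apply/funext => t; rewrite /tail_weight /f; case: ifP => // rt.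
  by rewrite (lt_trans r0 rt).
by measurability.
Qed.

(* Doubling bounds [K u] by the average of [rho t * t^(-d-1)] over [|u|, 2|u|],
   which replaces the usual dyadic decomposition by an integral over [t]. *)
Lemma rho_kernel_le_tail (Cr r u : R) :
  (forall s t : R, 0 < s -> 0 < t -> 2^-1 <= s / t <= 2 -> rho s <= Cr * rho t) ->
  0 < Cr -> 0 < r ->
  ((K u)%:E <= (near_kernel r u)%:E + (Cr * 2 `^ (d + 1))%:E *
     wint one (fun t => (tail_weight r t)%:E * (ind_ball t u)%:E))%E.
Proof.
move=> hdbl Cr0 r0; have C0 : 0 <= Cr * 2 `^ (d + 1) by rewrite mulr_ge0 ?powR_ge0// ltW.
have i0 t : (0 <= (tail_weight r t)%:E * (ind_ball t u)%:E)%E.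
  by rewrite mule_ge0// lee_fin ?tail_weight_ge0 ?ind_ball_ge0.
rewrite /near_kernel; have [ur|ru] := ltP `|u| r.
  by rewrite leeDl// mule_ge0 ?lee_fin// wint_ge0.
rewrite add0e; set v : R := `|u|; have v0 : 0 < v by rewrite (lt_le_trans r0).
(* A lower bound for the tail weight on []v, 2 v[], an interval of length [v];
   [Cr * 2^(d+1) * c * v] is exactly [K u]. *)
pose c := rho v / Cr * (2 * v) `^ (- d - 1).
have c0 : 0 <= c by rewrite mulr_ge0 ?powR_ge0// divr_ge0 ?ltW// rho_pos.
apply: (@le_trans _ _ ((Cr * 2 `^ (d + 1))%:E * (c * v)%:E)%E).
  rewrite -EFinM lee_fin /K /rho_kernel -/v /c.
  have -> : - d - 1 = - (d + 1) by lra.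
  rewrite powRN powRM ?(ltW v0)// powRD_gt0// (powRD_gt0 d 1 v0) (powRr1 (ltW v0)) powRr1//.
  have h1 : 2 `^ d != 0 by rewrite gt_eqF// powR_gt0.
  have h2 : v `^ d != 0 by rewrite gt_eqF// powR_gt0.
  rewrite le_eqVlt; apply/orP; left; apply/eqP; field.
  by rewrite h1 h2 !gt_eqF.
apply: lee_wpmul2l; first by rewrite lee_fin.
apply: (@le_trans _ _ (\int[leb]_(t in `]v, (2 * v)%R[) c%:E)%E).
  rewrite (integral_cst _ _ c%:E)//= lebesgue_measure_itv/= lte_fin ltr_pMl// ltr1n.
  by rewrite -EFinD -EFinM lee_fin le_eqVlt; apply/orP; left; apply/eqP; ring.
rewrite /wint; apply: ge0_leint_supp => [t _|t _|t|t _ nT]; last by case: nT.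
  by rewrite lee_fin.
  by rewrite mule_ge0// lee_fin.
rewrite /= in_itv/= => /andP[vt tv] _; rewrite mule1 /ind_ball vt mule1 lee_fin.
have t0 : 0 < t by exact: lt_trans vt.
rewrite /tail_weight (le_lt_trans ru vt) /c.
apply: ler_pM; rewrite ?powR_ge0//; first by rewrite divr_ge0 ?ltW// rho_pos.
  rewrite ler_pdivrMr// [leRHS]mulrC; apply: hdbl => //.
  by rewrite ler_pdivlMr// ler_pdivrMr//; apply/andP; split; lra.
have -> : - d - 1 = - (d + 1) by lra.
rewrite !powRN lef_pV2 ?posrE ?powR_gt0//; last by rewrite mulr_gt0.
have d10 : 0 <= d + 1 by rewrite addr_ge0// ltW.
by apply: (ge0_ler_powR d10); rewrite ?nnegrE ?(ltW t0) ?(ltW tv)// mulr_ge0// ltW.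
Qed.

(** The density [|u|^(d-1)] against [|u|^(-d)] leaves [1 / t]; the factor 2 counts the two
    half-lines. *)
Lemma wint_near_kernel_le (r : R) : 0 < r ->
  (wint w (fun u => (near_kernel r u)%:E) <=
   (2 * A_alpha a)%:E * \int[leb]_(t in `]0%R, r[) (rho t / t)%:E)%E.
Proof.
move=> r0; have A0 := A_alpha_gt0 a1.
have mK := measurable_near_kernel r.
have mw := measurable_w_alpha a.
have -> : wint w (fun u => (near_kernel r u)%:E) =
    (\int[leb]_u (near_kernel r `|u| * w `|u|)%:E)%E.
  apply: eq_integral => u _.
  by rewrite -EFinM /near_kernel /rho_kernel /w_alpha !normr_id.
rewrite (integral_abs_sym (g := fun u => near_kernel r u * w u)); first last.
- by move=> u; apply: mulr_ge0; [exact: near_kernel_ge0|exact: w_alpha_ge0].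
- by apply: measurable_funM; (apply: measurableT_comp => //; exact: normr_measurable).
rewrite EFinM -muleA; apply: lee_wpmul2l; first by rewrite lee_fin.
rewrite -ge0_integralZl_EFin//; first last.
- exact: ltW.
- apply/measurable_EFinP.
  have -> : (fun t => rho t / t) = (fun t => rho t * t^-1) by [].
  apply: (@eq_measurable_fun _ _ _ _ _ (fun t : R => rho t * t `^ (-1))).
    by move=> t; rewrite inE/= in_itv/= => /andP[t0 _]; rewrite powR_inv1// ltW.
  apply: measurable_funM; last by apply: measurable_funTS; measurability.
  by apply: measurable_funS rho_meas => // t /=; rewrite !in_itv/= andbT => /andP[].
- move=> t; rewrite /= in_itv/= => /andP[t0 _].
  by rewrite lee_fin divr_ge0 ?(ltW t0)// ltW// rho_pos.
apply: ge0_leint_supp => [u _|u|u|u]; rewrite /= ?in_itv/= ?andbT.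
- by rewrite lee_fin; apply: mulr_ge0; [exact: near_kernel_ge0|exact: w_alpha_ge0].
- move=> /andP[t0 _].
  by rewrite mule_ge0 ?lee_fin ?(ltW A0)// divr_ge0 ?(ltW t0)// ltW// rho_pos.
- move=> u0 /andP[_ ur]; rewrite -EFinM lee_fin /near_kernel (gtr0_norm u0) ur.
  rewrite /rho_kernel /w_alpha (gtr0_norm u0) /d_alpha.
  have -> : 2 * a + 2 = (2 * a + 1) + 1 by lra.
  rewrite (powRD_gt0 _ _ u0) (powRr1 (ltW u0)).
  have h : u `^ (2 * a + 1) != 0 by rewrite gt_eqF// powR_gt0.
  rewrite le_eqVlt; apply/orP; left; apply/eqP; field.
  by rewrite h gt_eqF.
- move=> u0 /negP; rewrite u0/= -leNgt => ru.
  by rewrite /near_kernel (gtr0_norm u0) ltNge ru/= mul0r.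
Qed.

Lemma measurable_ind_ball (t : R) : measurable_fun setT (ind_ball t).
Proof. by rewrite /ind_ball; measurability. Qed.

Lemma wint_ball_le (r : R) : 0 < r ->
  (wint w (fun u => (ind_ball r u)%:E) <= (2 * A_alpha a / d * r `^ d)%:E)%E.
Proof.
move=> r0; have A0 := A_alpha_gt0 a1.
have mK := measurable_ind_ball r.
have mw := measurable_w_alpha a.
have -> : wint w (fun u => (ind_ball r u)%:E) =
    (\int[leb]_u (ind_ball r `|u| * w `|u|)%:E)%E.
  apply: eq_integral => u _.
  by rewrite -EFinM /ind_ball /w_alpha !normr_id.
rewrite (integral_abs_sym (g := fun u => ind_ball r u * w u)); first last.
- by move=> u; apply: mulr_ge0; [exact: ind_ball_ge0|exact: w_alpha_ge0].
- by apply: measurable_funM; (apply: measurableT_comp => //; exact: normr_measurable).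
apply: (@le_trans _ _ (2%:E * ((A_alpha a)%:E * \int[leb]_(t in `]0%R, r[) (t `^ (d - 1))%:E))%E).
  apply: lee_wpmul2l; first by rewrite lee_fin.
  rewrite -ge0_integralZl_EFin//; first last.
  - exact: ltW.
  - by apply: measurable_funTS; measurability.
  - by move=> t _; rewrite lee_fin powR_ge0.
  apply: ge0_leint_supp => [u _|u _|u|u]; rewrite /= ?in_itv/= ?andbT.
  - by rewrite lee_fin; apply: mulr_ge0; [exact: ind_ball_ge0|exact: w_alpha_ge0].
  - by rewrite mule_ge0 ?lee_fin ?powR_ge0// ltW.
  - move=> u0 /andP[_ ur]; rewrite -EFinM lee_fin /ind_ball (gtr0_norm u0) ur mul1r.
    rewrite /w_alpha (gtr0_norm u0) /d_alpha.
    by have -> : 2 * a + 2 - 1 = 2 * a + 1 by lra.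
  - move=> u0 /negP; rewrite u0/= -leNgt => ru.
    by rewrite /ind_ball (gtr0_norm u0) ltNge ru/= mul0r.
rewrite integral_powR0// -!EFinM lee_fin le_eqVlt; apply/orP; left; apply/eqP; field.
by rewrite gt_eqF.
Qed.

End radial_kernels.

(** * The potential bound for an abstract translation *)

Section riesz_potential.
Context {R : realType}.
Local Notation leb := (@lebesgue_measure R).
Local Notation one := (fun _ : R => 1%R : R).
Variables (a : R) (phi psi rho : R -> R).
Hypothesis ha : - 2^-1 <= a.
Hypothesis phi_pos : forall r : R, 0 < r -> 0 < phi r.
Hypothesis psi_pos : forall r : R, 0 < r -> 0 < psi r.
Hypothesis rho_pos : forall r : R, 0 < r -> 0 < rho r.
Hypothesis phi_doubling : doubling phi.
Hypothesis rho_doubling : doubling rho.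
Hypothesis phi_meas : measurable_fun (`]0, +oo[ : set R) phi.
Hypothesis rho_meas : measurable_fun (`]0, +oo[ : set R) rho.
Hypothesis hcond : exists C : R, 0 < C /\ forall r : R, 0 < r ->
  ((phi r)%:E * (\int[leb]_(t in `]0%R, r[) (rho t / t)%:E)
    + \int[leb]_(t in `]r, +oo[) (rho t * phi t / t)%:E <= (C * psi r)%:E)%E.
Local Notation K := (rho_kernel a rho).
Local Notation w := (w_alpha a).
Local Notation d := (d_alpha a).

Let a1 : -1 < a. Proof. by have := ha; lra. Qed.
Let d0 : 0 < d. Proof. by rewrite /d_alpha; have := ha; lra. Qed.
Let w0 x : 0 <= w x. Proof. exact: w_alpha_ge0. Qed.
Let mw : measurable_fun setT w. Proof. exact: measurable_w_alpha. Qed.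

Lemma doubling_le (f : R -> R) : (forall r : R, 0 < r -> 0 < f r) -> doubling f ->
  exists C : R, 0 < C /\ forall s t : R, 0 < s -> 0 < t -> 2^-1 <= s / t <= 2 ->
    f s <= C * f t.
Proof.
move=> f0 [C [C0 h]]; exists C; split => // s t s0 t0 st.
by have /andP[_] := h s t s0 t0 st; rewrite ler_pdivrMr// f0.
Qed.

(* [P h] stands for the generalized translation of the even function [h]. *)
Variable P : (R -> R) -> R -> R -> \bar R.
Variables Cm C4 : R.
Hypothesis Cm0 : 0 < Cm.
Hypothesis C40 : 0 <= C4.
Hypothesis P_ge0 : forall (h : R -> R) x y, (forall u, 0 <= h u) -> (0 <= P h x y)%E.
Hypothesis P_sym : forall (h : R -> R) x y, (forall u, h (- u) = h u) -> P h x y = P h y x.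
Hypothesis P_tail : forall (h h1 c : R -> R) (C1 : R) x y, 0 <= C1 ->
  (forall u, 0 <= h u) -> (forall u, 0 <= h1 u) -> (forall t, 0 <= c t) ->
  measurable_fun setT h1 -> measurable_fun setT c ->
  (forall u, (h u)%:E <= (h1 u)%:E +
     C1%:E * wint one (fun t => (c t)%:E * (ind_ball t u)%:E))%E ->
  (P h x y <= P h1 x y + C1%:E * wint one (fun t => (c t)%:E * P (ind_ball t) x y))%E.
Hypothesis P_meas : forall h : R -> R, (forall u, 0 <= h u) -> measurable_fun setT h ->
  measurable_fun setT (fun q : R * R => P h q.1 q.2).
Hypothesis P_meas_ball : forall x,
  measurable_fun setT (fun q : R * R => P (ind_ball q.1) x q.2).
Hypothesis P_mass : forall (h : R -> R) x, (forall u, 0 <= h u) -> measurable_fun setT h ->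
  (wint w (P h x) <= Cm%:E * wint w (fun u => (h u)%:E))%E.
Hypothesis P_ball : forall (h : R -> R) (r x y z : R), 0 < r -> (forall u, 0 <= h u) ->
  (forall u, r <= `|u| -> h u = 0) ->
  (P h z y * P (ind_ball r) x z <= C4%:E * (P h z y * P (ind_ball (3 * r)) x y))%E.

(** Each term of the integral condition serves one part of the kernel: the integral over []0, r[]
    bounds the mass [I] of the near kernel, and the integral over []r, +oo[] bounds the tail with
    [lam t = M * phi t]. The near part sees [g] in a ball of radius [3 r], hence the doubling of
    [phi]. *)
Lemma riesz_bound (p : R) : 1 < p ->
  exists C : R, 0 < C /\ forall (g : R -> R) (M : R),
    (forall y, 0 <= g y) -> measurable_fun setT g -> 0 < M ->
    (forall t x : R, 0 < t ->
       (wint w (fun y => (g y `^ p)%:E * P (ind_ball t) x y) <=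
        ((M * phi t) `^ p * t `^ d)%:E)%E) ->
    forall r x : R, 0 < r ->
       (wint w (fun z => poweR (wint w (fun y => (g y)%:E * P K z y)) p * P (ind_ball r) x z) <=
        (C * (M * psi r) `^ p * r `^ d)%:E)%E.
Proof.
move=> p1; have p0 : 0 < p := lt_trans ltr01 p1.
have [C0 [C00 hC0]] := hcond.
have [Cf [Cf0 hCf]] := doubling_le phi_pos phi_doubling.
have [Cr [Cr0 hCr]] := doubling_le rho_pos rho_doubling.
have A0 := A_alpha_gt0 a1.
pose C1 : R := Cr * 2 `^ (d + 1).
pose C2 : R := Cm * (2 * A_alpha a / d).
have C10 : 0 <= C1 by rewrite mulr_ge0 ?powR_ge0// ltW.
have C20 : 0 < C2 by rewrite /C2 mulr_gt0// divr_gt0// mulr_gt0.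
(* Chosen so that [I * phi (3 * r) <= E1 * psi r]; the division by [phi r] in [I] is compensated by
   doubling, which costs [Cf ^+ 2]. *)
pose E1 : R := Cm * (2 * A_alpha a) * C0 * Cf ^+ 2.
pose C : R := 2 `^ p * (2 `^ p * E1 `^ p * C4 * 3 `^ d + (C1 * (1 + C2) * C0) `^ p * C2).
have E10 : 0 < E1 by rewrite /E1 !mulr_gt0// exprn_gt0.
have C12 : 0 < C1 * (1 + C2) * C0.
  by rewrite /C1 !mulr_gt0 ?powR_gt0 ?addr_gt0.
exists C; split.
  apply: mulr_gt0; first exact: powR_gt0.
  apply: ltr_wpDl; last by apply: mulr_gt0; [exact: powR_gt0|].
  by rewrite !mulr_ge0 ?powR_ge0.
move=> g M g0 mg M0 hg r x r0.
have r30 : 0 < 3 * r by rewrite mulr_gt0.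
pose I : R := Cm * (2 * A_alpha a) * (C0 * psi r / phi r).
have I0 : 0 < I by rewrite /I !mulr_gt0// ?invr_gt0 ?phi_pos ?psi_pos.
have phi0 : forall t : R, 0 < t -> 0 < phi t := phi_pos.
have hr := hC0 r r0.
have int1 : (0 <= \int[leb]_(t in `]0%R, r[) (rho t / t)%:E)%E.
  apply: integral_ge0 => t; rewrite /= in_itv/= => /andP[t0 _].
  by rewrite lee_fin divr_ge0 ?(ltW t0)// ltW// rho_pos.
have int2 : (0 <= \int[leb]_(t in `]r, +oo[) (rho t * phi t / t)%:E)%E.
  apply: integral_ge0 => t; rewrite /= in_itv/= andbT => rt; have t0 := lt_trans r0 rt.
  by rewrite lee_fin divr_ge0 ?(ltW t0)// mulr_ge0// ltW// ?rho_pos ?phi0.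
have near_le : (wint w (fun u => (near_kernel a rho r u)%:E) <=
    (2 * A_alpha a * (C0 * psi r / phi r))%:E)%E.
  apply: (le_trans (wint_near_kernel_le ha rho_pos rho_meas r0)).
  rewrite (EFinM (2 * _)); apply: lee_wpmul2l; first by rewrite lee_fin mulr_ge0// ltW.
  have h : ((phi r)%:E * \int[leb]_(t in `]0%R, r[) (rho t / t)%:E <= (C0 * psi r)%:E)%E.
    by apply: le_trans hr; rewrite leeDl.
  by rewrite EFinM lee_pdivlMr ?phi0// muleC.
have nk0 := near_kernel_ge0 ha rho_pos r.
have mnk := measurable_near_kernel ha rho_meas r.
have tw0 t : 0 <= tail_weight a rho r t by exact: tail_weight_ge0.
have mtw := measurable_tail_weight a rho_meas r0.
pose lam t := M * phi t.
have := @averaging_bound R w w0 mw d p C1 C2 C4 I (M * (C0 * psi r)) r (3 * r) x g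
  (tail_weight a rho r) lam (P K) (P (near_kernel a rho r)) (fun t => P (ind_ball t)).
move=> /(_ p1 C10 (ltW C20) C40 I0).
have B0 : 0 <= M * (C0 * psi r) by rewrite !mulr_ge0 ?(ltW C00) ?(ltW M0)// ltW// psi_pos.
move=> /(_ B0 r0 r30 g0 mg tw0).
have twneg t : t <= 0 -> tail_weight a rho r t = 0.
  by move=> t0; rewrite /tail_weight ltNge (le_trans t0 (ltW r0)).
move=> /(_ twneg mtw).
have lam0 t : 0 < t -> 0 < lam t by move=> t0; rewrite mulr_gt0// phi0.
move=> /(_ lam0).
have mcl : measurable_fun setT (fun t => tail_weight a rho r t * (lam t * t `^ d)).
  have mphi := measurable_extend0 phi_meas.
  apply: (eq_measurable_fun (fun t : R => tail_weight a rho r t *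
      (M * (if 0 < t then phi t else 0) * t `^ d))).
    move=> t _; rewrite /lam; case: ifP => // /negbT; rewrite -leNgt => t0.
    by rewrite twneg// !mul0r.
  by measurability.
move=> /(_ mcl).
have K0 := rho_kernel_ge0 ha rho_pos.
move=> /(_ (fun z y => P_ge0 z y K0) (fun z y => P_ge0 z y nk0)
  (fun t z y => P_ge0 z y (ind_ball_ge0 t)) (P_meas nk0 mnk) P_meas_ball).
have h1 z y : (P K z y <= P (near_kernel a rho r) z y +
    C1%:E * wint one (fun t => (tail_weight a rho r t)%:E * P (ind_ball t) z y))%E.
  by apply: P_tail => // u; exact: (rho_kernel_le_tail ha rho_pos u hCr Cr0 r0).
move=> /(_ h1).
have h2 (t z : R) : 0 < t -> (wint w (P (ind_ball t) z) <= (C2 * t `^ d)%:E)%E.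
  move=> t0; apply: (le_trans (P_mass z (ind_ball_ge0 t) (measurable_ind_ball t))).
  rewrite /C2 -mulrA EFinM; apply: lee_wpmul2l; first by rewrite lee_fin ltW.
  exact: wint_ball_le.
move=> /(_ h2).
have h3 z : (wint w (P (near_kernel a rho r) z) <= I%:E)%E.
  apply: (le_trans (P_mass z nk0 mnk)).
  rewrite /I -[in leRHS]mulrA EFinM; apply: lee_wpmul2l => //; first by rewrite lee_fin ltW.
move=> /(_ h3).
have h3' y : (wint w ((P (near_kernel a rho r))^~ y) <= I%:E)%E.
  rewrite (_ : (P _)^~ y = P (near_kernel a rho r) y) ?h3//.
  apply/funext => z; apply: P_sym => u.
  by rewrite /near_kernel /rho_kernel normrN.
move=> /(_ h3').
have h4 z y : (P (near_kernel a rho r) z y * P (ind_ball r) x z <=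
    C4%:E * (P (near_kernel a rho r) z y * P (ind_ball (3 * r)) x y))%E.
  by apply: P_ball => // u ru; rewrite /near_kernel ltNge ru.
move=> /(_ h4 hg).
(* The volume factor [t^d] cancels the [t^(-d)] of the tail weight and leaves [M] times the
   integrand [rho t * phi t / t] of the condition. *)
have hB : (wint one (fun t => (tail_weight a rho r t * (lam t * t `^ d))%:E) <=
    (M * (C0 * psi r))%:E)%E.
  apply: (@le_trans _ _ (M%:E * \int[leb]_(t in `]r, +oo[) (rho t * phi t / t)%:E)%E).
    rewrite -ge0_integralZl_EFin ?(ltW M0)//; first last.
    - apply/measurable_EFinP.
      apply: (eq_measurable_fun (fun t : R => rho t * phi t * t `^ (-1))).
        move=> t; rewrite inE/= in_itv/= andbT => rt.
        by rewrite powR_inv1// ltW// (lt_trans r0 rt).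
      have sub : (`]r, +oo[ `<=` `]0, +oo[)%classic.
        by move=> t /=; rewrite !in_itv/= !andbT; exact: lt_trans.
      apply: measurable_funM; last by apply: measurable_funTS; measurability.
      by apply: measurable_funM; [exact: measurable_funS rho_meas|exact: measurable_funS phi_meas].
    - move=> t; rewrite /= in_itv/= andbT => rt; have t0 := lt_trans r0 rt.
      by rewrite lee_fin divr_ge0 ?(ltW t0)// mulr_ge0// ltW// ?rho_pos ?phi0.
    apply: ge0_leint_supp => [t _|t|t _|t _]; rewrite /= ?in_itv/= ?andbT.
    - rewrite mule1 lee_fin; have [t0|t0] := ltP 0 t; last by rewrite twneg// mul0r.
      apply: mulr_ge0; first exact: tw0.
      by apply: mulr_ge0; [exact: ltW (lam0 _ t0)|exact: powR_ge0].
    - move=> rt; have t0 := lt_trans r0 rt.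
      rewrite mule_ge0 ?lee_fin ?(ltW M0)//.
      by rewrite divr_ge0 ?(ltW t0)// mulr_ge0// ltW// ?rho_pos ?phi0.
    - move=> rt; have t0 := lt_trans r0 rt.
      rewrite mule1 -EFinM lee_fin /tail_weight rt /lam.
      have -> : - d - 1 = - (d + 1) by lra.
      rewrite powRN (powRD_gt0 d 1 t0) (powRr1 (ltW t0)).
      have h : t `^ d != 0 by rewrite gt_eqF// powR_gt0.
      rewrite le_eqVlt; apply/orP; left; apply/eqP; field.
      by rewrite h gt_eqF.
    - by move=> /negP; rewrite /tail_weight => /negbTE ->; rewrite mul0r mul0e.
  rewrite EFinM; apply: lee_wpmul2l; first by rewrite lee_fin ltW.
  apply: le_trans hr; rewrite leeDr// mule_ge0// lee_fin ltW// phi0//.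
move=> /(_ hB) /le_trans; apply; rewrite lee_fin /C.
(* The ratio 3 exceeds 2, so doubling is applied twice, through the radius [3 / 2 * r]. *)
have phi3 : phi (3 * r) <= Cf ^+ 2 * phi r.
  have h32 : 0 < 3 / 2 * r by rewrite mulr_gt0.
  have q1 : phi (3 * r) <= Cf * phi (3 / 2 * r).
    apply: hCf => //; rewrite invfM mulrACA divff ?gt_eqF// mulr1.
    by apply/andP; split; lra.
  have q2 : phi (3 / 2 * r) <= Cf * phi r.
    apply: hCf => //; rewrite mulfK ?gt_eqF//.
    by apply/andP; split; lra.
  by apply: (le_trans q1); rewrite expr2 -[leRHS]mulrA ler_pM2l.
rewrite -[leRHS]mulrA -[leRHS]mulrA ler_pM2l ?powR_gt0// [leRHS]mulrDl; apply: lerD.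
  have -> : 2 `^ p * I `^ p * C4 * (lam (3 * r) `^ p * (3 * r) `^ d) =
      2 `^ p * C4 * 3 `^ d * r `^ d * (I * lam (3 * r)) `^ p.
    rewrite (powRM _ (_ : 0 <= 3) (ltW r0))//.
    rewrite (powRM _ (ltW I0) (ltW (lam0 _ r30))); ring.
  have -> : 2 `^ p * E1 `^ p * C4 * 3 `^ d * ((M * psi r) `^ p * r `^ d) =
      2 `^ p * C4 * 3 `^ d * r `^ d * (E1 * (M * psi r)) `^ p.
    rewrite (powRM _ (ltW E10)); last by rewrite mulr_ge0 ?(ltW M0)// ltW// psi_pos.
    ring.
  apply: ler_wpM2l; first by rewrite !mulr_ge0 ?powR_ge0.
  apply: (ge0_ler_powR (ltW p0)); rewrite ?nnegrE.
  - by rewrite mulr_ge0 ?(ltW I0)// ltW// lam0.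
  - by rewrite mulr_ge0 ?(ltW E10)// mulr_ge0 ?(ltW M0)// ltW// psi_pos.
  rewrite /I /lam /E1.
  have -> : Cm * (2 * A_alpha a) * C0 * Cf ^+ 2 * (M * psi r) =
      Cm * (2 * A_alpha a) * (C0 * psi r / phi r) * (M * (Cf ^+ 2 * phi r)).
    by field; rewrite gt_eqF// phi0.
  rewrite ler_pM2l; last exact: I0.
  by rewrite ler_pM2l.
rewrite le_eqVlt; apply/orP; left; apply/eqP.
have -> : C1 * (1 + C2) * (M * (C0 * psi r)) = C1 * (1 + C2) * C0 * (M * psi r) by ring.
rewrite (powRM _ (ltW C12)); last by rewrite mulr_ge0 ?(ltW M0)// ltW// psi_pos.
ring.
Qed.

End riesz_potential.

(** * Elementary inequalities behind the choice of radii *)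

Section ball_arithmetic.
Context {R : realType}.
Implicit Types r v X Y : R.

(** Origin of 5/32: of the available [9 r^2], the square [(X - Y)^2] takes at most [4 r^2], and
    [X * Y <= 2 r * 4 r] makes the other term at most [32 r^2 * (5/32) = 5 r^2]. *)
Lemma sqrB_le_of_small r X Y : 0 < r -> 0 < X -> 0 < Y -> X <= 2 * r ->
  - (2 * r) < X - Y -> X - Y < 2 * r ->
  (X - Y) ^+ 2 + 4 * (X * Y) * (5 / 32) <= (3 * r) ^+ 2.
Proof.
move=> r0 X0 Y0 Xr XY1 XY2; have h1 : (X - Y) ^+ 2 <= 4 * r ^+ 2 by nra.
have h2 : X * Y <= 8 * r ^+ 2 by nra.
by nra.
Qed.

(** Here [Y < 2 X], so [4 X Y <= 8 X^2]; the normalization of [v] lets it use up the same remainder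
    [5 r^2]. *)
Lemma sqrB_le_of_large r v X Y : 0 < r -> 0 < Y -> 0 < v -> 2 * r < X ->
  - (2 * r) < X - Y -> X - Y < 2 * r -> v * (8 * X ^+ 2) = 5 * r ^+ 2 ->
  (X - Y) ^+ 2 + 4 * (X * Y) * v <= (3 * r) ^+ 2.
Proof.
move=> r0 Y0 v0 Xr XY1 XY2 vE; have h1 : (X - Y) ^+ 2 <= 4 * r ^+ 2 by nra.
have h2 : 4 * (X * Y) <= 8 * X ^+ 2 by nra.
by have h3 : v * (4 * (X * Y)) <= v * (8 * X ^+ 2); [rewrite ler_pM2l|nra].
Qed.

(** The hypotheses force [Y > X / 2]. *)
Lemma sqr_le_mul_of_near r X Y : 0 < r -> 2 * r < X -> X - Y < r ->
  2 * X ^+ 2 <= 4 * (X * Y).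
Proof. by nra. Qed.

Lemma sqrBr_le_mul r X Y : 0 < r -> 2 * r < X -> X - Y < r ->
  r ^+ 2 - (X - Y) ^+ 2 <= 4 * (X * Y) / 2.
Proof. by move=> r0 Xr XY; have := sqr_le_mul_of_near r0 Xr XY; nra. Qed.

Lemma sqr_le_of_large r X : 0 < r -> 2 * r < X -> 5 * r ^+ 2 <= 2^-1 * (8 * X ^+ 2).
Proof. by nra. Qed.

End ball_arithmetic.

(** * The Bessel translation: domination, mass, support, comparison of balls *)

Section bessel_translation.
Context {R : realType}.
Local Notation leb := (@lebesgue_measure R).
Local Notation one := (fun _ : R => 1%R : R).
Variable a : R.
Hypothesis ha : - 2^-1 < a.
Local Notation w := (w_alpha a).
Local Notation P := (btrans a).

Let a1 : -1 < a. Proof. by have := ha; lra. Qed.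
Let s0 : 0 < a + 2^-1. Proof. by have := ha; lra. Qed.
Let w0 x : 0 <= w x. Proof. exact: w_alpha_ge0. Qed.
Let mw : measurable_fun setT w. Proof. exact: measurable_w_alpha. Qed.
Let one0 (t : R) : 0 <= one t. Proof. by []. Qed.
Let mone : measurable_fun setT one. Proof. exact: measurable_cst. Qed.
Let bk0 := bkernel_ge0 ha.

Lemma btrans_ge0 (h : R -> R) x y : (forall u, 0 <= h u) -> (0 <= P h x y)%E.
Proof. by move=> h0; apply: wint_ge0 => // u; rewrite lee_fin mulr_ge0. Qed.

Lemma btransC (h : R -> R) x y : P h x y = P h y x.
Proof. by apply: eq_integral => u _; rewrite bkernelC. Qed.

Let mbk x y : measurable_fun setT (bkernel a x y).
Proof. exact: (@measurable_bkernel _ a _ _ (fun=> x) (fun=> y) id). Qed.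

(** The pointwise bound is integrated against the nonnegative kernel, and the integrals over [t] and
    [u] are exchanged. *)
Lemma btrans_tail (h h1 c : R -> R) (C1 : R) x y : 0 <= C1 ->
  (forall u, 0 <= h u) -> (forall u, 0 <= h1 u) -> (forall t, 0 <= c t) ->
  measurable_fun setT h1 -> measurable_fun setT c ->
  (forall u, (h u)%:E <= (h1 u)%:E +
     C1%:E * wint one (fun t => (c t)%:E * (ind_ball t u)%:E))%E ->
  (P h x y <= P h1 x y + C1%:E * wint one (fun t => (c t)%:E * P (ind_ball t) x y))%E.
Proof.
move=> C10 h0 h10 c0 mh1 mc hh.
have mb := mbk x y.
have mind : measurable_fun setT (fun q : R * R => ind_ball q.2 q.1).
  by rewrite /ind_ball; measurability.
have mind1 u : measurable_fun setT (fun t : R => ind_ball t u).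
  by rewrite /ind_ball; measurability.
have ib0 := @ind_ball_ge0 R.
have -> : wint one (fun t => (c t)%:E * P (ind_ball t) x y)%E =
    wint w (fun u => wint one (fun t => (c t)%:E * (ind_ball t u * bkernel a x y u)%:E)%E).
  rewrite (wint_swap w0 mw one0 mone
      (h := fun u t => ((c t)%:E * (ind_ball t u * bkernel a x y u)%:E)%E)).
  - apply: eq_integral => t _; congr (_ * _)%E; rewrite wintZl ?lee_fin//.
    + by move=> u; rewrite lee_fin mulr_ge0.
    + have := measurable_ind_ball t => mt.
      by measurability.
  - by move=> u t; rewrite mule_ge0// lee_fin// mulr_ge0.
  - have m1 : measurable_fun setT (fun q : R * R => c q.2) by exact: measurableT_comp.
    have m2 : measurable_fun setT (fun q : R * R => bkernel a x y q.1) by exact: measurableT_comp.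
    by measurability.
have W0 u : (0 <= wint one (fun t => (c t)%:E * (ind_ball t u)%:E))%E.
  by apply: wint_ge0 => // t; rewrite mule_ge0// lee_fin.
have WE u : wint one (fun t => (c t)%:E * (ind_ball t u * bkernel a x y u)%:E)%E =
    ((bkernel a x y u)%:E * wint one (fun t => (c t)%:E * (ind_ball t u)%:E))%E.
  rewrite -wintZl//.
  - by apply: eq_integral => t _; rewrite mule1 mule1 EFinM muleA muleC.
  - by rewrite lee_fin.
  - by move=> t; rewrite mule_ge0// lee_fin.
  - have := mind1 u => mi; by measurability.
apply: (@le_trans _ _ (wint w (fun u => (h1 u * bkernel a x y u)%:E +
    C1%:E * wint one (fun t => (c t)%:E * (ind_ball t u * bkernel a x y u)%:E)))%E).
  apply: le_wint => // u; first by rewrite lee_fin mulr_ge0.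
  rewrite WE EFinM [(h1 u * _)%:E]EFinM muleCA ![((bkernel _ _ _ _)%:E * _)%E]muleC.
  rewrite -ge0_muleDl; first by apply: lee_wpmul2r => //; rewrite lee_fin.
  - by rewrite lee_fin.
  - by apply: mule_ge0; [rewrite lee_fin|].
have mW : measurable_fun setT (fun u => wint one (fun t => (c t)%:E *
    (ind_ball t u * bkernel a x y u)%:E)%E).
  apply: measurable_wint => //; first by move=> u t; rewrite mule_ge0// lee_fin// mulr_ge0.
  have m1 : measurable_fun setT (fun q : R * R => c q.2) by exact: measurableT_comp.
  have m2 : measurable_fun setT (fun q : R * R => bkernel a x y q.1) by exact: measurableT_comp.
  by measurability.
have W0' u : (0 <= wint one (fun t => (c t)%:E * (ind_ball t u * bkernel a x y u)%:E))%E.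
  by rewrite WE mule_ge0// lee_fin.
rewrite wintD//; first last.
- by measurability.
- by measurability.
- by move=> u; rewrite mule_ge0.
- by move=> u; rewrite lee_fin mulr_ge0.
by rewrite wintZl.
Qed.

Lemma measurable_btrans (h : R -> R) : (forall u, 0 <= h u) -> measurable_fun setT h ->
  measurable_fun setT (fun q : R * R => P h q.1 q.2).
Proof.
move=> h0 mh.
apply: (measurable_wint w0 mw (h := fun (q : R * R) z => (h z * bkernel a q.1 q.2 z)%:E)).
  by move=> q z; rewrite lee_fin mulr_ge0.
apply/measurable_EFinP; apply: measurable_funM; first exact: measurableT_comp.
by apply: measurable_bkernel; measurability.
Qed.

Lemma measurable_btrans_ball x :
  measurable_fun setT (fun q : R * R => P (ind_ball q.1) x q.2).
Proof.
apply: (measurable_wint w0 mw (h := fun (q : R * R) z => (ind_ball q.1 z * bkernel a x q.2 z)%:E)).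
  by move=> q z; rewrite lee_fin mulr_ge0// ind_ball_ge0.
apply/measurable_EFinP; apply: measurable_funM; first by rewrite /ind_ball; measurability.
by apply: measurable_bkernel; measurability.
Qed.

Lemma btrans0 (h : R -> R) y : P h 0 y = 0%E.
Proof.
by rewrite /btrans /wint integral0_eq// => u _; rewrite /bkernel eqxx/= mulr0 mul0e.
Qed.

Lemma btrans0r (h : R -> R) x : P h x 0 = 0%E.
Proof. by rewrite btransC btrans0. Qed.

Definition btrans_mass_const : R :=
  2 * bessel_const a * (1 + 2 `^ (- (a + 2^-1 - 1))) / (a + 2^-1).
Local Notation Cm := btrans_mass_const.

Lemma btrans_mass_const_gt0 : 0 < Cm.
Proof.
apply: divr_gt0 => //; apply: mulr_gt0; last by rewrite ltr_pwDl// powR_ge0.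
by apply: mulr_gt0 => //; exact: bessel_const_gt0.
Qed.

Lemma btrans_ball_le_mass r x y : (P (ind_ball r) x y <= Cm%:E)%E.
Proof.
have C0 : (0 <= Cm%:E)%E by rewrite lee_fin ltW// btrans_mass_const_gt0.
have [->|x0] := eqVneq x 0; first by rewrite btrans0.
have [->|y0] := eqVneq y 0; first by rewrite btrans0r.
exact: btrans_ball_le.
Qed.

(** The kernel is supported in [|z| <= |x| + |y|], so a large ball sees all of it; the summand 1 in
    its radius is there because the ball is open. *)
Lemma bkernel_mass x y : (wint w (fun z => (bkernel a x y z)%:E) <= Cm%:E)%E.
Proof.
apply: le_trans (btrans_ball_le_mass (`|x| + `|y| + 1) x y).
apply: le_wint => // z; first by rewrite lee_fin.
rewrite lee_fin /ind_ball; case: ifP => [|/negbT h]; first by rewrite mul1r.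
suff /eqP -> : bkernel a x y z == 0 by rewrite mulr0.
apply: contraNT h => /bkernel_supp /andP[_ h].
by rewrite (le_lt_trans h)// ltrDl.
Qed.

(** After an exchange of integrals, the symmetry of the kernel in its last two arguments turns the
    integral over [y] into a total mass. *)
Lemma btrans_mass (h : R -> R) x : (forall u, 0 <= h u) -> measurable_fun setT h ->
  (wint w (P h x) <= Cm%:E * wint w (fun u => (h u)%:E))%E.
Proof.
move=> h0 mh.
have C0 : (0 <= Cm%:E)%E by rewrite lee_fin ltW// btrans_mass_const_gt0.
have mk : measurable_fun setT (fun q : R * R => bkernel a x q.1 q.2).
  exact: (@measurable_bkernel _ a _ _ (fun=> x) fst snd).
rewrite /btrans (wint_swap w0 mw w0 mw (h := fun y z => (h z * bkernel a x y z)%:E)); first last.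
- by apply/measurable_EFinP; apply: measurable_funM => //; exact: measurableT_comp.
- by move=> y z; rewrite lee_fin mulr_ge0.
rewrite -wintZl//; first last.
- exact/measurable_EFinP.
apply: le_wint => // z.
  by apply: wint_ge0 => // y; rewrite lee_fin mulr_ge0.
have -> : wint w (fun y => (h z * bkernel a x y z)%:E) =
    ((h z)%:E * wint w (fun y => (bkernel a x z y)%:E))%E.
  rewrite -(wintZl w0 mw (c := (h z)%:E) (h := fun y => (bkernel a x z y)%:E)).
  - by apply: eq_integral => y _; rewrite EFinM bkernelCr.
  - by rewrite lee_fin.
  - by move=> y; rewrite lee_fin.
  - have := mbk x z => m; exact/measurable_EFinP.
by rewrite muleC; apply: lee_wpmul2r; rewrite ?lee_fin// bkernel_mass.
Qed.

Lemma btrans_eq0 (h : R -> R) r x y : (forall u : R, r <= `|u| -> h u = 0) ->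
  r <= `| `|x| - `|y| | -> P h x y = 0%E.
Proof.
move=> hz hr; rewrite /btrans /wint integral0_eq// => u _.
have [ru|ur] := leP r `|u|; first by rewrite hz// mul0r mul0e.
suff /eqP -> : bkernel a x y u == 0 by rewrite mulr0 mul0e.
apply: contraTT ur => /bkernel_supp /andP[h1 _].
by rewrite -leNgt (le_trans hr).
Qed.

Definition btrans_low_const : R :=
  bessel_const a / (1 + 2 `^ (a + 2^-1 - 1)) / (a + 2^-1).
Local Notation Cl := btrans_low_const.

Lemma btrans_low_const_gt0 : 0 < Cl.
Proof.
apply: divr_gt0 => //; apply: divr_gt0; first exact: bessel_const_gt0.
by rewrite ltr_pwDl// powR_ge0.
Qed.

Lemma btrans_ball_lower (r v x y : R) : x != 0 -> y != 0 -> 0 < r -> 0 < v -> v <= 2^-1 ->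
  (`|x| - `|y|) ^+ 2 + 4 * (`|x| * `|y|) * v <= r ^+ 2 ->
  ((Cl * v `^ (a + 2^-1))%:E <= P (ind_ball r) x y)%E.
Proof.
move=> x0 y0 r0 v0 v1 hr; apply: btrans_ball_ge => //.
by rewrite real_normK ?num_real.
Qed.

(** One summand for each case of the comparison below: [|x| <= 2 r], then [|x| > 2 r]. *)
Definition btrans_cmp_const : R :=
  Cm / (Cl * (5 / 32) `^ (a + 2^-1)) + Cm / Cl.
Local Notation C4 := btrans_cmp_const.

Lemma btrans_cmp_const_ge0 : 0 <= C4.
Proof.
have := btrans_mass_const_gt0; have := btrans_low_const_gt0 => h1 h2.
have h3 : 0 < (5 / 32 : R) `^ (a + 2^-1) by rewrite powR_gt0.
by apply: addr_ge0; apply: ltW; apply: divr_gt0 => //; exact: mulr_gt0.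
Qed.

(** For [|x| <= 2 r] the left average is at most the mass constant, and the right one is at least a
    constant, since a fixed fraction 5/32 of its interval is covered. For [|x| > 2 r] both are
    compared with [v^(a+1/2)], where [v] is of order [(r / |x|)^2]. If [|z|] is not within [r] of
    [|x|] the left side is 0. *)
Lemma btrans_ball_compare (r x y z : R) : 0 < r -> x != 0 -> y != 0 ->
  `| `|x| - `|y| | < 2 * r ->
  (P (ind_ball r) x z <= C4%:E * P (ind_ball (3 * r)) x y)%E.
Proof.
move=> r0 x0 y0; rewrite ltr_norml => /andP[xy1 xy2].
have Cm0 := btrans_mass_const_gt0; have Cl0 := btrans_low_const_gt0.
have C40 := btrans_cmp_const_ge0.
have r30 : 0 < 3 * r by rewrite mulr_gt0.
have P0 : (0 <= P (ind_ball (3 * r)) x y)%E by apply: btrans_ge0; exact: ind_ball_ge0.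
have [->|z0] := eqVneq z 0; first by rewrite btrans0r mule_ge0// lee_fin.
have [rz|zr] := leP r `| `|x| - `|z| |.
  rewrite (btrans_eq0 (r := r))//; first by rewrite mule_ge0// lee_fin.
  by move=> u ru; rewrite /ind_ball ltNge ru.
move: (zr); rewrite ltr_norml => /andP[zr1 zr2].
have X0 : 0 < `|x| by rewrite normr_gt0.
have Y0 : 0 < `|y| by rewrite normr_gt0.
have Z0 : 0 < `|z| by rewrite normr_gt0.
have q0 : 0 < (5 / 32 : R) `^ (a + 2^-1) by rewrite powR_gt0.
have [xr|rx] := leP `|x| (2 * r).
  have low : ((Cl * (5 / 32) `^ (a + 2^-1))%:E <= P (ind_ball (3 * r)) x y)%E.
    apply: btrans_ball_lower => //; first by lra.
    exact: sqrB_le_of_small.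
  apply: (le_trans (btrans_ball_le_mass r x z)).
  apply: (@le_trans _ _ (C4%:E * (Cl * (5 / 32) `^ (a + 2^-1))%:E)%E); last first.
    by apply: lee_wpmul2l => //; rewrite lee_fin.
  have cq : Cl * (5 / 32) `^ (a + 2^-1) != 0 by rewrite (gt_eqF (mulr_gt0 Cl0 q0)).
  rewrite -EFinM lee_fin /btrans_cmp_const mulrDl divfK//.
  rewrite lerDl; apply: mulr_ge0; apply: ltW; first exact: divr_gt0.
  exact: mulr_gt0.
pose v : R := 5 * r ^+ 2 / (8 * `|x| ^+ 2).
have x2 : 0 < 8 * `|x| ^+ 2 by rewrite mulr_gt0// exprn_gt0.
have v0 : 0 < v by rewrite /v divr_gt0// mulr_gt0// exprn_gt0.
have vE : v * (8 * `|x| ^+ 2) = 5 * r ^+ 2 by rewrite /v divfK// gt_eqF.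
have v1 : v <= 2^-1 by rewrite /v ler_pdivrMr//; exact: sqr_le_of_large.
have low : ((Cl * v `^ (a + 2^-1))%:E <= P (ind_ball (3 * r)) x y)%E.
  apply: btrans_ball_lower => //.
  exact: sqrB_le_of_large.
apply: (@le_trans _ _ (Cm * v `^ (a + 2^-1))%:E); last first.
  apply: (@le_trans _ _ (C4%:E * (Cl * v `^ (a + 2^-1))%:E)%E); last first.
    by apply: lee_wpmul2l => //; rewrite lee_fin.
  rewrite -EFinM lee_fin mulrA ler_pM2r ?powR_gt0//.
  rewrite /btrans_cmp_const mulrDl divfK ?(gt_eqF Cl0)// lerDr.
  by apply: mulr_ge0; apply: ltW => //; apply: divr_gt0 => //; exact: mulr_gt0.
have ez : `| `|x| - `|z| | ^+ 2 = (`|x| - `|z|) ^+ 2 by rewrite real_normK ?num_real.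
have small : `| `|x| - `|z| | < r -> r ^+ 2 - `| `|x| - `|z| | ^+ 2 <= 4 * (`|x| * `|z|) / 2 ->
  (P (ind_ball r) x z <= (bessel_const a * (1 + 2 `^ (- (a + 2^-1 - 1))) / (a + 2^-1) *
   ((r ^+ 2 - `| `|x| - `|z| | ^+ 2) / (4 * (`|x| * `|z|))) `^ (a + 2^-1))%:E)%E.
  exact: btrans_ball_le_small.
apply: le_trans (small zr _) _; first by rewrite ez; exact: sqrBr_le_mul.
rewrite lee_fin; apply: ler_pM.
- apply: divr_ge0; last exact: ltW.
  by apply: mulr_ge0; [exact: ltW (bessel_const_gt0 ha)|rewrite addr_ge0// powR_ge0].
- exact: powR_ge0.
- rewrite /btrans_mass_const ler_pM2r ?invr_gt0// ler_pM2r ?ltr_pwDl ?powR_ge0//.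
  by apply: ler_peMl; [exact: ltW (bessel_const_gt0 ha)|rewrite ler1n].
have zz : 0 < 4 * (`|x| * `|z|) by rewrite !mulr_gt0.
have e1 : 0 <= r ^+ 2 - `| `|x| - `|z| | ^+ 2.
  by rewrite subr_ge0 ler_sqr ?nnegrE ?(ltW zr) ?(ltW r0).
apply: (ge0_ler_powR (ltW s0)); rewrite ?nnegrE ?(ltW v0)//.
  by rewrite divr_ge0// ltW.
rewrite ler_pdivrMr//.
have h1 : 2 * `|x| ^+ 2 <= 4 * (`|x| * `|z|) by exact: sqr_le_mul_of_near zr2.
have h2 : v * (2 * `|x| ^+ 2) <= v * (4 * (`|x| * `|z|)) by rewrite ler_pM2l.
(* The right side equals [5/4 * r^2]. *)
have h3 : r ^+ 2 <= v * (2 * `|x| ^+ 2).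
  have -> : v * (2 * `|x| ^+ 2) = 4^-1 * (v * (8 * `|x| ^+ 2)) by field.
  by rewrite vE mulrA ler_peMl ?sqr_ge0//; lra.
by apply: le_trans h2; apply: le_trans h3; rewrite gerBl sqr_ge0.
Qed.

Let transfer_aux (A B D : \bar R) (C : R) : (0 <= C) -> (0 <= A)%E -> (0 <= D)%E ->
  [\/ A = 0%E, B = 0%E | (B <= C%:E * D)%E] -> (A * B <= C%:E * (A * D))%E.
Proof.
move=> C0 A0 D0 [->|->|BD]; first by rewrite !mul0e mule0.
  by rewrite mule0 !mule_ge0// lee_fin.
by rewrite muleCA lee_wpmul2l.
Qed.

(** Unless a factor on the left vanishes, [|z|] is within [r] of both [|y|] and [|x|]; hence [|x|]
    and [|y|] differ by less than [2 r] and balls can be compared. *)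
Lemma btrans_ball_transfer (h : R -> R) (r x y z : R) : 0 < r -> (forall u, 0 <= h u) ->
  (forall u, r <= `|u| -> h u = 0) ->
  (P h z y * P (ind_ball r) x z <= C4%:E * (P h z y * P (ind_ball (3 * r)) x y))%E.
Proof.
move=> r0 h0 hz; apply: transfer_aux.
- exact: btrans_cmp_const_ge0.
- exact: btrans_ge0.
- by apply: btrans_ge0; exact: ind_ball_ge0.
have [x0|x0] := eqVneq x 0; first by apply: Or32; rewrite x0 btrans0.
have [y0|y0] := eqVneq y 0; first by apply: Or31; rewrite y0 btrans0r.
have [zy|zy] := leP r `| `|z| - `|y| |; first by apply: Or31; exact: btrans_eq0 hz zy.
have [xz|xz] := leP r `| `|x| - `|z| |.
  by apply: Or32; apply: btrans_eq0 xz => u ru; rewrite /ind_ball ltNge ru.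
apply: Or33; apply: btrans_ball_compare => //.
move: zy xz; rewrite !ltr_norml => /andP[? ?] /andP[? ?]; apply/andP; split; lra.
Qed.

(** The cut-off translation vanishes at centre 0, so [B(0, r)] is seen from the point [r] instead.
    The fraction 1/2 is covered because [(r - |z|)^2 + 2 r |z| = r^2 + z^2 <= 9 r^2]. *)
Lemma btrans_ball_center (r z : R) : 0 < r -> z != 0 -> `|z| < r ->
  ((Cl * 2^-1 `^ (a + 2^-1))%:E <= P (ind_ball (3 * r)) r z)%E.
Proof.
move=> r0 z0 zr; have r30 : 0 < 3 * r by rewrite mulr_gt0.
have Z0 : 0 < `|z| by rewrite normr_gt0.
apply: btrans_ball_lower => //; first by rewrite gt_eqF.
by rewrite (gtr0_norm r0); nra.
Qed.

End bessel_translation.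

(** * The case alpha = -1/2: the sum of two translates *)

Section classical_translation.
Context {R : realType}.
Local Notation leb := (@lebesgue_measure R).
Local Notation one := (fun _ : R => 1%R : R).
Local Notation a := (- 2^-1 : R).
Local Notation w := (w_alpha a).

(** No factor 1/2, so that the averages at [x] and [-x] add up to it exactly; its mass constant is
    therefore 2. *)
Definition sym_trans (h : R -> R) (x y : R) : \bar R := (h (x + y) + h (x - y))%:E.
Local Notation P := sym_trans.

Let a1 : -1 < a. Proof. by lra. Qed.
Let w0 x : 0 <= w x. Proof. exact: w_alpha_ge0. Qed.
Let mw : measurable_fun setT w. Proof. exact: measurable_w_alpha. Qed.

Lemma w_alpha_classical x : w x = A_alpha a.
Proof. by rewrite /w_alpha (_ : 2 * a + 1 = 0) ?powRr0 ?mulr1//; lra. Qed.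

Lemma wint_classical (h : R -> \bar R) : (forall x, 0 <= h x)%E -> measurable_fun setT h ->
  wint w h = ((A_alpha a)%:E * \int[leb]_x h x)%E.
Proof.
move=> h0 mh; rewrite /wint muleC -ge0_integralZr//.
- by apply: eq_integral => x _; rewrite w_alpha_classical.
- by rewrite lee_fin ltW// A_alpha_gt0.
Qed.

Lemma sym_trans_ge0 (h : R -> R) x y : (forall u, 0 <= h u) -> (0 <= P h x y)%E.
Proof. by move=> h0; rewrite lee_fin addr_ge0. Qed.

Lemma sym_transC (h : R -> R) x y : (forall u, h (- u) = h u) -> P h x y = P h y x.
Proof. by move=> hN; rewrite /P addrC [y + x]addrC -[y - x]opprB hN addrC. Qed.

Lemma sym_trans_tail (h h1 c : R -> R) (C1 : R) x y : 0 <= C1 ->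
  (forall u, 0 <= h u) -> (forall u, 0 <= h1 u) -> (forall t, 0 <= c t) ->
  measurable_fun setT h1 -> measurable_fun setT c ->
  (forall u, (h u)%:E <= (h1 u)%:E +
     C1%:E * wint one (fun t => (c t)%:E * (ind_ball t u)%:E))%E ->
  (P h x y <= P h1 x y + C1%:E * wint one (fun t => (c t)%:E * P (ind_ball t) x y))%E.
Proof.
move=> C10 h0 h10 c0 mh1 mc hh.
have mind u : measurable_fun setT (fun t : R => ind_ball t u).
  by rewrite /ind_ball; measurability.
have ib0 := @ind_ball_ge0 R.
have -> : wint one (fun t => (c t)%:E * P (ind_ball t) x y)%E =
    (wint one (fun t => (c t)%:E * (ind_ball t (x + y))%:E) +
     wint one (fun t => (c t)%:E * (ind_ball t (x - y))%:E))%E.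
  rewrite -wintD//.
  - by apply: eq_integral => t _; rewrite /P EFinD ge0_muleDr ?lee_fin.
  - by move=> t; rewrite mule_ge0 ?lee_fin.
  - by move=> t; rewrite mule_ge0 ?lee_fin.
  - have := mind (x + y) => m; by measurability.
  - have := mind (x - y) => m; by measurability.
have W0 u : (0 <= wint one (fun t => (c t)%:E * (ind_ball t u)%:E))%E.
  by apply: wint_ge0 => // t; rewrite mule_ge0// lee_fin.
by rewrite /P !EFinD ge0_muleDr// addeACA; apply: leeD.
Qed.

Lemma measurable_sym_trans (h : R -> R) : measurable_fun setT h ->
  measurable_fun setT (fun q : R * R => P h q.1 q.2).
Proof.
move=> mh; apply/measurable_EFinP; apply: measurable_funD;
  apply: (measurableT_comp mh); by measurability.
Qed.

Lemma measurable_sym_trans_ball x :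
  measurable_fun setT (fun q : R * R => P (ind_ball q.1) x q.2).
Proof. by rewrite /P /ind_ball; measurability. Qed.

Lemma sym_trans_mass (h : R -> R) x : (forall u, 0 <= h u) -> measurable_fun setT h ->
  (wint w (P h x) <= 2%:E * wint w (fun u => (h u)%:E))%E.
Proof.
move=> h0 mh; have A0 := A_alpha_gt0 a1.
have m1 : measurable_fun setT (fun y : R => (h (x + y))%:E).
  by apply/measurable_EFinP; apply: (measurableT_comp mh); apply: measurable_funD.
have m2 : measurable_fun setT (fun y : R => (h (x - y))%:E).
  by apply/measurable_EFinP; apply: (measurableT_comp mh); measurability.
have h0' u : (0 <= (h u)%:E)%E by rewrite lee_fin.
rewrite (_ : P h x = fun y => (h (x + y))%:E + (h (x - y))%:E)%E//.
rewrite wintD// !wint_classical//; last exact/measurable_EFinP.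
have mhE : measurable_fun setT (fun u => (h u)%:E) by exact/measurable_EFinP.
rewrite (integral_reflect (f := fun y => (h (x + y))%:E))//.
rewrite (integral_translate (f := fun y => (h y)%:E))//.
by rewrite (_ : 2%:E = 1 + 1)%E// ge0_muleDl// !mul1e.
Qed.

Lemma ind_ball_le1 (t z : R) : ind_ball t z <= 1.
Proof. by rewrite /ind_ball; case: ifP. Qed.

(** If one of [|z + y|], [|z - y|] and one of [|x + z|], [|x - z|] are below [r], then [|x + y|] or
    [|x - y|] is below [2 r]. The indicator sum on the right is then at least 1, while the one on
    the left is at most 2. The cases are those of the signs. *)
Lemma sym_trans_ball_transfer (h : R -> R) (r x y z : R) : 0 < r -> (forall u, 0 <= h u) ->
  (forall u, r <= `|u| -> h u = 0) ->
  (P h z y * P (ind_ball r) x z <= 2%:E * (P h z y * P (ind_ball (3 * r)) x y))%E.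
Proof.
move=> r0 h0 hz; rewrite -!EFinM lee_fin mulrCA.
have hh0 : 0 <= h (z + y) + h (z - y) by rewrite addr_ge0.
have ib r' u := @ind_ball_ge0 R r' u.
have ib1 := ind_ball_le1.
have big : `|x + y| < 3 * r \/ `|x - y| < 3 * r ->
    (h (z + y) + h (z - y)) * (ind_ball r (x + z) + ind_ball r (x - z)) <=
    (h (z + y) + h (z - y)) * (2 * (ind_ball (3 * r) (x + y) + ind_ball (3 * r) (x - y))).
  move=> hb; apply: ler_wpM2l => //.
  apply: (@le_trans _ _ 2); first by have := ib1 r (x + z); have := ib1 r (x - z); lra.
  have := ib (3 * r) (x + y); have := ib (3 * r) (x - y).
  have ib3 u : `|u| < 3 * r -> ind_ball (3 * r) u = 1 by rewrite /ind_ball => ->.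
  by case: hb => /ib3 ->; lra.
have triv : h (z + y) + h (z - y) = 0 \/ ind_ball r (x + z) + ind_ball r (x - z) = 0 ->
    (h (z + y) + h (z - y)) * (ind_ball r (x + z) + ind_ball r (x - z)) <=
    (h (z + y) + h (z - y)) * (2 * (ind_ball (3 * r) (x + y) + ind_ball (3 * r) (x - y))).
  case=> -> ; first by rewrite !mul0r.
  by rewrite mulr0; apply: mulr_ge0 => //; rewrite mulr_ge0// addr_ge0.
have [zy1|zy1] := ltP `|z + y| r; have [zy2|zy2] := ltP `|z - y| r;
 have [xz1|xz1] := ltP `|x + z| r; have [xz2|xz2] := ltP `|x - z| r;
 try (by apply: triv; left; rewrite !hz// addr0);
 try (by apply: triv; right; rewrite /ind_ball ltNge xz1 ltNge xz2 addr0);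
 apply: big; move: zy1 zy2 xz1 xz2; rewrite ?ltr_norml => ? ? ? ?;
 repeat match goal with H : is_true (_ && _) |- _ => move/andP: H => [? ?] end;
 try (left; apply/andP; split; lra); right; apply/andP; split; lra.
Qed.

End classical_translation.

(** * Signed real-valued integrals without convergence assumptions *)

Section integral_bounds.
Context {R : realType}.
Local Notation leb := (@lebesgue_measure R).

Lemma norm_fineB_le (A B I : \bar R) : (0 <= A)%E -> (0 <= B)%E -> (A <= I)%E -> (B <= I)%E ->
  (`|fine (A - B)|%:E <= I)%E.
Proof.
case: I => [i| |]; [|by move=> *; rewrite leey|by move=> A0 _ /(le_trans A0)].
case: A => [x| |]//; case: B => [y| |]//=; rewrite !lee_fin => x0 y0 xi yi.
by rewrite ler_norml; apply/andP; split; lra.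
Qed.

(** The integrals of both parts are at most that of [|f|], and if the latter is infinite nothing is
    claimed. The potential can thus be bounded before its convergence is known. *)
Lemma norm_Rintegral_le (D : set R) (f : R -> R) :
  (`|Rintegral leb D f|%:E <= \int[leb]_(x in D) `|f x|%:E)%E.
Proof.
rewrite /Rintegral integralE.
set A := (\int[leb]_(x in D) ((fun x => (f x)%:E)^\+ x)%E)%E.
set B := (\int[leb]_(x in D) ((fun x => (f x)%:E)^\- x)%E)%E.
have A0 : (0 <= A)%E by apply: integral_ge0 => x _; exact: funepos_ge0.
have B0 : (0 <= B)%E by apply: integral_ge0 => x _; exact: funeneg_ge0.
have AI : (A <= \int[leb]_(x in D) `|f x|%:E)%E.
  apply: ge0_leint => x _; first exact: funepos_ge0.
  by rewrite funeposE ge_max; apply/andP; split; rewrite lee_fin ?ler_norm.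
have BI : (B <= \int[leb]_(x in D) `|f x|%:E)%E.
  apply: ge0_leint => x _; first exact: funeneg_ge0.
  by rewrite funenegE ge_max; apply/andP; split; rewrite lee_fin// -normrN ler_norm.
exact: norm_fineB_le.
Qed.

(** Tonelli's theorem applies to the positive and the negative part; the difference in [\bar R] and
    [fine] stay measurable even where the integral diverges. *)
Lemma measurable_fine_integral d (T : measurableType d) (H : T -> R -> R) :
  measurable_fun [set: T * R] (fun q => H q.1 q.2) ->
  measurable_fun setT (fun t => Rintegral leb setT (H t)).
Proof.
move=> mH; rewrite /Rintegral.
have mHE : measurable_fun [set: T * R] (fun q => (H q.1 q.2)%:E) by exact/measurable_EFinP.
apply: (measurableT_comp (@fine_measurable R _ measurableT)).
rewrite (_ : (fun t => _) = (fun t => \int[leb]_z ((fun q => (H q.1 q.2)%:E)^\+ (t, z)) -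
   \int[leb]_z ((fun q => (H q.1 q.2)%:E)^\- (t, z)))%E).
  apply: emeasurable_funB.
  - apply: (measurable_fun_fubini_tonelli_F (m2 := leb)); last by move=> q; exact: funepos_ge0.
    exact: measurable_funepos.
  - apply: (measurable_fun_fubini_tonelli_F (m2 := leb)); last by move=> q; exact: funeneg_ge0.
    exact: measurable_funeneg.
by apply/funext => t; rewrite [LHS]integralE; congr (_ - _)%E;
  apply: eq_integral => z _; rewrite ?funeposE ?funenegE.
Qed.

End integral_bounds.

(** * The Dunkl kernel and its even part *)

Section dunkl_kernel.
Context {R : realType}.
Local Notation leb := (@lebesgue_measure R).
Variable a : R.

(** By the law of cosines [sigma3 x y z] is, up to sign, the cosine of an angle in the triangle with
    sides [|x|], [|y|], [|z|]. *)
Lemma sigma3_le1 (x y z : R) :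
  `| `|x| - `|y| | <= `|z| -> `|z| <= `|x| + `|y| -> `|sigma3 x y z| <= 1.
Proof.
move=> h1 h2; rewrite /sigma3; case: ifP => [/andP[x0 y0]|_]; last by rewrite normr0.
have X0 : 0 < `|x| by rewrite normr_gt0.
have Y0 : 0 < `|y| by rewrite normr_gt0.
have d0 : 0 < `|2 * x * y| by rewrite normr_gt0 !mulf_neq0.
rewrite normrM normfV ler_pdivrMr// mul1r !normrM (ger0_norm (ler0n _ 2)).
rewrite -(real_normK (num_real x)) -(real_normK (num_real y)) -(real_normK (num_real z)).
move: h1; rewrite !ler_norml => /andP[? ?]; have := normr_ge0 z.
by move=> ?; apply/andP; split; nra.
Qed.

Lemma sigma3Nr (x y z : R) : sigma3 x (- y) z = - sigma3 x y z.
Proof.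
rewrite /sigma3 oppr_eq0; case: ifP => [/andP[x0 y0]|]; last by rewrite oppr0.
by field; rewrite x0 y0.
Qed.

Lemma sigma3N (x y z : R) : sigma3 x y (- z) = sigma3 x y z.
Proof. by rewrite /sigma3 sqrrN. Qed.

Lemma measurable_sigma3 d (T : measurableType d) (fx fy fz : T -> R) :
  measurable_fun setT fx -> measurable_fun setT fy -> measurable_fun setT fz ->
  measurable_fun setT (fun t => sigma3 (fx t) (fy t) (fz t)).
Proof.
move=> mx my mz.
rewrite (_ : (fun t => _) = (fun t => if (fx t != 0) && (fy t != 0) then
  (fx t ^+ 2 + fy t ^+ 2 - fz t ^+ 2) * (1 * fx t * fy t * 2^-1)
   * (`|fx t| `^ (-2) * `|fy t| `^ (-2)) else 0)).
  by measurability.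
apply/funext => t; rewrite /sigma3; case: ifP => // /andP[x0 y0].
rewrite !powRN !powR_mulrn//.
by rewrite !real_normK ?num_real//; field; rewrite x0 y0.
Qed.

Definition dkernel (x y z : R) : R :=
  (1 - sigma3 x y z + sigma3 z x y + sigma3 z y x) * bkernel a x y z.

(* [dkernel x y z] minus its odd part in [y], see [dkernel_odd]. *)
Definition dkernel_even (x y z : R) : R := (1 + sigma3 z x y) * bkernel a x y z.

Lemma measurable_dkernel d (T : measurableType d) (fx fy fz : T -> R) :
  measurable_fun setT fx -> measurable_fun setT fy -> measurable_fun setT fz ->
  measurable_fun setT (fun t => dkernel (fx t) (fy t) (fz t)).
Proof.
move=> mx my mz; rewrite /dkernel; apply: measurable_funM; last exact: measurable_bkernel.
have m1 := measurable_sigma3 mx my mz; have m2 := measurable_sigma3 mz mx my.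
by have m3 := measurable_sigma3 mz my mx; measurability.
Qed.

Lemma measurable_dkernel_even d (T : measurableType d) (fx fy fz : T -> R) :
  measurable_fun setT fx -> measurable_fun setT fy -> measurable_fun setT fz ->
  measurable_fun setT (fun t => dkernel_even (fx t) (fy t) (fz t)).
Proof.
move=> mx my mz; rewrite /dkernel_even; apply: measurable_funM; last exact: measurable_bkernel.
by have m2 := measurable_sigma3 mz mx my; measurability.
Qed.

Lemma bkernelN (x y z : R) : bkernel a x (- y) z = bkernel a x y z.
Proof. by rewrite bkernelCr bkernel_norm normrN -bkernel_norm bkernelCr. Qed.

Lemma bkernelNl (x y z : R) : bkernel a (- x) y z = bkernel a x y z.
Proof. by rewrite bkernelC bkernelN bkernelC. Qed.

(** [sigma3 z x y] is odd in [x], so only the constant term survives. This gives the lower bound for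
    the sum of the averages at [x] and [-x]. *)
Lemma dkernel_evenN (x y z : R) :
  dkernel_even x y z + dkernel_even (- x) y z = 2 * bkernel a x y z.
Proof. by rewrite /dkernel_even sigma3Nr bkernelNl; ring. Qed.

(** The terms left out of [dkernel_even], namely [sigma3 x y z] and [sigma3 z y x], are odd in [y],
    while [bkernel] is even. *)
Lemma dkernel_odd (x y z : R) :
  dkernel x (- y) z - dkernel_even x (- y) z = - (dkernel x y z - dkernel_even x y z).
Proof. by rewrite /dkernel /dkernel_even bkernelN sigma3Nr sigma3N sigma3Nr; ring. Qed.

Hypothesis ha : - 2^-1 < a.

Lemma sigma3_supp (x y z : R) : bkernel a x y z != 0 ->
  [/\ `|sigma3 x y z| <= 1, `|sigma3 z x y| <= 1 & `|sigma3 z y x| <= 1].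
Proof.
move=> /bkernel_supp /andP[]; rewrite ler_norml => /andP[h1 h2] h3.
by split; apply: sigma3_le1; rewrite 1?(ler_norml (_ - _)); try (apply/andP; split); lra.
Qed.

Lemma dkernel_le (x y z : R) : `|dkernel x y z| <= 4 * bkernel a x y z.
Proof.
have b0 := bkernel_ge0 ha x y z.
rewrite /dkernel normrM (ger0_norm b0); have [->|bn0] := eqVneq (bkernel a x y z) 0.
  by rewrite !mulr0.
apply: ler_wpM2r => //; have [] := sigma3_supp bn0.
by rewrite !ler_norml => /andP[? ?] /andP[? ?] /andP[? ?]; apply/andP; split; lra.
Qed.

Lemma dkernel_even_bounds (x y z : R) : 0 <= dkernel_even x y z <= 2 * bkernel a x y z.
Proof.
have b0 := bkernel_ge0 ha x y z.
rewrite /dkernel_even; have [->|bn0] := eqVneq (bkernel a x y z) 0.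
  by rewrite !mulr0 lexx.
have [_ + _] := sigma3_supp bn0; rewrite ler_norml => /andP[? ?].
by apply/andP; split; [apply: mulr_ge0 => //|apply: ler_wpM2r => //]; lra.
Qed.

Lemma w_alpha_0 : w_alpha a (0 : R) = 0.
Proof. by rewrite /w_alpha normr0 powR0 ?mulr0//; have := ha; lra. Qed.

(** The two formulas can differ only at [y = 0] and at [z = 0], where the weight vanishes since
    [2 a + 1 > 0]. Multiplying by the weight removes the case distinctions of [dunkl_tau]. *)
Lemma dunkl_tau_dkernel (x y : R) (f : R -> R) : x != 0 ->
  dunkl_tau a x f y * w_alpha a y =
  Rintegral leb setT (fun z => f z * dkernel x y z * w_alpha a z) * w_alpha a y.
Proof.
move=> x0; have [->|y0] := eqVneq y 0; first by rewrite w_alpha_0 !mulr0.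
congr (_ * _); rewrite /dunkl_tau (negbTE x0) (negbTE y0) ifF; last first.
  by apply/eqP => e; have := ha; rewrite e ltxx.
apply: eq_Rintegral => z _; have [->|z0] := eqVneq z 0; first by rewrite w_alpha_0 !mulr0.
by rewrite /dkernel /bkernel x0 y0 z0.
Qed.

End dunkl_kernel.

(** * Fubini's theorem for real-valued inner integrals, and odd parts *)

Section signed_fubini.
Context {R : realType}.
Local Notation leb := (@lebesgue_measure R).
Local Open Scope ereal_scope.

(** [Rintegral] turns an infinite inner integral into 0. Absolute integrability makes it finite for
    almost every [y] with [c y != 0], and where [c y = 0] both integrands vanish. *)
Lemma Fubini_Rintegral (c : R -> R) (h : R -> R -> R) :
  measurable_fun setT c -> measurable_fun setT (fun q : R * R => h q.1 q.2) ->
  \int[leb]_y \int[leb]_z `|c y * h y z|%R%:E < +oo ->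
  \int[leb]_y (c y * Rintegral leb setT (h y))%:E = \int[leb]_z \int[leb]_y (c y * h y z)%:E.
Proof.
move=> mc mh hfin.
pose H (q : R * R) : \bar R := (c q.1 * h q.1 q.2)%:E.
have mH : measurable_fun setT H.
  apply/measurable_EFinP; apply: measurable_funM => //; exact: measurableT_comp.
have iH : (leb \x leb)%E.-integrable setT H by apply/(integrable12ltyP leb leb mH).
rewrite -(Fubini iH).
apply: ae_eq_integral => //.
- apply/measurable_EFinP; apply: measurable_funM => //; exact: measurable_fine_integral.
- have := measurable_fubini_F iH; exact.
have := ae_integrable1 iH; apply: filterS => y iy _.
rewrite /H/=; have [->|c0] := eqVneq (c y) 0%R.
  by rewrite mul0r; under [RHS]eq_integral do rewrite mul0r; rewrite integral0.
have ih : leb.-integrable setT (fun z => (h y z)%:E).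
  have := integrableZl measurableT (c y)^-1 iy; apply: eq_integrable => // z _.
  by rewrite /H/= -EFinM mulKf.
rewrite /Rintegral EFinM fineK; last exact: integrable_fin_num ih.
by rewrite -integralZl.
Qed.

Lemma eq_integral_odd_part (f g : R -> R) :
  leb.-integrable setT (EFin \o f) -> leb.-integrable setT (EFin \o g) ->
  (forall x, f (- x) - g (- x) = - (f x - g x))%R ->
  \int[leb]_x (f x)%:E = \int[leb]_x (g x)%:E.
Proof.
move=> fi gi fg; have fgi := integrableB measurableT fi gi.
have : \int[leb]_x ((EFin \o f) x - (EFin \o g) x) = 0 by exact: (integral_odd (f := fun x => f x - g x)%R).
rewrite integralB//; have := integrable_fin_num measurableT gi.
have := integrable_fin_num measurableT fi.
rewrite /comp; case: (\int[leb]_x (f x)%:E) => [u| |]//; case: (\int[leb]_x (g x)%:E) => [v| |]// _ _.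
by move=> /eqP; rewrite -EFinB eqe subr_eq0 => /eqP ->.
Qed.

End signed_fubini.

(** * Dunkl averages as integrals against the even kernel *)

Section dunkl_average.
Context {R : realType}.
Local Notation leb := (@lebesgue_measure R).
Variable a : R.
Local Notation w := (w_alpha a).

Lemma int_mu_ball (r : R) (f : R -> R) :
  int_mu a (ball0 r) f = wint w (fun y => (ind_ball r y * f y)%:E).
Proof.
rewrite /int_mu integral_mkcond; apply: eq_integral => y _.
rewrite patchE /ball0 mem_setE in_itv/= -ltr_norml /ind_ball.
by case: ifP => _; rewrite ?mul1r ?mul0r ?mul0e// EFinM.
Qed.

Hypothesis ha : - 2^-1 < a.
Let a1 : -1 < a. Proof. by have := ha; lra. Qed.
Let w0 x : 0 <= w x. Proof. exact: w_alpha_ge0. Qed.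
Let mw : measurable_fun setT w. Proof. exact: measurable_w_alpha. Qed.
Let bk0 := bkernel_ge0 ha.
Let mind t : measurable_fun setT (@ind_ball R t).
Proof. by rewrite /ind_ball; measurability. Qed.

Section fixed_function.
Variables (g : R -> R) (x r : R).
Hypothesis g0 : forall y, 0 <= g y.
Hypothesis mg : measurable_fun setT g.
Hypothesis gloc : forall t : R, 0 < t -> (int_mu a (ball0 t) g < +oo)%E.
Hypothesis r0 : 0 < r.

(** As a function of [z] the ball average is bounded by the mass constant and vanishes for
    [|z| >= |x| + r], so local integrability of [g] suffices. *)
Lemma wint_btrans_ball_lty :
  (wint w (fun z => (g z)%:E * btrans a (ind_ball r) x z) < +oo)%E.
Proof.
have C0 := btrans_mass_const_gt0 ha.
set Cm := btrans_mass_const a in C0.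
have t0 : 0 < `|x| + r by rewrite ltr_wpDl.
apply: (@le_lt_trans _ _ (Cm%:E * int_mu a (ball0 (`|x| + r)) g)%E); last first.
  by rewrite lte_mul_pinfty ?lee_fin ?(ltW C0)//; exact: gloc.
rewrite int_mu_ball -wintZl//; first last.
- by have := mind (`|x| + r) => m; measurability.
- by move=> z; rewrite lee_fin; apply: mulr_ge0 => //; exact: ind_ball_ge0.
- by rewrite lee_fin ltW.
apply: le_wint => // z.
  by rewrite mule_ge0 ?lee_fin// btrans_ge0// => u; exact: ind_ball_ge0.
have [zr|rz] := ltP `|z| (`|x| + r).
  rewrite /ind_ball zr mul1r muleC; apply: lee_wpmul2r; first by rewrite lee_fin.
  exact: btrans_ball_le_mass.
rewrite (@btrans_eq0 _ a (ind_ball r) r).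
- by rewrite mule0 mule_ge0 ?lee_fin ?(ltW C0)//; apply: mulr_ge0 => //; exact: ind_ball_ge0.
- by move=> u ru; rewrite /ind_ball ltNge ru.
- by rewrite distrC (le_trans _ (ler_norm _))// lerBrDl.
Qed.

Let wint_ball_bkernel z : wint w (fun y => (ind_ball r y * bkernel a x y z)%:E) =
  btrans a (ind_ball r) x z.
Proof. by apply: eq_integral => y _; rewrite bkernelCr. Qed.

Let mib' z : measurable_fun setT (fun y : R => ind_ball r y * bkernel a x y z).
Proof. by apply: measurable_funM => //; apply: measurable_bkernel; measurability. Qed.

Let kbound (k : R -> R -> R) y z : `|k y z| <= 4 * bkernel a x y z ->
  `|ind_ball r y * w y * (g z * k y z * w z)| <=
  4 * (g z * (ind_ball r y * bkernel a x y z) * w y * w z).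
Proof.
move=> hk; have i0 := @ind_ball_ge0 R r y.
have c0 : 0 <= ind_ball r y * w y * (g z * w z) by apply: mulr_ge0; apply: mulr_ge0.
have -> : ind_ball r y * w y * (g z * k y z * w z) =
    ind_ball r y * w y * (g z * w z) * k y z by ring.
rewrite normrM (ger0_norm c0).
have -> : 4 * (g z * (ind_ball r y * bkernel a x y z) * w y * w z) =
   ind_ball r y * w y * (g z * w z) * (4 * bkernel a x y z) by ring.
exact: ler_wpM2l.
Qed.

(** Supplies the absolute integrability for Fubini's theorem, as four times the Bessel kernel
    dominates the Dunkl kernel. *)
Let iterated_lty : (wint w (fun z => wint w (fun y =>
  (4 * (g z * (ind_ball r y * bkernel a x y z)))%:E)) < +oo)%E.
Proof.
have e z : wint w (fun y => (4 * (g z * (ind_ball r y * bkernel a x y z)))%:E) =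
    (4%:E * ((g z)%:E * btrans a (ind_ball r) x z))%E.
  rewrite -wint_ball_bkernel muleA -wintZl//.
  - by apply: eq_integral => y _; rewrite !EFinM !muleA.
  - by rewrite mule_ge0 ?lee_fin.
  - by move=> y; rewrite lee_fin; apply: mulr_ge0; [exact: ind_ball_ge0|].
  - by apply/measurable_EFinP.
under [X in wint w X]eq_fun do rewrite e.
rewrite wintZl//; last 2 first.
- by move=> z; rewrite mule_ge0 ?lee_fin// btrans_ge0// => u; exact: ind_ball_ge0.
- apply: emeasurable_funM; first exact/measurable_EFinP.
  have := @measurable_btrans_ball R a ha x => m.
  exact: (measurableT_comp m (measurable_pair1 r)).
by rewrite lte_mul_pinfty ?lee_fin//; exact: wint_btrans_ball_lty.
Qed.

Let kint (k : R -> R -> R) z : (forall y, `|k y z| <= 4 * bkernel a x y z) ->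
  measurable_fun setT (k ^~ z) ->
  leb.-integrable setT (EFin \o (fun y => ind_ball r y * w y * (g z * k y z * w z))).
Proof.
move=> hk mk; apply/integrableP; split.
  by apply/measurable_EFinP; have m := mind r; measurability.
apply: (@le_lt_trans _ _ (\int[leb]_y ((4 * g z * w z)%:E *
    ((ind_ball r y * bkernel a x y z)%:E * (w y)%:E)))%E).
  apply: ge0_leint => // y _; rewrite /= lee_fin (le_trans (kbound (hk y)))//.
  by rewrite le_eqVlt; apply/orP; left; apply/eqP; ring.
rewrite ge0_integralZl_EFin//; first last.
- by apply: mulr_ge0 => //; exact: mulr_ge0.
- by have := mib' z => m; measurability.
- move=> y _; rewrite mule_ge0 ?lee_fin//; apply: mulr_ge0 => //; exact: ind_ball_ge0.
rewrite lte_mul_pinfty ?lee_fin//; first by apply: mulr_ge0 => //; exact: mulr_ge0.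
rewrite (_ : (\int[leb]_y _)%E = btrans a (ind_ball r) x z); last exact: wint_ball_bkernel.
by rewrite (le_lt_trans (btrans_ball_le_mass ha r x z))// ltry.
Qed.

(** Once the integral over [y] is taken first, the odd part of the kernel integrates to 0 over the
    symmetric ball. Hence the average of [g >= 0] is nonnegative although [dunkl_tau a x g] need not
    be. *)
Lemma int_mu_dunkl_tau : x != 0 -> int_mu a (ball0 r) (dunkl_tau a x g) =
  wint w (fun z => wint w (fun y => (g z * (ind_ball r y * dkernel_even a x y z))%:E)).
Proof.
move=> x0; rewrite int_mu_ball /wint.
have mD : measurable_fun setT (fun q : R * R => dkernel a x q.1 q.2).
  by apply: measurable_dkernel; measurability.
have mE : measurable_fun setT (fun q : R * R => dkernel_even a x q.1 q.2).
  by apply: measurable_dkernel_even; measurability.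
have mg2 : measurable_fun setT (fun q : R * R => g q.2) by exact: measurableT_comp.
have mw1 : measurable_fun setT (fun q : R * R => w q.1) by exact: measurableT_comp.
have mw2 : measurable_fun setT (fun q : R * R => w q.2) by exact: measurableT_comp.
transitivity (\int[leb]_y (ind_ball r y * w y *
    Rintegral leb setT (fun z => g z * dkernel a x y z * w z))%:E)%E.
  apply: eq_integral => y _; rewrite -EFinM; congr EFin.
  have h := dunkl_tau_dkernel ha y g x0.
  rewrite -[LHS]mulrA; set t := dunkl_tau a x g y in h *; set I := Rintegral _ _ _ in h *.
  by rewrite h; ring.
rewrite (Fubini_Rintegral (h := fun y z => g z * dkernel a x y z * w z)).
- apply: eq_integral => z _.
  transitivity (\int[leb]_y (ind_ball r y * w y * (g z * dkernel_even a x y z * w z))%:E)%E.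
    apply: eq_integral_odd_part.
    + by apply: kint => [y|]; [exact: dkernel_le|exact: measurable_fun_pair1 mD].
    + apply: kint => [y|]; last exact: measurable_fun_pair1 mE.
      have := bk0 x y z; have /andP[h1 h2] := dkernel_even_bounds ha x y z.
      by rewrite ger0_norm//; lra.
    + move=> y; rewrite w_alphaN {1 2}/ind_ball normrN -/(ind_ball r y).
      have := dkernel_odd a x y z; move: (dkernel a x (- y) z) (dkernel_even a x (- y) z) (dkernel a x y z)
        (dkernel_even a x y z) (ind_ball r y) (w y) (w z).
      by move=> D E D' E' c u v /(canRL (subrK _)) ->; ring.
  rewrite -ge0_integralZr//.
  + by apply: eq_integral => y _; rewrite -!EFinM; congr EFin; ring.
  + have mE1 := measurable_fun_pair1 z mE; have m := mind r.
    by measurability.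
  + move=> y _; rewrite mule_ge0 ?lee_fin//; apply: mulr_ge0 => //.
    by apply: mulr_ge0; [exact: ind_ball_ge0|have /andP[] := dkernel_even_bounds ha x y z].
  + by rewrite lee_fin.
- by have m := mind r; measurability.
- by measurability.
- apply: le_lt_trans iterated_lty; rewrite /wint.
  have m : measurable_fun [set: R * R] (fun q : R * R =>
      (4 * (g q.1 * (ind_ball r q.2 * bkernel a x q.2 q.1)))%:E).
    have mi : measurable_fun setT (fun q : R * R => ind_ball r q.2) by exact: measurableT_comp.
    have mb : measurable_fun setT (fun q : R * R => bkernel a x q.2 q.1).
      by apply: measurable_bkernel; measurability.
    have mg1 : measurable_fun setT (fun q : R * R => g q.1) by exact: measurableT_comp.
    by measurability.
  have := wint_swap w0 mw w0 mw (h := fun z y => (4 * (g z * (ind_ball r y * bkernel a x y z)))%:E).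
  rewrite /wint => -> //; last first.
    move=> z y; rewrite lee_fin; apply: mulr_ge0 => //; apply: mulr_ge0 => //.
    by apply: mulr_ge0 => //; exact: ind_ball_ge0.
  apply: ge0_leint => y _; first by apply: integral_ge0.
  rewrite -ge0_integralZr//.
  + apply: ge0_leint => z _; first by rewrite lee_fin.
    rewrite lee_fin (le_trans (kbound (dkernel_le ha x y z)))//.
    by rewrite le_eqVlt; apply/orP; left; apply/eqP; ring.
  + by have := measurable_fun_pair1 y m => m1; measurability.
  + move=> z _; rewrite mule_ge0 ?lee_fin//; apply: mulr_ge0 => //; apply: mulr_ge0 => //.
    by apply: mulr_ge0 => //; exact: ind_ball_ge0.
  + by rewrite lee_fin.
Qed.

End fixed_function.
End dunkl_average.

(** * Comparison of Dunkl averages and potentials with Bessel ones *)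

Section dunkl_average_bounds.
Context {R : realType}.
Local Notation leb := (@lebesgue_measure R).
Variable a : R.
Hypothesis ha : - 2^-1 < a.
Local Notation w := (w_alpha a).
Let a1 : -1 < a. Proof. by have := ha; lra. Qed.
Let w0 x : 0 <= w x. Proof. exact: w_alpha_ge0. Qed.
Let mw : measurable_fun setT w. Proof. exact: measurable_w_alpha. Qed.
Let bk0 := bkernel_ge0 ha.
Let i0 := @ind_ball_ge0 R.
Let mind t : measurable_fun setT (@ind_ball R t).
Proof. by rewrite /ind_ball; measurability. Qed.
Let an : a == - 2^-1 = false.
Proof. by apply/eqP => e; have := ha; rewrite e ltxx. Qed.

Lemma int_mu_dunkl_tau0 (g : R -> R) (r : R) :
  int_mu a (ball0 r) (dunkl_tau a 0 g) = int_mu a (ball0 r) g.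
Proof. by congr int_mu; apply/funext => y; rewrite /dunkl_tau an eqxx. Qed.

Section fixed_function.
Variables (g : R -> R) (r : R).
Hypothesis g0 : forall y, 0 <= g y.
Hypothesis mg : measurable_fun setT g.
Hypothesis r0 : 0 < r.

Let dint (k : R -> R -> R) : \bar R :=
  wint w (fun z => wint w (fun y => (g z * (ind_ball r y * k y z))%:E)).

Let dint_bkernel x : dint (bkernel a x) = wint w (fun z => (g z)%:E * btrans a (ind_ball r) x z)%E.
Proof.
apply: eq_integral => z _; congr (_ * _)%E.
rewrite -(wintZl w0 mw (c := (g z)%:E) (h := fun y => (ind_ball r y * bkernel a x z y)%:E)).
- by apply: eq_integral => y _; rewrite bkernelCr EFinM.
- by rewrite lee_fin.
- by move=> y; rewrite lee_fin; apply: mulr_ge0.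
- by apply/measurable_EFinP; apply: measurable_funM => //; apply: measurable_bkernel; measurability.
Qed.

Let mdint (k : R -> R -> R) : measurable_fun setT (fun q : R * R => k q.1 q.2) ->
  measurable_fun setT (fun q : R * R => (g q.1 * (ind_ball r q.2 * k q.2 q.1))%:E).
Proof.
move=> mk; have m1 : measurable_fun setT (fun q : R * R => g q.1) by exact: measurableT_comp.
have m2 : measurable_fun setT (fun q : R * R => ind_ball r q.2) by exact: measurableT_comp.
have m3 : measurable_fun setT (fun q : R * R => k q.2 q.1).
  exact: (measurableT_comp mk (measurable_fun_pair measurable_snd measurable_fst)).
by measurability.
Qed.

Let dint_ge0 (k : R -> R -> R) z y : (forall y z, 0 <= k y z) -> (0 <= (g z * (ind_ball r y * k y z))%:E)%E.
Proof. by move=> k0; rewrite lee_fin; apply: mulr_ge0 => //; exact: mulr_ge0. Qed.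

Let dintD (k l : R -> R -> R) : (forall y z, 0 <= k y z) -> (forall y z, 0 <= l y z) ->
  measurable_fun setT (fun q : R * R => k q.1 q.2) ->
  measurable_fun setT (fun q : R * R => l q.1 q.2) ->
  dint (fun y z => k y z + l y z) = (dint k + dint l)%E.
Proof.
move=> k0 l0 mk ml; have mk' := mdint mk; have ml' := mdint ml.
rewrite /dint -wintD//.
- apply: eq_integral => z _; congr (_ * _)%E; rewrite -wintD//.
  + by apply: eq_integral => y _; rewrite -EFinD -mulrDr -mulrDr.
  + by move=> y; exact: dint_ge0.
  + by move=> y; exact: dint_ge0.
  + exact: measurable_fun_pair2 z mk'.
  + exact: measurable_fun_pair2 z ml'.
- by move=> z; apply: wint_ge0 => // y; exact: dint_ge0.
- by move=> z; apply: wint_ge0 => // y; exact: dint_ge0.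
- by apply: measurable_wint => // z y; exact: dint_ge0.
- by apply: measurable_wint => // z y; exact: dint_ge0.
Qed.

Let mb x : measurable_fun setT (fun q : R * R => bkernel a x q.1 q.2).
Proof. by apply: measurable_bkernel; measurability. Qed.

Let me x : measurable_fun setT (fun q : R * R => dkernel_even a x q.1 q.2).
Proof. by apply: measurable_dkernel_even; measurability. Qed.

Let e0 x y z : 0 <= dkernel_even a x y z.
Proof. by have /andP[] := dkernel_even_bounds ha x y z. Qed.

Let le_dint (k l : R -> R -> R) : (forall y z, 0 <= k y z) -> (forall y z, k y z <= l y z) ->
  (dint k <= dint l)%E.
Proof.
move=> k0 kl; apply: le_wint => // z; first by apply: wint_ge0 => // y; exact: dint_ge0.
apply: le_wint => // y; first exact: dint_ge0.
by rewrite lee_fin; apply: ler_wpM2l => //; exact: ler_wpM2l.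
Qed.

Let ball_ge0 x : (0 <= wint w (fun z => (g z)%:E * btrans a (ind_ball r) x z))%E.
Proof. by apply: wint_ge0 => // z; rewrite mule_ge0 ?lee_fin// btrans_ge0. Qed.

Let int_mu_ge0 : (0 <= int_mu a (ball0 r) g)%E.
Proof. by rewrite int_mu_ball; apply: wint_ge0 => // y; rewrite lee_fin; exact: mulr_ge0. Qed.

(** On [B(0, r)] without the origin the average seen from [r] is bounded below, and the origin has
    weight 0. *)
Lemma int_mu_center :
  (int_mu a (ball0 r) g <= ((btrans_low_const a * 2^-1 `^ (a + 2^-1))^-1)%:E *
    wint w (fun z => (g z)%:E * btrans a (ind_ball (3 * r)) r z))%E.
Proof.
have mP := @measurable_btrans_ball R a ha r.
have mP' : measurable_fun setT (fun z => btrans a (ind_ball (3 * r)) r z).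
  exact: (measurableT_comp mP (measurable_pair1 (3 * r))).
have c0 : 0 < btrans_low_const a * 2^-1 `^ (a + 2^-1).
  by apply: mulr_gt0; [exact: btrans_low_const_gt0|exact: powR_gt0].
have B0 z : (0 <= btrans a (ind_ball (3 * r)) r z)%E by exact: btrans_ge0.
have gE z : (0 <= (g z)%:E)%E by rewrite lee_fin.
have := @btrans_ball_center R a ha r.
move: (btrans a (ind_ball (3 * r)) r) (btrans_low_const a * _) c0 mP' B0 => B c c0 mB B0 hB.
have c1 : 0 <= c^-1 by rewrite invr_ge0 ltW.
rewrite int_mu_ball -wintZl ?lee_fin//; last 2 first.
- by move=> z; rewrite mule_ge0.
- by measurability.
apply: ge0_leint => z _; first by rewrite mule_ge0 ?lee_fin//; exact: mulr_ge0.
have [->|z0] := eqVneq z 0; first by rewrite w_alpha_0// !mule0.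
apply: lee_wpmul2r; first by rewrite lee_fin.
rewrite /ind_ball; case: ifP => zr; last by rewrite mul0r; apply: mule_ge0; rewrite ?mule_ge0 ?lee_fin.
rewrite mul1r muleCA; apply: (@le_trans _ _ ((g z)%:E * (c^-1%:E * c%:E))%E).
  by rewrite -(EFinM c^-1 c) mulVf ?gt_eqF// mule1.
by apply: lee_wpmul2l => //; apply: lee_wpmul2l; [rewrite lee_fin|exact: hB].
Qed.

Hypothesis gloc : forall t : R, 0 < t -> (int_mu a (ball0 t) g < +oo)%E.

Lemma int_mu_dunkl_tau_ge0 x : (0 <= int_mu a (ball0 r) (dunkl_tau a x g))%E.
Proof.
have [->|x0] := eqVneq x 0; first by rewrite int_mu_dunkl_tau0.
rewrite int_mu_dunkl_tau//; apply: wint_ge0 => // z; apply: wint_ge0 => // y.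
exact: dint_ge0 (e0 x).
Qed.

(** [dkernel_even] is at most twice the Bessel kernel; the factor 4 is the constant that
    [morrey_bound] expects from both translations. *)
Lemma int_mu_dunkl_tau_le x : x != 0 -> (int_mu a (ball0 r) (dunkl_tau a x g) <=
  4%:E * wint w (fun z => (g z)%:E * btrans a (ind_ball r) x z))%E.
Proof.
move=> x0; rewrite int_mu_dunkl_tau//.
apply: (@le_trans _ _ (dint (fun y z => bkernel a x y z + bkernel a x y z))).
  by apply: le_dint => // y z; have /andP[_] := dkernel_even_bounds ha x y z; lra.
rewrite dintD// dint_bkernel.
have := ball_ge0 x; move: (wint _ _) => I I0.
rewrite (_ : 4%:E = 1 + (1 + (1 + 1)))%E; last by rewrite -!EFinD; congr EFin; lra.
by rewrite !ge0_muleDl ?adde_ge0// !mul1e addeA leeDl// adde_ge0.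
Qed.

Lemma int_mu_dunkl_tau_ge x : (wint w (fun z => (g z)%:E * btrans a (ind_ball r) x z) <=
  int_mu a (ball0 r) (dunkl_tau a x g) + int_mu a (ball0 r) (dunkl_tau a (- x) g))%E.
Proof.
have [->|x0] := eqVneq x 0.
  rewrite (_ : wint _ _ = 0)%E.
    by rewrite oppr0 int_mu_dunkl_tau0 adde_ge0.
  by apply: integral0_eq => z _; rewrite btrans0 mule0 mul0e.
have xN0 : - x != 0 by rewrite oppr_eq0.
have h1 : _ = dint (dkernel_even a x) := int_mu_dunkl_tau ha g0 mg gloc r0 x0.
have h2 : _ = dint (dkernel_even a (- x)) := int_mu_dunkl_tau ha g0 mg gloc r0 xN0.
rewrite [X in (_ <= X + _)%E]h1 [X in (_ <= _ + X)%E]h2.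
rewrite -(dintD (e0 x) (e0 (- x)) (me x) (me (- x))) -dint_bkernel.
apply: le_dint => // y z.
by rewrite dkernel_evenN; have := bk0 x y z; lra.
Qed.

End fixed_function.

Section potential.
Variables (rho f : R -> R).
Hypothesis rho_pos : forall r : R, 0 < r -> 0 < rho r.
Hypothesis rho_meas : measurable_fun (`]0, +oo[ : set R) rho.
Local Notation K := (rho_kernel a rho).

Let ha' : - 2^-1 <= a. Proof. exact: ltW. Qed.
Let K0 : forall u, 0 <= K u. Proof. exact: rho_kernel_ge0. Qed.
Let mK : measurable_fun setT K. Proof. exact: measurable_rho_kernel. Qed.

(** Absolute values are taken in the outer and the inner integral; the four terms of the kernel,
    each at most [bkernel], give the 4. *)
Lemma T_rho_le x : x != 0 -> measurable_fun setT f ->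
  (`|T_rho a rho f x|%:E <= 4%:E * wint w (fun y => (`|f y|%:E * btrans a K x y)))%E.
Proof.
move=> x0 mf; have mP := measurable_fun_pair2 x (measurable_btrans ha K0 mK).
have mP' : measurable_fun setT (fun y => btrans a K x y) by exact: mP.
have P0 y : (0 <= btrans a K x y)%E by exact: btrans_ge0.
have f0 y : (0 <= `|f y|%:E)%E by rewrite lee_fin.
rewrite -wintZl//; last 2 first.
- by move=> y; rewrite mule_ge0.
- by measurability.
rewrite /T_rho /Rint_mu; apply: le_trans (norm_Rintegral_le _ _) _.
apply: ge0_leint => y _; first by rewrite lee_fin.
rewrite -mulrA (dunkl_tau_dkernel ha y K x0) normrM [X in (_ * X)%:E]normrM (ger0_norm (w0 y)).
rewrite EFinM EFinM muleA; apply: lee_wpmul2r; first by rewrite lee_fin.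
rewrite muleCA; apply: lee_wpmul2l => //.
apply: le_trans (norm_Rintegral_le _ _) _.
rewrite /btrans -wintZl//.
- apply: ge0_leint => z _; first by rewrite lee_fin.
  rewrite -!EFinM lee_fin normrM [X in X * _]normrM (ger0_norm (w0 z)) (ger0_norm (K0 z)).
  apply: ler_wpM2r => //; rewrite mulrCA; apply: ler_wpM2l => //; exact: dkernel_le.
- by move=> z; rewrite lee_fin; apply: mulr_ge0.
- apply/measurable_EFinP; apply: measurable_funM => //.
  by apply: measurable_bkernel; measurability.
Qed.

Lemma measurable_T_rho : measurable_fun setT f -> measurable_fun setT (T_rho a rho f).
Proof.
move=> mf.
have mI : measurable_fun setT (fun q : R * R =>
    Rintegral leb setT (fun z => K z * dkernel a q.1 q.2 z * w z)).
  apply: (measurable_fine_integral (H := fun (q : R * R) z => K z * dkernel a q.1 q.2 z * w z)).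
  have m1 : measurable_fun setT (fun q : (R * R) * R => K q.2) by exact: measurableT_comp.
  have m2 : measurable_fun setT (fun q : (R * R) * R => w q.2) by exact: measurableT_comp.
  have m3 : measurable_fun setT (fun q : (R * R) * R => dkernel a q.1.1 q.1.2 q.2).
    by apply: measurable_dkernel; measurability.
  by measurability.
(* The kernel formula does not describe the translation at [x = 0], but a single point does not
   affect measurability. *)
rewrite (_ : T_rho a rho f = fun x => if x == 0 then T_rho a rho f 0 else
    Rintegral leb setT (fun y => f y *
      Rintegral leb setT (fun z => K z * dkernel a x y z * w z) * w y)).
  apply: measurable_fun_ifT => //; first by measurability.
  apply: (measurable_fine_integral (H := fun x y => f y *
      Rintegral leb setT (fun z => K z * dkernel a x y z * w z) * w y)).
  have m1 : measurable_fun setT (fun q : R * R => f q.2) by exact: measurableT_comp.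
  have m2 : measurable_fun setT (fun q : R * R => w q.2) by exact: measurableT_comp.
  by measurability.
apply/funext => x; case: eqVneq => [->//|x0].
rewrite /T_rho /Rint_mu; apply: eq_Rintegral => y _.
by rewrite -mulrA (dunkl_tau_dkernel ha y K x0) mulrA.
Qed.

End potential.
End dunkl_average_bounds.

(** * Averages and the potential for alpha = -1/2 *)

Section classical_average.
Context {R : realType}.
Local Notation leb := (@lebesgue_measure R).
Local Notation a := (- 2^-1 : R).
Local Notation w := (w_alpha a).
Let a1 : -1 < a. Proof. by lra. Qed.
Let w0 x : 0 <= w x. Proof. exact: w_alpha_ge0. Qed.
Let mw : measurable_fun setT w. Proof. exact: measurable_w_alpha. Qed.
Let i0 := @ind_ball_ge0 R.
Let mind t : measurable_fun setT (@ind_ball R t).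
Proof. by rewrite /ind_ball; measurability. Qed.

Lemma dunkl_tau_classical (x : R) (g : R -> R) : dunkl_tau a x g = fun y => g (x + y).
Proof. by apply/funext => y; rewrite /dunkl_tau eqxx. Qed.

Section fixed_function.
Variables (g : R -> R) (r : R).
Hypothesis g0 : forall y, 0 <= g y.
Hypothesis mg : measurable_fun setT g.
Hypothesis r0 : 0 < r.

Lemma int_mu_translation_ge0 x : (0 <= int_mu a (ball0 r) (dunkl_tau a x g))%E.
Proof.
rewrite dunkl_tau_classical int_mu_ball; apply: wint_ge0 => // y.
by rewrite lee_fin; exact: mulr_ge0.
Qed.

Let translated x : int_mu a (ball0 r) (dunkl_tau a x g) =
  wint w (fun z => (g z * ind_ball r (x - z))%:E).
Proof.
have mi : measurable_fun setT (fun z : R => ind_ball r (x - z)).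
  by apply: (measurableT_comp (mind r)); measurability.
have m1 : measurable_fun setT (fun y : R => ind_ball r y * g (x + y)).
  by apply: measurable_funM => //; apply: (measurableT_comp mg); apply: measurable_funD.
rewrite dunkl_tau_classical int_mu_ball !wint_classical.
- congr (_ * _)%E.
  rewrite -(integral_translate (f := fun z => (g z * ind_ball r (x - z))%:E) x).
  + by apply: eq_integral => y _; rewrite opprD addNKr /ind_ball normrN mulrC.
  + by measurability.
  + by move=> z; rewrite lee_fin; exact: mulr_ge0.
- by move=> z; rewrite lee_fin; exact: mulr_ge0.
- by measurability.
- by move=> z; rewrite lee_fin; exact: mulr_ge0.
- by measurability.
Qed.

Lemma int_mu_translationD x :
  (int_mu a (ball0 r) (dunkl_tau a x g) + int_mu a (ball0 r) (dunkl_tau a (- x) g) =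
   wint w (fun z => (g z)%:E * sym_trans (ind_ball r) x z))%E.
Proof.
have mi u : measurable_fun setT (fun z : R => ind_ball r (u - z)).
  by apply: (measurableT_comp (mind r)); measurability.
have m1 := mi x; have m2 := mi (- x).
rewrite [X in (X + _)%E]translated [X in (_ + X)%E]translated -wintD//.
- apply: eq_integral => z _; congr (_ * _)%E; rewrite -EFinD -EFinM; congr EFin.
  by rewrite -mulrDr addrC -opprD {1}/ind_ball normrN.
- by move=> z; rewrite lee_fin; exact: mulr_ge0.
- by move=> z; rewrite lee_fin; exact: mulr_ge0.
- by measurability.
- by measurability.
Qed.

Let le_four (I J : \bar R) : (0 <= I)%E -> (0 <= J)%E -> (I <= 4%:E * (I + J))%E.
Proof.
move=> I0 J0; rewrite (_ : 4%:E = 1 + 3%:E)%E; last by rewrite -EFinD; congr EFin; lra.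
by rewrite ge0_muleDl ?lee_fin// mul1e -addeA leeDl// adde_ge0// mule_ge0 ?adde_ge0 ?lee_fin.
Qed.

Lemma int_mu_translation_le x : (int_mu a (ball0 r) (dunkl_tau a x g) <=
  4%:E * wint w (fun z => (g z)%:E * sym_trans (ind_ball r) x z))%E.
Proof.
by rewrite -int_mu_translationD; apply: le_four; exact: int_mu_translation_ge0.
Qed.

(** For [|z| < r] the point [r - z] has modulus below [2 r], so one of the two indicators is already
    1. *)
Lemma int_mu_translation_center : (int_mu a (ball0 r) g <=
  wint w (fun z => (g z)%:E * sym_trans (ind_ball (3 * r)) r z))%E.
Proof.
rewrite int_mu_ball; apply: le_wint => // z; first by rewrite lee_fin; exact: mulr_ge0.
rewrite -EFinM lee_fin mulrC; apply: ler_wpM2l => //.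
rewrite {1}/ind_ball; case: ifP => zr; last by rewrite addr_ge0.
suff e : ind_ball (3 * r) (r - z) = 1 by rewrite e lerDr.
rewrite /ind_ball ifT//; move: zr; rewrite !ltr_norml => /andP[? ?].
by apply/andP; split; lra.
Qed.

End fixed_function.

Section potential.
Variables (rho f : R -> R).
Hypothesis rho_pos : forall r : R, 0 < r -> 0 < rho r.
Hypothesis rho_meas : measurable_fun (`]0, +oo[ : set R) rho.
Local Notation K := (rho_kernel a rho).
Let K0 : forall u, 0 <= K u. Proof. exact: rho_kernel_ge0. Qed.
Let mK : measurable_fun setT K. Proof. exact: measurable_rho_kernel. Qed.

Lemma T_rho_classical_le x : (`|T_rho a rho f x|%:E <=
  4%:E * wint w (fun y => (`|f y|%:E * sym_trans K x y)))%E.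
Proof.
have I0 : (0 <= wint w (fun y => (`|f y|%:E * sym_trans K x y)))%E.
  by apply: wint_ge0 => // y; rewrite mule_ge0 ?lee_fin ?addr_ge0.
apply: (@le_trans _ _ (wint w (fun y => (`|f y|%:E * sym_trans K x y)%E))).
  rewrite /T_rho /Rint_mu; apply: le_trans (norm_Rintegral_le _ _) _.
  apply: ge0_leint => y _; first by rewrite lee_fin.
  rewrite dunkl_tau_classical normrM [X in (X * _)%:E]normrM (ger0_norm (w0 y)).
  rewrite (ger0_norm (K0 _)) -!EFinM lee_fin; apply: ler_wpM2r => //.
  by apply: ler_wpM2l => //; rewrite lerDl.
move: (wint _ _) I0 => I I0.
rewrite (_ : 4%:E = 1 + 3%:E)%E; last by rewrite -EFinD; congr EFin; lra.
by rewrite ge0_muleDl ?lee_fin// mul1e leeDl// mule_ge0 ?lee_fin.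
Qed.

Lemma measurable_T_rho_classical :
  measurable_fun setT f -> measurable_fun setT (T_rho a rho f).
Proof.
move=> mf; apply: (measurable_fine_integral (H := fun x y => f y * dunkl_tau a x K y * w y)).
under eq_fun do rewrite dunkl_tau_classical.
have m1 : measurable_fun setT (fun q : R * R => f q.2) by exact: measurableT_comp.
have m2 : measurable_fun setT (fun q : R * R => w q.2) by exact: measurableT_comp.
have m3 : measurable_fun setT (fun q : R * R => K (q.1 + q.2)).
  by apply: (measurableT_comp mK); measurability.
by apply: measurable_funM => //; exact: measurable_funM.
Qed.

End potential.
End classical_average.

(** * From kernel averages to Morrey norms *)

Section morrey_bound.
Context {R : realType}.
Local Notation leb := (@lebesgue_measure R).
Variables (a : R) (phi psi rho : R -> R).
Hypothesis ha : - 2^-1 <= a.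
Hypothesis phi_pos : forall r : R, 0 < r -> 0 < phi r.
Hypothesis psi_pos : forall r : R, 0 < r -> 0 < psi r.
Hypothesis psi_doubling : doubling psi.
Local Notation K := (rho_kernel a rho).
Local Notation w := (w_alpha a).
Local Notation d := (d_alpha a).
Local Notation mean x r g := (int_mu a (ball0 r) (dunkl_tau a x g)).

Let a1 : -1 < a. Proof. by have := ha; lra. Qed.
Let w0 x : 0 <= w x. Proof. exact: w_alpha_ge0. Qed.
Let mw : measurable_fun setT w. Proof. exact: measurable_w_alpha. Qed.

(** Solves one term of the Morrey norm for its integral, with [b] the value of [phi] or [psi] at [r]
    and [c = r^d]. For [J = +oo] both sides are false. *)
Lemma morrey_term_le (J : \bar R) (b c M p : R) : (0 <= J)%E -> 0 < b -> 0 < c -> 0 <= M -> 0 < p ->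
  ((b^-1%:E * poweR (c^-1%:E * J) p^-1 <= M%:E)%E = (J <= ((M * b) `^ p * c)%:E)%E).
Proof.
move=> + b0 c0 M0 p0; have b1 : 0 < b^-1 by rewrite invr_gt0.
have c1 : 0 < c^-1 by rewrite invr_gt0.
have p1 : 0 < p^-1 by rewrite invr_gt0.
case: J => [j| |]// j0; last first.
  rewrite gt0_muley ?lte_fin// poweRyr ?gt_eqF// gt0_muley ?lte_fin//.
rewrite -(EFinM c^-1 j) poweR_EFin -EFinM !lee_fin ler_pdivrMl// [b * M]mulrC.
rewrite -[RHS](ler_pdivrMr _ _ c0) [j / c]mulrC.
have j1 : 0 <= c^-1 * j by rewrite mulr_ge0// ltW.
have Mb : 0 <= M * b by rewrite mulr_ge0// ltW.
apply/idP/idP => h.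
  have -> : c^-1 * j = ((c^-1 * j) `^ p^-1) `^ p by rewrite -powRrM mulVf ?gt_eqF// powRr1.
  by apply: ge0_ler_powR; rewrite ?nnegrE ?powR_ge0 ?(ltW p0).
have -> : M * b = ((M * b) `^ p) `^ p^-1 by rewrite -powRrM mulfV ?gt_eqF// powRr1.
by apply: ge0_ler_powR; rewrite ?nnegrE ?powR_ge0 ?(ltW p1).
Qed.

(** The estimates are stated for positive bounds [M], whereas the norm [N] may be 0; so [M] is taken
    slightly above [N]. *)
Lemma lee_of_upper_bounds (N N' : \bar R) (c : R) : 0 < c -> (0 <= N)%E -> (N < +oo)%E ->
  (forall M : R, 0 < M -> (N <= M%:E)%E -> (N' <= (c * M)%:E)%E) -> (N' <= c%:E * N)%E.
Proof.
move=> c0; case: N => [n| |]//; rewrite lee_fin => n0 _ h.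
apply/lee_addgt0Pr => e e0; have ec : 0 < e / c by exact: divr_gt0.
have := h (n + e / c) (ltr_wpDl n0 ec); rewrite lee_fin lerDl (ltW ec) => /(_ isT).
by rewrite mulrDr mulrCA divff ?gt_eqF// mulr1 EFinD EFinM.
Qed.

Lemma lty_upper_bound (N : \bar R) : (0 <= N)%E -> (N < +oo)%E ->
  exists M : R, 0 < M /\ (N <= M%:E)%E.
Proof.
case: N => [n| |]//; rewrite lee_fin => n0 _; exists (n + 1).
by rewrite lee_fin lerDl ler01 ltr_wpDl.
Qed.

Variable P : (R -> R) -> R -> R -> \bar R.
Variables C5 p : R.
Hypothesis C50 : 0 <= C5.
Hypothesis p1 : 1 < p.
Hypothesis P_ge0 : forall (h : R -> R) x y, (forall u, 0 <= h u) -> (0 <= P h x y)%E.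
Hypothesis P_meas_ball : forall r x, measurable_fun setT (P (ind_ball r) x).
Hypothesis P_meas_kernel : measurable_fun setT (fun q : R * R => P K q.1 q.2).
Hypothesis K0 : forall u, 0 <= K u.
Hypothesis riesz : exists C : R, 0 < C /\ forall (g : R -> R) (M : R),
    (forall y, 0 <= g y) -> measurable_fun setT g -> 0 < M ->
    (forall t x : R, 0 < t ->
       (wint w (fun y => (g y `^ p)%:E * P (ind_ball t) x y) <=
        ((M * phi t) `^ p * t `^ d)%:E)%E) ->
    forall r x : R, 0 < r ->
       (wint w (fun z => poweR (wint w (fun y => (g y)%:E * P K z y)) p * P (ind_ball r) x z) <=
        (C * (M * psi r) `^ p * r `^ d)%:E)%E.
Hypothesis mean0 : forall (g : R -> R) r, mean 0 r g = int_mu a (ball0 r) g.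
Hypothesis mean_ge0 : forall (g : R -> R) r x, (forall y, 0 <= g y) -> measurable_fun setT g ->
  0 < r -> (forall t : R, 0 < t -> (int_mu a (ball0 t) g < +oo)%E) -> (0 <= mean x r g)%E.
Hypothesis mean_le : forall (g : R -> R) r x, (forall y, 0 <= g y) -> measurable_fun setT g ->
  0 < r -> (forall t : R, 0 < t -> (int_mu a (ball0 t) g < +oo)%E) -> x != 0 ->
  (mean x r g <= 4%:E * wint w (fun z => (g z)%:E * P (ind_ball r) x z))%E.
Hypothesis mean_ge : forall (g : R -> R) r x, (forall y, 0 <= g y) -> measurable_fun setT g ->
  0 < r -> (forall t : R, 0 < t -> (int_mu a (ball0 t) g < +oo)%E) ->
  (wint w (fun z => (g z)%:E * P (ind_ball r) x z) <= mean x r g + mean (- x) r g)%E.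
Hypothesis int_le : forall (g : R -> R) r, (forall y, 0 <= g y) -> measurable_fun setT g ->
  0 < r -> (int_mu a (ball0 r) g <=
    C5%:E * wint w (fun z => (g z)%:E * P (ind_ball (3 * r)) r z))%E.
(** The condition on the weight exempts the origin when [a > -1/2], where no kernel bound is
    available; at [a = -1/2] the weight is a positive constant and exempts no point. *)
Hypothesis T_le : forall (f : R -> R) x, w x != 0 -> measurable_fun setT f ->
  (`|T_rho a rho f x|%:E <= 4%:E * wint w (fun y => (`|f y|%:E * P K x y)))%E.
Hypothesis T_meas : forall f : R -> R,
  measurable_fun setT f -> measurable_fun setT (T_rho a rho f).

Let p0 : 0 < p := lt_trans ltr01 p1.
Let ib0 := @ind_ball_ge0 R.

Lemma potential_average_le : exists C : R, 0 < C /\ forall (f : R -> R) (M : R),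
  loc_p_integrable a p f -> 0 < M -> (morrey_norm a p phi f <= M%:E)%E ->
  forall r x : R, 0 < r ->
    (wint w (fun z => (`|T_rho a rho f z| `^ p)%:E * P (ind_ball r) x z) <=
     (C * (M * psi r) `^ p * r `^ d)%:E)%E.
Proof.
have [C [C0 hC]] := riesz.
exists (4 `^ p * (2 * C)); split; first by rewrite !mulr_gt0// powR_gt0.
move=> f M [mf floc] M0 hM r x r0.
pose g y := `|f y|.
have g0 y : 0 <= g y by exact: normr_ge0.
have mg : measurable_fun setT g by rewrite /g; measurability.
have mgp : measurable_fun setT (fun y => g y `^ p) by measurability.
have gp0 y : 0 <= g y `^ p by exact: powR_ge0.
(* Absorbs the factor 2 that comes from adding the averages at [y] and [-y]. *)
pose M' := 2 `^ p^-1 * M.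
have M'0 : 0 < M' by rewrite mulr_gt0// powR_gt0.
have M'E (b : R) : 0 < b -> (M' * b) `^ p = 2 * (M * b) `^ p.
  move=> b0; rewrite /M' -mulrA powRM ?mulr_ge0 ?powR_ge0 ?(ltW M0) ?(ltW b0)//.
  by rewrite -powRrM mulVf ?gt_eqF// powRr1.
have term (t y : R) : 0 < t -> (mean y t (fun z : R => (g z `^ p)%R) <= ((M * phi t) `^ p * t `^ d)%:E)%E.
  move=> t0; rewrite -morrey_term_le ?phi_pos ?powR_gt0 ?(ltW M0)//; last exact: mean_ge0.
  rewrite -powRN; apply: le_trans hM; apply: ereal_sup_ubound.
  by exists t => //; exists y.
have hyp t y : 0 < t -> (wint w (fun z => (g z `^ p)%:E * P (ind_ball t) y z) <=
    ((M' * phi t) `^ p * t `^ d)%:E)%E.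
  move=> t0; apply: le_trans (mean_ge y gp0 mgp t0 floc) _.
  rewrite M'E ?phi_pos// -mulrA mulr2n mulrDl mul1r EFinD.
  by apply: leeD; exact: term.
have := hC g M' g0 mg M'0 hyp r x r0.
pose Tg z := wint w (fun y => (g y)%:E * P K z y)%E.
have Tg0 z : (0 <= Tg z)%E by apply: wint_ge0 => // y; rewrite mule_ge0 ?lee_fin ?P_ge0.
have mTg : measurable_fun setT Tg.
  apply: (measurable_wint w0 mw (h := fun z y => (g y)%:E * P K z y)%E).
    by move=> z y; rewrite mule_ge0 ?lee_fin ?P_ge0.
  apply: emeasurable_funM => //; apply/measurable_EFinP; exact: measurableT_comp.
have PB0 z : (0 <= P (ind_ball r) x z)%E by exact: P_ge0.
have mPB := P_meas_ball r x.
rewrite -/Tg M'E ?psi_pos//.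
move=> h; apply: (@le_trans _ _ ((4 `^ p)%:E * wint w (fun z => poweR (Tg z) p * P (ind_ball r) x z))%E).
  rewrite -wintZl ?lee_fin ?powR_ge0//; last 2 first.
  - by move=> z; rewrite mule_ge0// poweR_ge0.
  - by measurability.
  apply: ge0_leint => z _; first by rewrite !mule_ge0 ?lee_fin ?powR_ge0.
  have [->|wz] := eqVneq (w z) 0; first by rewrite !mule0.
  apply: lee_wpmul2r; first by rewrite lee_fin.
  rewrite muleA; apply: lee_wpmul2r => //.
  rewrite -!poweR_EFin -poweRM ?lee_fin//.
  apply: gt0_ler_poweR; rewrite ?in_itv/= ?leey ?andbT ?lee_fin ?mule_ge0//; first exact: ltW.
  exact: T_le.
have := lee_wpmul2l (powR_ge0 4 p : (0 <= (4 `^ p)%:E)%E) h.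
by move=> h'; apply: le_trans h' _; rewrite -EFinM lee_fin le_eqVlt; apply/orP; left; apply/eqP; ring.
Qed.

Lemma doubling_triple : exists C : R, 0 < C /\ forall r : R, 0 < r -> psi (3 * r) <= C * psi r.
Proof.
have [C [C0 hC]] := doubling_le psi_pos psi_doubling.
exists (C * C); split; first exact: mulr_gt0.
move=> r r0; have h0 : 0 < 3 / 2 * r by rewrite mulr_gt0.
apply: (@le_trans _ _ (C * psi (3 / 2 * r))).
  apply: hC => //; first by rewrite mulr_gt0.
  have -> : 3 * r / (3 / 2 * r) = 2 by field; rewrite gt_eqF.
  by apply/andP; split; lra.
rewrite -[leRHS]mulrA; apply: ler_wpM2l; first exact: ltW.
apply: hC => //; have -> : 3 / 2 * r / r = 3 / 2 by field; rewrite gt_eqF.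
by apply/andP; split; lra.
Qed.

(** A centre [x != 0] is treated by the kernel average at [x]. The centre 0, and with it local
    integrability, uses the ball of radius [3 r] seen from [r], at the price of the tripling
    constant of [psi]. *)
Lemma morrey_bound : exists C : R, 0 < C /\ forall f : R -> R, morrey_space a p phi f ->
  morrey_space a p psi (T_rho a rho f) /\
  (morrey_norm a p psi (T_rho a rho f) <= C%:E * morrey_norm a p phi f)%E.
Proof.
have [C [C0 hC]] := potential_average_le.
have [Cp [Cp0 hCp]] := doubling_triple.
(* The first summand serves the centres [x != 0], the second the centre 0. *)
pose C6 : R := 4 * C + C5 * C * Cp `^ p * 3 `^ d.
have C7 : 0 <= C5 * C * Cp `^ p * 3 `^ d.
  by apply: mulr_ge0; rewrite ?powR_ge0//; apply: mulr_ge0; rewrite ?powR_ge0//; apply: mulr_ge0 => //; exact: ltW.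
have C60 : 0 < C6 by apply: ltr_wpDr => //; exact: mulr_gt0.
have key f M : loc_p_integrable a p f -> 0 < M -> (morrey_norm a p phi f <= M%:E)%E ->
    loc_p_integrable a p (T_rho a rho f) /\
    (morrey_norm a p psi (T_rho a rho f) <= (C6 `^ p^-1 * M)%:E)%E.
  move=> lf M0 hM; have [mf _] := lf.
  have hA := hC f M lf M0 hM.
  have mT := T_meas mf.
  pose g y := `|T_rho a rho f y| `^ p.
  have g0 y : 0 <= g y by exact: powR_ge0.
  have mg : measurable_fun setT g by rewrite /g; measurability.
  have hI r : 0 < r -> (int_mu a (ball0 r) g <=
      (C5 * (C * (M * psi (3 * r)) `^ p * (3 * r) `^ d))%:E)%E.
    move=> r0; apply: le_trans (int_le g0 mg r0) _; rewrite EFinM.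
    by apply: lee_wpmul2l; [rewrite lee_fin|apply: hA; rewrite mulr_gt0].
  have lT : loc_p_integrable a p (T_rho a rho f).
    by split => // r r0; apply: le_lt_trans (hI r r0) _; rewrite ltry.
  have [_ gloc] := lT.
  split => //; apply: ub_ereal_sup => _ [r r0 [x _ <-]].
  have r0' : 0 < r by [].
  have rd : 0 < r `^ d by exact: powR_gt0.
  have ps0 := psi_pos r0'.
  have Mps : 0 <= M * psi r by rewrite mulr_ge0// ltW.
  have e6 : (C6 `^ p^-1 * M * psi r) `^ p * r `^ d = C6 * ((M * psi r) `^ p * r `^ d).
    rewrite -mulrA powRM ?powR_ge0// -powRrM mulVf ?gt_eqF// powRr1 ?(ltW C60)//.
    by rewrite -mulrA.
  rewrite powRN morrey_term_le ?mulr_ge0 ?powR_ge0 ?(ltW M0)//; last exact: mean_ge0.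
  rewrite e6; have [->|x0] := eqVneq x 0.
    rewrite mean0; apply: le_trans (hI r r0') _; rewrite lee_fin.
    apply: (@le_trans _ _ (C5 * C * Cp `^ p * 3 `^ d * ((M * psi r) `^ p * r `^ d))); last first.
      by apply: ler_wpM2r; rewrite ?mulr_ge0 ?powR_ge0// /C6 lerDr mulr_ge0// ltW.
    have h1 : (M * psi (3 * r)) `^ p <= Cp `^ p * (M * psi r) `^ p.
      rewrite -powRM ?(ltW Cp0)//; apply: ge0_ler_powR; rewrite ?nnegrE ?(ltW p0)//.
      - by rewrite mulr_ge0 ?(ltW M0)// ltW// psi_pos// mulr_gt0.
      - by rewrite mulr_ge0 ?(ltW Cp0).
      - by rewrite mulrCA ler_pM2l// hCp.
    rewrite [(3 * r) `^ d]powRM ?(ltW r0')//.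
    have -> : C5 * C * Cp `^ p * 3 `^ d * ((M * psi r) `^ p * r `^ d) =
      C5 * (C * (Cp `^ p * (M * psi r) `^ p) * (3 `^ d * r `^ d)) by ring.
    apply: ler_wpM2l => //; apply: ler_wpM2r; first by rewrite mulr_ge0 ?powR_ge0.
    by apply: ler_wpM2l => //; exact: ltW.
  apply: le_trans (mean_le g0 mg r0' gloc x0) _.
  apply: le_trans (lee_wpmul2l _ (hA r x r0')) _; first by rewrite lee_fin.
  rewrite -(EFinM 4) lee_fin.
  have -> : 4 * (C * (M * psi r) `^ p * r `^ d) = 4 * C * ((M * psi r) `^ p * r `^ d) by ring.
  apply: ler_wpM2r.
    by rewrite mulr_ge0 ?powR_ge0.
  by rewrite /C6 lerDl.
exists (C6 `^ p^-1); split; first exact: powR_gt0.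
(* A supremum in [\bar R] could be negative a priori; the term with [r = 1] and [x = 0] excludes
   this. *)
move=> f [lf nlty]; have n0 : (0 <= morrey_norm a p phi f)%E.
  apply: le_trans (_ : (0 <= ((phi 1)^-1)%:E * poweR ((1 `^ (- d))%:E *
     mean 0 1 (fun z : R => (`|f z| `^ p)%R)) p^-1)%E) _.
    by rewrite mule_ge0 ?poweR_ge0// lee_fin invr_ge0 ltW// phi_pos.
  by apply: ereal_sup_ubound; exists 1 => //=; exists 0.
have [M [M0 hM]] := lty_upper_bound n0 nlty.
have [lT nT] := key f M lf M0 hM.
split; first exact: (conj lT (le_lt_trans nT (ltry _))).
apply: (lee_of_upper_bounds _ n0 nlty); first exact: powR_gt0.
move=> N N0 hN; exact: (key f N lf N0 hN).2.
Qed.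

End morrey_bound.

Theorem theorem3p3 (R : realType) (a : R) (phi psi rho : R -> R)
  (ha : - 2^-1 <= a)
  (phi_pos : forall r : R, 0 < r -> 0 < phi r)
  (psi_pos : forall r : R, 0 < r -> 0 < psi r)
  (rho_pos : forall r : R, 0 < r -> 0 < rho r)
  (phi_doubling : doubling phi)
  (psi_doubling : doubling psi)
  (rho_doubling : doubling rho)
  (phi_meas : measurable_fun (`]0, +oo[ : set R) phi)
  (rho_meas : measurable_fun (`]0, +oo[ : set R) rho)
  (rho_int : (\int[@lebesgue_measure R]_(t in `]0%R, 1%R[) (rho t / t)%:E < +oo)%E)
  (hcond : exists C : R, 0 < C /\ forall r : R, 0 < r ->
      ((phi r)%:E * (\int[@lebesgue_measure R]_(t in `]0%R, r[) (rho t / t)%:E)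
       + \int[@lebesgue_measure R]_(t in `]r, +oo[) (rho t * phi t / t)%:E
       <= (C * psi r)%:E)%E) :
  forall p : R, 1 < p ->
    exists C : R, 0 < C /\
      forall f : R -> R, morrey_space a p phi f ->
        morrey_space a p psi (T_rho a rho f) /\
        (morrey_norm a p psi (T_rho a rho f) <= C%:E * morrey_norm a p phi f)%E.
Proof.
move=> p p1; have K0 u : 0 <= rho_kernel a rho u by exact: rho_kernel_ge0.
have mK := measurable_rho_kernel ha rho_meas.
have mib r : measurable_fun setT (@ind_ball R r) by rewrite /ind_ball; measurability.
(* At [a = -1/2] the constant [D_alpha] involves Gamma at 0, so the sum of two translates replaces
   the Bessel translation, with mass and comparison constants 2 and centre constant 1. *)
move: (ha); rewrite le_eqVlt => /predU1P[ea|a_gt].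
  subst a.
  have riesz := @riesz_bound _ _ phi psi rho ha phi_pos psi_pos rho_pos phi_doubling
    rho_doubling phi_meas rho_meas hcond sym_trans 2 2 (ltr0n _ 2) (ler0n _ 2) (@sym_trans_ge0 R)
    (@sym_transC R) (@sym_trans_tail R) (fun h _ => @measurable_sym_trans R h)
    (@measurable_sym_trans_ball R) (@sym_trans_mass R) (@sym_trans_ball_transfer R) p p1.
  apply: (@morrey_bound _ _ phi psi rho ha phi_pos psi_pos psi_doubling sym_trans 1 p ler01 p1
    (@sym_trans_ge0 R) _ _ K0 riesz).
  - by move=> r x; exact: (measurable_fun_pair2 x (measurable_sym_trans (mib r))).
  - exact: measurable_sym_trans.
  - move=> g r; rewrite dunkl_tau_classical; congr int_mu.
    by apply/funext => y; rewrite add0r.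
  - by move=> g r x g0 mg r0 _; exact: int_mu_translation_ge0.
  - by move=> g r x g0 mg r0 _ _; exact: int_mu_translation_le.
  - by move=> g r x g0 mg r0 _; rewrite int_mu_translationD.
  - by move=> g r g0 mg r0; rewrite mul1e; exact: int_mu_translation_center.
  - by move=> f x _ _; exact: T_rho_classical_le.
  - by move=> f; exact: measurable_T_rho_classical.
have riesz := @riesz_bound _ _ phi psi rho ha phi_pos psi_pos rho_pos phi_doubling
  rho_doubling phi_meas rho_meas hcond (btrans a) _ _ (btrans_mass_const_gt0 a_gt)
  (btrans_cmp_const_ge0 a_gt) (btrans_ge0 a_gt) (fun h x y _ => btransC a h x y)
  (btrans_tail a_gt) (measurable_btrans a_gt) (measurable_btrans_ball a_gt)
  (btrans_mass a_gt) (btrans_ball_transfer a_gt) p p1.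
have c0 : 0 <= (btrans_low_const a * 2^-1 `^ (a + 2^-1))^-1.
  rewrite invr_ge0; apply: mulr_ge0; last exact: powR_ge0.
  by apply: ltW; exact: btrans_low_const_gt0.
apply: (@morrey_bound _ _ phi psi rho ha phi_pos psi_pos psi_doubling (btrans a) _ p c0 p1
  (btrans_ge0 a_gt) _ _ K0 riesz).
- by move=> r x; exact: (measurable_fun_pair2 x (measurable_btrans a_gt (@ind_ball_ge0 R r) (mib r))).
- exact: measurable_btrans.
- by move=> g r; exact: int_mu_dunkl_tau0.
- by move=> g r x g0 mg r0 gl; exact: int_mu_dunkl_tau_ge0.
- by move=> g r x g0 mg r0 gl x0; exact: int_mu_dunkl_tau_le.
- by move=> g r x g0 mg r0 gl; exact: int_mu_dunkl_tau_ge.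
- by move=> g r g0 mg r0; exact: int_mu_center.
- move=> f x wx mf; apply: (T_rho_le a_gt) mf => //.
  by apply: contraNneq wx => ->; rewrite w_alpha_0.
- by move=> f; exact: measurable_T_rho.
Qed.
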